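(* Let $\alpha > -1$ and $0< \sigma < \alpha+1$. Assume that $1\le p,q\le \infty$. Then (i) $L^p(dw_{\alpha}) \subset \mathrm{Dom}\, \mathbb{I}^{\alpha,\sigma}$ if and only if $p<\frac{\alpha+1}{\sigma}$; (ii) $\mathbb{I}^{\alpha,\sigma}$ is bounded from $L^p(dw_{\alpha})$ to $L^q(dw_{\alpha})$ if and only if $$\frac{1}q = \frac{1}p - \frac{\sigma}{\alpha+1} \quad \text{and} \quad 1 < p < \frac{\alpha+1}{\sigma} \quad \text{and} \quad \alpha \ge -1/2;$$ (iii) $\mathbb{I}^{\alpha,\sigma}$ is bounded from $L^1(dw_{\alpha})$ to weak $L^q(dw_{\alpha})$ for $q=\frac{\alpha+1}{\alpha+1-\sigma}$ if and only if $\alpha \ge -1/2$.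
   Context: For $\alpha>-1$ let $dw_\alpha(x)=|x|^{2\alpha+1}dx$ on $\mathbb R$, let $I_\alpha$ denote the modified Bessel function of the first kind of order $\alpha$, and for $t,x,y>0$ let $$W_t^{\alpha}(x,y)=\frac{1}{2t}\exp\Big(-\frac{x^2+y^2}{4t}\Big)(xy)^{-\alpha}I_\alpha\Big(\frac{xy}{2t}\Big),$$ extended to $x=0$ or $y=0$ by taking limits. Define $$\mathbb W_t^{\alpha}(x,y)=\frac12\Big[W_t^{\alpha}(|x|,|y|)+xy\,W_t^{\alpha+1}(|x|,|y|)\Big],\qquad x,y\in\mathbb R,\ t>0,$$ $$\mathbb K^{\alpha,\sigma}(x,y)=\frac1{\Gamma(\sigma)}\int_0^\infty \mathbb W_t^{\alpha}(x,y)\,t^{\sigma-1}\,dt,\qquad \mathbb I^{\alpha,\sigma}f(x)=\int_{\mathbb R}\mathbb K^{\alpha,\sigma}(x,y)f(y)\,dw_\alpha(y),\qquad x,y\in\mathbb R.$$ The natural domain $\mathrm{Dom}\,\mathbb I^{\alpha,\sigma}$ consists of those functions $f$ on $\mathbb R$ for which the last integral converges for a.e. $x\in\mathbb R$. Boundedness between function spaces means that the operator is defined on the whole source space and the corresponding (quasi-)norm inequality holds with a uniform constant. Convention: $1/\infty=0$. *)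

(* Defs.v *)
From HB Require Import structures.
From mathcomp Require Import all_boot all_order all_algebra.
From mathcomp Require Import all_classical all_reals all_analysis.
From mathcomp Require Import measurable_realfun.

Set Implicit Arguments.
Unset Strict Implicit.
Unset Printing Implicit Defensive.
Import Order.TTheory GRing.Theory Num.Theory.
Import numFieldNormedType.Exports.
Local Open Scope classical_set_scope.
Local Open Scope ring_scope.

(* The density at the single point x = 0 is 0 `^ (2 * alpha + 1), which powR
   makes finite (0 or 1) even when the exponent is negative; {0} is a null
   set. *)
Definition dw {R : realType} (alpha : R) : set (measurableTypeR R) -> \bar R :=
  fun A => (\int[lebesgue_measure]_(x in A) (`|x| `^ (2 * alpha + 1))%:E)%E.

Section dw_measure.
Variables (R : realType) (alpha : R).

Let dw0 : dw alpha set0 = 0%E.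
Proof. by rewrite /dw integral_set0. Qed.

Let dw_ge0 A : (0 <= dw alpha A)%E.
Proof. by apply: integral_ge0 => x _; rewrite lee_fin powR_ge0. Qed.

Let dw_sigma_additive : semi_sigma_additive (dw alpha).
Proof.
apply: semi_sigma_additive_nng_induced.
  apply/measurable_EFinP.
  by apply: (measurableT_comp (measurable_powR _)); exact: measurable_realfun.normr_measurable.
by move=> x; rewrite lee_fin powR_ge0.
Qed.

HB.instance Definition _ :=
  isMeasure.Build _ _ _ (dw alpha) dw0 dw_ge0 dw_sigma_additive.

End dw_measure.

Section potential_operator.
Context {R : realType}.
Implicit Types (alpha sigma s t x y z : R) (p q : \bar R) (f : R -> R).

(* Euler's integral; it is only used for s > 0. *)
Definition Gamma s : R :=
  \int[lebesgue_measure]_(t in `]0, +oo[) (t `^ (s - 1) * expR (- t)).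

(* Modified Bessel function of the first kind; only used for alpha > -1 and
   z > 0. *)
Definition besselI alpha z : R :=
  limn (series (fun k : nat =>
    (z / 2) `^ (2 * k%:R + alpha) / (k`!%:R * Gamma (k%:R + alpha + 1)))).

Definition W_pos alpha t x y : R :=
  (2 * t)^-1 * expR (- (x ^+ 2 + y ^+ 2) / (4 * t)) *
  (x * y) `^ (- alpha) * besselI alpha (x * y / (2 * t)).

(* Limits at boundary points of the quadrant x, y >= 0 are taken from its
   interior. *)
Definition W alpha t x y : R :=
  if (0 < x) && (0 < y) then W_pos alpha t x y
  else lim ((fun z : R * R => W_pos alpha t z.1 z.2) @
            within [set z : R * R | 0 < z.1 /\ 0 < z.2] (nbhs (x, y))).

Definition WW alpha t x y : R :=
  2^-1 * (W alpha t `|x| `|y| + x * y * W (alpha + 1) t `|x| `|y|).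

(* Extended-real valued: the integral is infinite at some points, e.g. at
   x = y when sigma <= 1/2. *)
Definition KK alpha sigma x y : \bar R :=
  (((Gamma sigma)^-1)%:E *
   \int[lebesgue_measure]_(t in `]0%R, +oo[)
     (WW alpha t x y * t `^ (sigma - 1))%:E)%E.

Definition II alpha sigma f (x : R) : \bar R :=
  (\int[dw alpha]_y (KK alpha sigma x y * (f y)%:E))%E.

Definition Dom_II alpha sigma : set (R -> R) :=
  [set f | {ae lebesgue_measure, forall x : R,
    (dw alpha).-integrable setT (fun y => KK alpha sigma x y * (f y)%:E)%E}].

(* For f in Dom_II, II f is only meaningful a.e.; its values on the remaining
   null set affect neither 'N[dw alpha]_q nor the weak quasi-norm below. *)
Definition II_bounded alpha sigma p q : Prop :=
  [set` Lfun (dw alpha) p] `<=` Dom_II alpha sigma /\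
  exists C : R, forall f, f \in Lfun (dw alpha) p ->
    measurable_fun setT (II alpha sigma f) /\
    ('N[dw alpha]_q [II alpha sigma f] <= C%:E * 'N[dw alpha]_p [EFin \o f])%E.

Definition weakLnorm alpha (q : R) (g : R -> \bar R) : \bar R :=
  ereal_sup [set (l%:E * dw alpha [set x | l%:E < `|g x|] `^ q^-1)%E
            | l in [set l : R | 0 < l]].

Definition II_weak_bounded alpha sigma p (q : R) : Prop :=
  [set` Lfun (dw alpha) p] `<=` Dom_II alpha sigma /\
  exists C : R, forall f, f \in Lfun (dw alpha) p ->
    measurable_fun setT (II alpha sigma f) /\
    (weakLnorm alpha q (II alpha sigma f) <= C%:E * 'N[dw alpha]_p [EFin \o f])%E.

End potential_operator.

(* Main.v *)
Require Import Defs.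
From HB Require Import structures.
From mathcomp Require Import all_boot all_order all_algebra.
From mathcomp Require Import all_classical all_reals all_analysis.
From mathcomp Require Import measurable_realfun ess_sup_inf ring lra.

(** Put N = alpha + 1, s = sigma and mu = dw alpha.  With u = x y / (4 t) and
    F_a(v) the sum over k of v^k / (k! Gamma(k + a + 1)), the kernel is, for t > 0
    and off the axes,
      WW_t(x,y) = (4 t)^(-N) exp(- (x^2 + y^2) / (4 t)) [F_alpha(u^2) + u F_(alpha+1)(u^2)].
    Its part even in y, called [bheat] below, is positive, symmetric and of mass 1
    ([bheat_mass]).  A termwise arithmetic-geometric mean inequality bounds the odd
    part by a multiple of the even one ([bessel_series_shift_le]), while for
    x y >= 0 the odd part is nonnegative.  Hence the potential operator is dominated
    by the one built on [bheat] ([abse_II_le]), and at x > 0 it is at least that one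
    on nonnegative functions that vanish for y <= 0 ([II_ge]).

    Sufficiency.  For alpha >= -1/2 the duplication of factorials gives the
    ultracontractive bound bheat <= C t^(-N) ([bheat_le]).  Split the time integral
    at T.  For a function of L^p norm at most 1, times above T contribute pointwise
    at most C T^(s - N/p), as long as p < N/s ([bpot_tail]); times below T give an
    operator bounded by T^s / s on L^1 and on bounded functions ([integral_bpot],
    [bpot_bounded]).  Choosing T according to the level l and cutting g at a height
    tau proportional to l^(q/p) yields
      mu {potential of g > l} <= tau^(-1) * (integral of g over {g > tau})
    ([bpot_distribution]).  For p = 1 this is the weak type inequality; for p > 1,
    integrating it against q l^(q-1) dl gives the strong one ([bpot_strong]).  For
    alpha < -1/2 the kernel bound survives for t >= 1 and x in a bounded set
    ([bheat_le_loc]), which is all that finiteness almost everywhere requires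
    ([bpot_ae_finite]); this is why the domain does not see the condition on alpha.

    Necessity.  The potential kernel is at least c (x + y)^(2 s - 2 N) for x, y > 0
    ([integral_bheat_ge]).  The function y^(-2 s) / ln y, restricted to y > e, lies
    in L^p for every p >= N/s and has infinite potential, whence p < N/s.
    Indicators of ]0, r], as r tends to 0 and to infinity, force the relation between
    p and q ([scaling_necessary]).  For p = 1 the indicator of ]0, 1] has a potential
    of order x^(2 s - 2 N) at infinity, not in L^(N/(N-s)) ([strong_1_false]).
    Finally, for t in [1, 2] a fixed share of the mass of bheat_t(x, .) lies within
    a fixed distance of x, uniformly in x >= 1; this follows from Chebyshev's
    inequality, because bheat is a Poisson mixture of Gamma densities in y^2 / (4 t)
    with an explicit variance ([bheat_concentration]).  So the potential of the
    indicator of an interval of fixed length is bounded below on its middle part,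
    however far the interval is.  When alpha < -1/2 the measure of such intervals
    tends to 0 at infinity, which contradicts any bound, strong or weak, from L^p to
    L^q with q > p. *)

Set Implicit Arguments.
Unset Strict Implicit.
Unset Printing Implicit Defensive.
Import Order.TTheory GRing.Theory Num.Theory.
Import numFieldNormedType.Exports.
Local Open Scope classical_set_scope.
Local Open Scope ring_scope.

(** * Calculus and power integrals *)
Section calculus.
Context {R : realType}.
Implicit Types (a b c x y : R) (f F : R -> R).
Local Notation leb := (@lebesgue_measure R).

Lemma is_derive_continuous F x dF : is_derive x 1 F dF -> {for x, continuous F}.
Proof.
move=> [dFx _]; apply: differentiable_continuous; exact/derivable1_diffP.
Qed.

Lemma integral_derive_itv f F a b : a <= b ->
  (forall x, a <= x <= b -> is_derive x 1 F (f x)) ->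
  (forall x, a <= x <= b -> {for x, continuous f}) ->
  (\int[leb]_(x in `[a, b]) (f x)%:E = (F b - F a)%:E)%E.
Proof.
rewrite le_eqVlt => /predU1P[<-|ab] dF cf.
  by rewrite set_itv1 integral_set1 subrr.
have ain : a <= a <= b by rewrite lexx ltW.
have bin : a <= b <= b by rewrite lexx ltW.
rewrite (@continuous_FTC2 _ f F a b ab).
- by rewrite EFinB.
- by apply: continuous_in_subspaceT => x; rewrite inE/= in_itv/=; exact: cf.
- split.
  + move=> x; rewrite in_itv/= => /andP[ax xb].
    by have [] := dF x _; rewrite ?(ltW ax) ?(ltW xb).
  + by apply: cvg_at_right_filter; exact: (is_derive_continuous (dF a ain)).
  + by apply: cvg_at_left_filter; exact: (is_derive_continuous (dF b bin)).
- move=> x; rewrite in_itv/= => /andP[ax xb].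
  by rewrite derive1E; have [] := dF x _; rewrite ?(ltW ax) ?(ltW xb).
Qed.

Lemma integral_derive_pinfty f F a (l : R) :
  (forall x, a <= x -> 0 <= f x) ->
  (forall x, a <= x -> is_derive x 1 F (f x)) ->
  (forall x, a <= x -> {for x, continuous f}) ->
  F x @[x --> +oo] --> l ->
  (\int[leb]_(x in `[a, +oo[) (f x)%:E = (l - F a)%:E)%E.
Proof.
move=> f0 dF cf Fl; rewrite (@ge0_continuous_FTC2y _ f F a l) //.
- by apply: continuous_in_subspaceT => x; rewrite inE/= in_itv/= andbT; exact: cf.
- by move=> x /ltW ax; have [] := dF x ax.
- by apply: cvg_at_right_filter; exact: (is_derive_continuous (dF a (lexx a))).
- move=> x; rewrite in_itv/= andbT => /ltW ax.
  by rewrite derive1E; have [] := dF x ax.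
Qed.

Lemma integral_expRN_tail a :
  (\int[leb]_(w in `[a, +oo[) (expR (- w))%:E = (expR (- a))%:E)%E.
Proof.
apply: etrans (@integral_derive_pinfty (fun w => expR (- w))
  (fun w => - expR (- w)) a 0 _ _ _ _) _; last by rewrite sub0r opprK.
- by move=> x _; exact: expR_ge0.
- move=> x _.
  by apply: is_derive_eq; rewrite ?(scaler0, mulrN1, opprK).
- move=> x _; apply: continuous_comp; last exact: continuous_expR.
  exact: continuousN.
- rewrite -oppr0; apply: cvgN; exact: cvgr_expR.
Qed.

Lemma continuous_powR_gt0 c x : 0 < x -> {for x, continuous (fun y => y `^ c)}.
Proof. by move=> x0; exact: (is_derive_continuous (is_derive1_powR c x0)). Qed.

Lemma cvg_powRN_pinfty c : 0 < c -> (w `^ (- c)) @[w --> +oo] --> (0 : R).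
Proof.
move=> c0; apply/cvgrPdist_le => e e0.
near=> w; rewrite sub0r normrN ger0_norm ?powR_ge0// powRN.
have w0 : 0 < w by near: w; exact: nbhs_pinfty_gt.
have ew : (e^-1) `^ c^-1 <= w by near: w; exact: nbhs_pinfty_ge.
rewrite -[leRHS]invrK lef_pV2 ?posrE ?powR_gt0 ?invr_gt0//.
have := @ge0_ler_powR _ _ (ltW c0) _ _ (powR_ge0 _ _) (ltW w0) ew.
by rewrite -powRrM mulVf ?gt_eqF// powRr1// invr_ge0 ltW.
Unshelve. all: by end_near. Qed.

Lemma integral_powR_pinfty c a : 0 < c -> 0 < a ->
  (\int[leb]_(t in `[a, +oo[) (t `^ (- c - 1))%:E = (a `^ (- c) / c)%:E)%E.
Proof.
move=> c0 a0.
apply: etrans (@integral_derive_pinfty (fun t => t `^ (- c - 1))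
  (fun w => - c^-1 * w `^ (- c)) a 0 _ _ _ _) _.
- by move=> x _; exact: powR_ge0.
- move=> x ax; have x0 := lt_le_trans a0 ax.
  have dP := is_derive1_powR (- c) x0.
  apply: is_derive_eq; rewrite ?scaler0 ?addr0 /GRing.scale/= mulrA mulrNN.
  by rewrite mulVf ?gt_eqF// mul1r.
- by move=> x ax; apply: continuous_powR_gt0; exact: lt_le_trans ax.
- rewrite -[X in _ --> X](mulr0 (- c^-1)); apply: cvgM; first exact: cvg_cst.
  exact: cvg_powRN_pinfty.
- by rewrite sub0r mulNr opprK mulrC.
Qed.

Lemma measurable_EFin_powR c (D : set R) :
  measurable_fun D (fun t : measurableTypeR R => (t `^ c)%:E).
Proof.
by apply: measurable_funTS; apply/measurable_EFinP; exact: measurable_powR.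
Qed.

(** The integrand may be singular at 0: the fundamental theorem applies on the
    intervals [a / (n + 1), a], which increase to ]0, a]. *)
Lemma integral_powR_0c c a : 0 < c -> 0 <= a ->
  (\int[leb]_(t in `]0%R, a]) (t `^ (c - 1))%:E = (a `^ c / c)%:E)%E.
Proof.
move=> c0; rewrite le_eqVlt => /predU1P[<-|a0].
  by rewrite set_itv_ge ?bnd_simp ?ltxx// integral_set0 powR0 ?gt_eqF// mul0r.
pose G n : set (measurableTypeR R) := `[a / n.+1%:R, a]%classic.
have nG : nondecreasing_seq G.
  move=> m n mn; rewrite subsetEset => x; rewrite /G/= !in_itv/= => /andP[h ->].
  rewrite andbT (le_trans _ h)// ler_pM2l// lef_pV2 ?posrE//.
  by rewrite ler_nat.
have UG : \bigcup_n G n = `]0, a]%classic.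
  apply/seteqP; split => x.
    move=> [n _]; rewrite /G/= !in_itv/= => /andP[h ->].
    by rewrite andbT (lt_le_trans _ h)// divr_gt0.
  rewrite /= in_itv/= => /andP[x0 xa].
  exists (Num.truncn (a / x)) => //; rewrite /G/= in_itv/= xa andbT.
  rewrite ler_pdivrMr// mulrC -ler_pdivrMr//; apply: ltW.
  exact: truncnS_gt.
have cv : (\int[leb]_(t in G n) (t `^ (c - 1))%:E)%E @[n --> \oo] -->
    (\int[leb]_(t in `]0%R, a]) (t `^ (c - 1))%:E)%E.
  rewrite -UG; apply: ge0_nondecreasing_set_cvg_integral => //.
  - by move=> n; exact: measurable_itv.
  - by move=> n; exact: measurable_EFin_powR.
  - by move=> n x _; rewrite lee_fin powR_ge0.
have E n : (\int[leb]_(t in G n) (t `^ (c - 1))%:E =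
    (a `^ c / c - (a / n.+1%:R) `^ c / c)%:E)%E.
  have an0 : 0 < a / n.+1%:R by rewrite divr_gt0.
  apply: etrans (@integral_derive_itv (fun t => t `^ (c - 1))
    (fun w => c^-1 * w `^ c) _ _ _ _ _) _.
  - by rewrite ler_pdivrMr// ler_pMr// ler1n.
  - move=> x /andP[ax _]; have x0 := lt_le_trans an0 ax.
    have dP := is_derive1_powR c x0.
    apply: is_derive_eq; rewrite ?scaler0 ?addr0 /GRing.scale/= mulrA.
    by rewrite mulVf ?gt_eqF// mul1r.
  - move=> x /andP[ax _]; have x0 := lt_le_trans an0 ax.
    exact: continuous_powR_gt0.
  - by rewrite ![c^-1 * _]mulrC.
apply: (cvg_unique _ cv) => //.
rewrite (_ : (fun n => _) = EFin \o (fun n => a `^ c / c - (a / n.+1%:R) `^ c / c));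
  last by apply/funext => n /=; exact: E.
apply: cvg_EFin; first by apply: nearW.
rewrite -[X in _ --> X]subr0; apply: cvgB; first exact: cvg_cst.
rewrite -[X in _ --> X](mul0r c^-1); apply: cvgM; last exact: cvg_cst.
have -> : (fun n => (a / n.+1%:R) `^ c) =
    (fun n => a `^ c * (n.+1%:R : R) `^ (- c)).
  apply/funext => n /=; rewrite powRM ?(ltW a0)// ?invr_ge0//.
  by rewrite -powR_inv1// -powRrM mulN1r.
rewrite -[X in _ --> X](mulr0 (a `^ c)); apply: cvgM; first exact: cvg_cst.
apply: (@cvg_comp _ _ _ (fun n => n.+1%:R : R) (fun w => w `^ (- c)) _ (pinfty_nbhs R)).
  by rewrite (cvg_shiftS (fun n => n%:R : R)); exact: cvgr_idn.
exact: cvg_powRN_pinfty.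
Qed.

End calculus.

(** * Measurability and Tonelli's theorem *)

Lemma measurable_fun_powRl d (T : measurableType d) (R : realType) (D : set T)
    (g : T -> R) (c : R) : measurable_fun D g ->
  measurable_fun D (fun z => g z `^ c).
Proof.
by move=> mg; apply: (measurableT_comp (f := fun y : R => y `^ c)) => //; exact: measurable_powR.
Qed.

Lemma measurable_fun_expR d (T : measurableType d) (R : realType) (D : set T)
    (g : T -> R) : measurable_fun D g -> measurable_fun D (fun z => expR (g z)).
Proof. by move=> mg; apply: measurableT_comp => //; exact: measurable_expR. Qed.

Lemma measurable_fun_opp d (T : measurableType d) (R : realType) (D : set T)
    (g : T -> R) : measurable_fun D g -> measurable_fun D (fun z => - g z).
Proof. by move=> mg; apply: measurableT_comp => //; exact: oppr_measurable. Qed.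

Lemma measurable_fun_norm d (T : measurableType d) (R : realType) (D : set T)
    (g : T -> R) : measurable_fun D g -> measurable_fun D (fun z => `|g z|).
Proof.
by move=> mg; apply: measurableT_comp => //; exact: measurable_realfun.normr_measurable.
Qed.

Lemma measurable_fun_exprn d (T : measurableType d) (R : realType) (D : set T)
    (g : T -> R) n : measurable_fun D g -> measurable_fun D (fun z => g z ^+ n).
Proof. by move=> mg; exact: measurable_funX. Qed.

(** Follows the syntax of an explicit formula down to its atoms. The patterns
    whose function has no bound variable catch formulas that unification has
    eta-reduced. *)
Ltac solve_meas := first
  [ exact: measurable_fst | exact: measurable_snd | exact: measurable_id
  | assumption | exact: oppr_measurable | exact: measurable_expR
  | exact: measurable_realfun.normr_measurable
  | match goal with
    | |- measurable_fun _ (fun z => EFin _) => apply/measurable_EFinP; solve_meas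
    | |- measurable_fun _ (fun z => EFin (@?a z)) =>
        apply/(measurable_EFinP _ a); solve_meas
    | |- measurable_fun _ (fun z => if @?b z then _ else _) =>
        apply: measurable_fun_ifT; solve_meas
    | |- measurable_fun _ (fun z => fst _) =>
        apply: (measurableT_comp measurable_fst); solve_meas
    | |- measurable_fun _ (fun z => snd _) =>
        apply: (measurableT_comp measurable_snd); solve_meas
    | |- measurable_fun _ (fun z => expR _) => apply: measurable_fun_expR; solve_meas
    | |- measurable_fun _ (fun z => powR _ _) => apply: measurable_fun_powRl; solve_meas
    | |- measurable_fun _ (fun z => Algebra.opp _) => apply: measurable_fun_opp; solve_meas
    | |- measurable_fun _ (fun z => @Num.norm _ _ _) => apply: measurable_fun_norm; solve_meas
    | |- measurable_fun _ (fun z => @GRing.mul _ _ _) => apply: measurable_funM; solve_meas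
    | |- measurable_fun _ (fun z => Algebra.add _ (Algebra.opp _)) =>
        apply: measurable_funB; solve_meas
    | |- measurable_fun _ (fun z => Algebra.add _ _) => apply: measurable_funD; solve_meas
    | |- measurable_fun _ (fun z => @GRing.exp _ _ _) => apply: measurable_fun_exprn; solve_meas
    | |- measurable_fun _ (fun z => @Order.le _ _ _ _) => apply: measurable_fun_ler; solve_meas
    | |- measurable_fun _ (fun z => @Order.lt _ _ _ _) => apply: measurable_fun_ltr; solve_meas
    | |- measurable_fun _ (@Algebra.add _ ?c) =>
        apply: (@measurable_funD _ _ _ _ (fun=> c) id); solve_meas
    | |- measurable_fun _ (@GRing.mul _ ?c) =>
        apply: (@measurable_funM _ _ _ _ (fun=> c) id); solve_meas
    | |- measurable_fun _ (fun z => mule _ _) => apply: emeasurable_funM; solve_meas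
    | |- measurable_fun _ (fun z => adde _ _) => apply: emeasurable_funD; solve_meas
    end
  | exact: measurable_cst ].

Section tonelli.
Context d1 d2 {T1 : measurableType d1} {T2 : measurableType d2} {R : realType}.
Variables (m1 : {sigma_finite_measure set T1 -> \bar R})
  (m2 : {sigma_finite_measure set T2 -> \bar R}).
Variables (D1 : set T1) (D2 : set T2) (f : T1 -> T2 -> \bar R).
Hypotheses (mD1 : measurable D1) (mD2 : measurable D2).
Hypothesis mf : measurable_fun setT (fun z : T1 * T2 => f z.1 z.2).
Hypothesis f0 : forall x y, (0 <= f x y)%E.

Let g (z : T1 * T2) : \bar R := if (z \in (D1 `*` D2)) then f z.1 z.2 else 0%E.

Let mg : measurable_fun setT g.
Proof.
apply: measurable_fun_ifT => //.
by apply: (measurable_fun_bool true) => //; rewrite setTI preimage_true;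
  rewrite (_ : [set _ | _] = D1 `*` D2);
  [exact: measurableX|apply/seteqP; split => z /=; rewrite inE].
Qed.

(** The zero extension of [f] off [D1 `*` D2] turns both iterated integrals
    into integrals over whole spaces. *)
Lemma tonelli_on :
  (\int[m1]_(x in D1) \int[m2]_(y in D2) f x y =
   \int[m2]_(y in D2) \int[m1]_(x in D1) f x y)%E.
Proof.
have g0 z : (0 <= g z)%E by rewrite /g; case: ifP.
transitivity (\int[m1]_x \int[m2]_y g (x, y))%E.
  rewrite [LHS]integral_mkcond; apply: eq_integral => x _; rewrite patchE.
  have [xD|xD] := boolP (x \in D1).
    rewrite [LHS]integral_mkcond; apply: eq_integral => y _.
    by rewrite patchE /g in_setX xD.
  by apply/esym/integral0_eq => y _; rewrite /g in_setX (negbTE xD).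
rewrite (fubini_tonelli g mg g0).
rewrite [RHS]integral_mkcond; apply: eq_integral => y _; rewrite patchE.
have [yD|yD] := boolP (y \in D2).
  rewrite [RHS]integral_mkcond; apply: eq_integral => x _.
  by rewrite patchE /g in_setX yD andbT.
by apply: integral0_eq => x _; rewrite /g in_setX (negbTE yD) andbF.
Qed.

End tonelli.

Lemma measurable_fun_integral_on d1 d2 {T1 : measurableType d1}
    {T2 : measurableType d2} {R : realType}
    (m2 : {sigma_finite_measure set T2 -> \bar R}) (D2 : set T2)
    (f : T1 -> T2 -> \bar R) : measurable D2 ->
  measurable_fun setT (fun z : T1 * T2 => f z.1 z.2) ->
  (forall x y, (0 <= f x y)%E) ->
  measurable_fun setT (fun x => \int[m2]_(y in D2) f x y)%E.
Proof.
move=> mD2 mf f0.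
pose g (z : T1 * T2) : \bar R := if (z.2 \in D2) then f z.1 z.2 else 0%E.
have mg : measurable_fun setT g.
  apply: measurable_fun_ifT => //.
  apply: (measurable_fun_bool true) => //; rewrite setTI preimage_true.
  rewrite (_ : [set _ | _] = setT `*` D2); first exact: measurableX.
  by apply/seteqP; split => z /=; rewrite inE// => -[].
have g0 z : (0 <= g z)%E by rewrite /g; case: ifP.
have := measurable_fun_fubini_tonelli_F (m2 := m2) g mg g0.
congr measurable_fun; apply/funext => x; rewrite /fubini_F.
rewrite [RHS]integral_mkcond; apply: eq_integral => y _.
by rewrite patchE /g.
Qed.

(** For [f] of arbitrary sign: the parametric integral is the difference of
    those of the positive and the negative part, whatever their values. *)
Lemma measurable_integral_param d1 d2 {T1 : measurableType d1}
    {T2 : measurableType d2} {R : realType}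
    (m2 : {sigma_finite_measure set T2 -> \bar R}) (D2 : set T2)
    (f : T1 -> T2 -> \bar R) : measurable D2 ->
  measurable_fun setT (fun z : T1 * T2 => f z.1 z.2) ->
  measurable_fun setT (fun x => \int[m2]_(y in D2) f x y)%E.
Proof.
move=> mD2 mf.
pose F := fun z : T1 * T2 => f z.1 z.2.
rewrite (_ : (fun x => _) = (fun x => \int[m2]_(y in D2) (fun x y => F^\+ (x, y)) x y -
    \int[m2]_(y in D2) (fun x y => F^\- (x, y)) x y)%E); last first.
  apply/funext => x; rewrite integralE.
  by congr (_ - _)%E; apply: eq_integral => y _; rewrite ?funeposE ?funenegE.
apply: emeasurable_funB; apply: measurable_fun_integral_on => //.
- by rewrite (_ : (fun z => _) = F^\+)%E; [exact: measurable_funepos|apply/funext => -[]].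
- by rewrite (_ : (fun z => _) = F^\-)%E; [exact: measurable_funeneg|apply/funext => -[]].
Qed.

(** * The Gamma function *)

Section gamma.
Context {R : realType}.
Local Notation leb := (@lebesgue_measure R).
Implicit Types (s b e r t : R).

(** With values in [0, +oo], so that the recursion precedes finiteness. *)
Definition eGamma s : \bar R :=
  (\int[leb]_(t in `]0%R, +oo[) (t `^ (s - 1) * expR (- t))%:E)%E.

(** Write [expR (- (b * y `^ e))] as the integral of [expR (- w)] over [w >= b
    * y `^ e] and exchange the integrals: the inner one becomes that of a
    power of y, and a Gamma integral in w remains. The case e = b = 1 is the
    functional equation of Gamma, and e = 2 computes the moments of a
    Gaussian. *)
Lemma integral_powR_expRN e b s : 0 < e -> 0 < b -> 0 < s ->
  (\int[leb]_(y in `]0%R, +oo[) (y `^ (e * s - 1) * expR (- (b * y `^ e)))%:E =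
   (b `^ (- s) / (e * s))%:E * eGamma (s + 1))%E.
Proof.
move=> e0 b0 s0.
pose f (y w : measurableTypeR R) : \bar R :=
  (y `^ (e * s - 1) * if b * y `^ e <= w then expR (- w) else 0)%:E.
have f0 x y : (0 <= f x y)%E.
  by rewrite lee_fin mulr_ge0// ?powR_ge0//; case: ifP => // _; exact: expR_ge0.
have mf : measurable_fun setT
    (fun z : measurableTypeR R * measurableTypeR R => f z.1 z.2).
  by rewrite /f; solve_meas.
transitivity (\int[leb]_(y in `]0%R, +oo[) \int[leb]_(w in `]0%R, +oo[) f y w)%E.
  apply: eq_integral => y; rewrite inE/= in_itv/= andbT => y0.
  have by0 : 0 < b * y `^ e by rewrite mulr_gt0// powR_gt0.
  transitivity (\int[leb]_(w in `[(b * y `^ e)%R, +oo[)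
      ((y `^ (e * s - 1))%:E * (expR (- w))%:E))%E.
    rewrite ge0_integralZl_EFin ?powR_ge0//; first by rewrite integral_expRN_tail.
    by apply: measurable_funTS; solve_meas.
  rewrite [LHS]integral_mkcond [RHS]integral_mkcond; apply: eq_integral => w _.
  rewrite !patchE /f; have [bw|bw] := leP (b * y `^ e) w.
    rewrite !ifT// ?inE/= in_itv/= andbT//; exact: lt_le_trans bw.
  rewrite ifF ?mulr0 ?if_same//; apply/negbTE; rewrite notin_setE/= in_itv/=.
  by rewrite andbT; apply/negP; rewrite -ltNge.
rewrite tonelli_on//.
transitivity (\int[leb]_(w in `]0%R, +oo[)
   ((b `^ (- s) / (e * s))%:E * (w `^ (s + 1 - 1) * expR (- w))%:E))%E.
  apply: eq_integral => w; rewrite inE/= in_itv/= andbT => w0.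
  have wb0 : 0 <= w / b by rewrite divr_ge0// ltW.
  transitivity (\int[leb]_(y in `]0%R, ((w / b) `^ e^-1)%R])
      ((expR (- w))%:E * (y `^ (e * s - 1))%:E))%E.
    rewrite [LHS]integral_mkcond [RHS]integral_mkcond; apply: eq_integral => y _.
    rewrite !patchE /f.
    have [y0|y0] := ltP 0 y; last first.
      by rewrite !ifF//; apply/negbTE; rewrite notin_setE/= in_itv/= ?andbT;
        apply/negP; rewrite ?negb_and -?leNgt ?y0.
    have -> : (b * y `^ e <= w) = (y <= (w / b) `^ e^-1).
      rewrite mulrC -ler_pdivlMr//; apply/idP/idP => h.
        have := @ge0_ler_powR _ e^-1 _ _ _ (powR_ge0 _ _) wb0 h.
        by rewrite -powRrM divff ?gt_eqF// powRr1 ?(ltW y0)//; apply; rewrite invr_ge0 ltW.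
      have := @ge0_ler_powR _ e (ltW e0) _ _ (ltW y0) (powR_ge0 _ _) h.
      by rewrite -powRrM mulVf ?gt_eqF// powRr1.
    rewrite !mem_setE !in_itv/= y0/=.
    by case: ifP => _; rewrite ?mulr0 // -EFinM mulrC.
  rewrite ge0_integralZl_EFin ?expR_ge0//; last 2 first.
  - by move=> *; rewrite lee_fin powR_ge0.
  - exact: measurable_EFin_powR.
  rewrite integral_powR_0c ?mulr_gt0 ?powR_ge0// -!EFinM; congr EFin.
  rewrite -powRrM mulrA mulVf ?gt_eqF// mul1r powRM ?(ltW w0) ?invr_ge0 ?ltW//.
  by rewrite -[b^-1]powR_inv1 ?ltW// -powRrM mulN1r addrK; ring.
rewrite ge0_integralZl_EFin//.
- by move=> *; rewrite lee_fin mulr_ge0 ?powR_ge0 ?expR_ge0.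
- by apply: measurable_funTS; solve_meas.
- by rewrite divr_ge0 ?powR_ge0 ?mulr_ge0 ?ltW.
Qed.

Lemma eGammaS s : 0 < s -> eGamma s = (s^-1%:E * eGamma (s + 1))%E.
Proof.
move=> s0; have := @integral_powR_expRN 1 1 s ltr01 ltr01 s0.
rewrite powR1 !mul1r => <-; apply: eq_integral => t; rewrite inE/= in_itv/= andbT => t0.
by rewrite mul1r powRr1 ?ltW.
Qed.
Lemma powR_le_expR r t : 0 < r -> 0 <= t -> t `^ r <= r `^ r * expR t.
Proof.
move=> r0 t0.
have h : t / r <= expR (t / r) by apply: le_trans (expR_ge1Dx _); rewrite lerDr.
have tr0 : 0 <= t / r by rewrite divr_ge0// ltW.
have := @ge0_ler_powR _ r (ltW r0) _ _ tr0 (expR_ge0 _) h.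
rewrite -expRM divfK ?gt_eqF// powRM// ?invr_ge0 ?(ltW r0)// -powR_inv1 ?(ltW r0)//.
rewrite -powRrM mulN1r powRN ler_pdivrMr ?powR_gt0//.
by rewrite mulrC.
Qed.

(** Near 0 the integrand is at most t^(s-1); at infinity, bounding exp(-t) by
    a multiple of t^(-(s+1)) leaves t^(-2). *)
Lemma eGamma_lty s : 0 < s -> (eGamma s < +oo)%E.
Proof.
move=> s0; rewrite /eGamma.
have m D : measurable_fun D (fun t : measurableTypeR R => (t `^ (s - 1) * expR (- t))%:E).
  by apply: measurable_funTS; solve_meas.
have p D : forall t, D t -> (0 <= (t `^ (s - 1) * expR (- t))%:E)%E.
  by move=> t _; rewrite lee_fin mulr_ge0 ?powR_ge0 ?expR_ge0.
have -> : `]0%R, +oo[%classic = `]0%R, 1%R] `|` `]1%R, +oo[ :> set (measurableTypeR R).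
  by rewrite -itv_bndbnd_setU// bnd_simp.
rewrite ge0_integral_setU//=; [|exact: (p _)|]; last first.
  rewrite disj_set2E; apply/eqP/seteqP; split => // x /=; rewrite !in_itv/= => -[].
  by move=> /andP[_ x1]; rewrite andbT ltNge x1.
apply: lte_add_pinfty.
  apply: (@le_lt_trans _ _ (\int[leb]_(t in `]0%R, 1%R]) (t `^ (s - 1))%:E)%E).
    apply: ge0_le_integral => //; do ?[exact: (p _)|exact: measurable_EFin_powR].
    move=> t; rewrite /= in_itv/= => /andP[t0 _]; rewrite lee_fin ler_piMr ?powR_ge0//.
    by rewrite -expR0 ler_expR oppr_le0 ltW.
  by rewrite integral_powR_0c// ltry.
set r := s + 1; have r0 : 0 < r by rewrite addr_gt0.
apply: (@le_lt_trans _ _ (\int[leb]_(t in `]1%R, +oo[)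
    ((r `^ r)%:E * (t `^ (- 1 - 1))%:E))%E).
  apply: ge0_le_integral => //; do ?[exact: (p _)|by apply: measurable_funTS; solve_meas].
  move=> t; rewrite /= in_itv/= andbT => t1; rewrite lee_fin.
  have t0 : 0 < t by exact: lt_trans t1.
  have -> : s - 1 = r + (- 1 - 1) by rewrite /r; ring.
  rewrite powRD; last by rewrite (gt_eqF t0) implybT.
  rewrite mulrAC ler_wpM2r ?powR_ge0// expRN ler_pdivrMr ?expR_gt0//.
  exact: powR_le_expR (ltW t0).
rewrite ge0_integralZl_EFin ?powR_ge0//; last 2 first.
- by move=> t _; rewrite lee_fin powR_ge0.
- exact: measurable_EFin_powR.
rewrite lte_mul_pinfty ?lee_fin ?powR_ge0//.
rewrite integral_itv_obnd_cbnd ?integral_powR_pinfty ?ltry//.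
exact: measurable_EFin_powR.
Qed.

Lemma eGammaE s : 0 < s -> eGamma s = (Gamma s)%:E.
Proof.
move=> s0; rewrite /Gamma /Rintegral fineK// ge0_fin_numE ?eGamma_lty//.
by apply: integral_ge0 => t _; rewrite lee_fin mulr_ge0 ?powR_ge0 ?expR_ge0.
Qed.

Lemma Gamma_ge0 s : 0 <= Gamma s.
Proof.
by apply: fine_ge0; apply: integral_ge0 => t _; rewrite lee_fin mulr_ge0 ?powR_ge0 ?expR_ge0.
Qed.

Lemma GammaS s : 0 < s -> Gamma (s + 1) = s * Gamma s.
Proof.
move=> s0; have := eGammaS s0; rewrite !eGammaE ?addr_gt0// -EFinM => -[->].
by rewrite mulrA divff ?mul1r// gt_eqF.
Qed.

Lemma Gamma_gt0 s : 0 < s -> 0 < Gamma s.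
Proof.
move=> s0; rewrite -lte_fin -eGammaE//.
apply: (@lt_le_trans _ _ (expR (- 1) * (s^-1))%:E).
  by rewrite lte_fin mulr_gt0 ?expR_gt0 ?invr_gt0.
apply: (@le_trans _ _ (\int[leb]_(t in `]0%R, 1%R])
    ((expR (- 1))%:E * (t `^ (s - 1))%:E))%E).
  rewrite ge0_integralZl_EFin ?expR_ge0//; last 2 first.
  - by move=> t _; rewrite lee_fin powR_ge0.
  - exact: measurable_EFin_powR.
  by rewrite integral_powR_0c// powR1 -EFinM div1r.
apply: (@le_trans _ _ (\int[leb]_(t in `]0%R, 1%R]) (t `^ (s - 1) * expR (- t))%:E)%E).
  apply: ge0_le_integral => //.
  - by move=> t _; rewrite lee_fin mulr_ge0 ?powR_ge0 ?expR_ge0.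
  - by apply: measurable_funTS; solve_meas.
  - by apply: measurable_funTS; solve_meas.
  - move=> t; rewrite /= in_itv/= => /andP[t0 t1].
    by rewrite lee_fin mulrC ler_wpM2l ?powR_ge0// ler_expR lerN2.
apply: ge0_subset_integral => //.
- by apply: measurable_funTS; solve_meas.
- by move=> t _; rewrite lee_fin mulr_ge0 ?powR_ge0 ?expR_ge0.
- by apply: subset_itvl; rewrite bnd_simp.
Qed.

Lemma integral_gauss_powR s t : 0 < s -> 0 < t ->
  (\int[leb]_(y in `]0%R, +oo[) (y `^ (2 * s - 1) * expR (- (y ^+ 2 / t)))%:E =
   (2^-1 * t `^ s * Gamma s)%:E)%E.
Proof.
move=> s0 t0; have ti0 : 0 < t^-1 by rewrite invr_gt0.
have h2 : (0 : R) < 2 by [].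
have := @integral_powR_expRN 2 t^-1 s h2 ti0 s0.
rewrite (eGammaE (addr_gt0 s0 ltr01)) -EFinM (GammaS s0).
have -> : t^-1 `^ (- s) / (2 * s) * (s * Gamma s) = 2^-1 * t `^ s * Gamma s.
  by rewrite -[t^-1]powR_inv1 ?(ltW t0)// -powRrM mulrNN mul1r; field; lra.
move=> <-; apply: eq_integral => y; rewrite inE/= in_itv/= andbT => y0.
by rewrite mulrC (powR_mulrn 2) ?ltW// [_ / t]mulrC mulrC.
Qed.

End gamma.

(** * Series with nonnegative terms *)

Section series.
Context {R : realType}.
Implicit Types (u : R ^nat).

Lemma nneg_series_homo u : (forall k, 0 <= u k) ->
  {homo series u : n m / (n <= m)%N >-> n <= m}.
Proof. by move=> u0; apply/nondecreasing_seqP => n; rewrite seriesSr lerDl. Qed.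

Lemma nneg_series_bounded u M : (forall k, 0 <= u k) ->
  (forall n, series u n <= M) -> cvgn (series u) /\ limn (series u) <= M.
Proof.
move=> u0 uM.
have cu : cvgn (series u).
  apply: nondecreasing_is_cvgn; first exact: nneg_series_homo.
  by exists M => _ [n _ <-].
by split=> //; apply: limr_le => //; exact: nearW.
Qed.

Lemma nneg_series_le_lim u n : (forall k, 0 <= u k) -> cvgn (series u) ->
  series u n <= limn (series u).
Proof. by move=> u0 cu; apply: nondecreasing_cvgn_le => //; exact: nneg_series_homo. Qed.

Lemma eseries_EFin u : cvgn (series u) ->
  (\sum_(k <oo) (u k)%:E)%E = (limn (series u))%:E.
Proof.
move=> cu; rewrite -EFin_lim//; congr (limn _); apply/funext => n /=.
by rewrite /series/= sumEFin.
Qed.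

Lemma series_exp_coeff_le_expR (x : R) n : 0 <= x ->
  \sum_(0 <= k < n) x ^+ k / k`!%:R <= expR x.
Proof.
move=> x0; apply: (@nneg_series_le_lim (exp_coeff x)); last exact: is_cvg_series_exp_coeff.
by move=> k; rewrite /exp_coeff/= divr_ge0// exprn_ge0.
Qed.

Lemma exprn_div_fact_le_expR (x : R) n : 0 <= x -> x ^+ n / n`!%:R <= expR x.
Proof.
move=> x0; apply: le_trans (series_exp_coeff_le_expR n.+1 x0).
rewrite big_nat_recr//= lerDr sumr_ge0// => k _.
by rewrite divr_ge0// exprn_ge0.
Qed.

End series.

(** * The Bessel series *)

Section bessel.
Context {R : realType}.
Implicit Types (a u v w : R) (k n : nat).

Definition bessel_coef a k : R := (k`!%:R * Gamma (k%:R + a + 1))^-1.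

(** [I_a (2 u) = u^a * bessel_series a (u^2)]; in the variable v = u^2 the
    singular power is gone and the series is entire. *)
Definition bessel_series a v : R := limn (series (fun k => v ^+ k * bessel_coef a k)).

(** The largest m with m (k + 1) <= k + a + 1 for every k; through it the
    recursion of the coefficients gives 1 / Gamma(k + a + 1) <= C m^(-k) / k!,
    for all a > -1 at once. *)
Definition slope a : R := Num.min 1 (a + 1).

Lemma slope_gt0 a : -1 < a -> 0 < slope a.
Proof. by move=> a1; rewrite lt_min ltr01; lra. Qed.

Lemma slope_le a k : slope a * (k%:R + 1) <= k%:R + a + 1.
Proof.
have h1 : slope a <= 1 by rewrite ge_min lexx.
have h2 : slope a <= a + 1 by rewrite ge_min lexx orbT.
have : slope a * k%:R <= k%:R by rewrite ler_piMl.
lra.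
Qed.

Lemma gamma_arg_gt0 a k : -1 < a -> 0 < k%:R + a + 1.
Proof. by move=> a1; have := ler0n R k; lra. Qed.

Lemma bessel_coef_gt0 a k : -1 < a -> 0 < bessel_coef a k.
Proof.
move=> a1; rewrite invr_gt0 mulr_gt0 ?ltr0n ?fact_gt0//.
by apply: Gamma_gt0; exact: gamma_arg_gt0.
Qed.

Lemma bessel_coefS a k : -1 < a -> bessel_coef a k.+1 = bessel_coef a k / ((k%:R + 1) * (k%:R + a + 1)).
Proof.
move=> a1; have k0 := gamma_arg_gt0 k a1; have G0 := Gamma_gt0 k0.
rewrite /bessel_coef factS natrM -!natr1.
have -> : k%:R + 1 + a + 1 = (k%:R + a + 1) + 1 :> R by ring.
rewrite GammaS//; have f0 : (0 : R) < k`!%:R by rewrite ltr0n fact_gt0.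
have := ler0n R k => kk; field; rewrite !gt_eqF//; lra.
Qed.

Lemma bessel_coef_shift a k : -1 < a -> bessel_coef (a + 1) k = bessel_coef a k / (k%:R + a + 1).
Proof.
move=> a1; have k0 := gamma_arg_gt0 k a1; have G0 := Gamma_gt0 k0.
rewrite /bessel_coef addrA GammaS//; have f0 : (0 : R) < k`!%:R by rewrite ltr0n fact_gt0.
field; rewrite !gt_eqF//.
Qed.

Lemma bessel_coef_le a k : -1 < a ->
  bessel_coef a k <= bessel_coef a 0 * ((slope a)^-1 ^+ k / k`!%:R / k`!%:R).
Proof.
move=> a1; have m0 := slope_gt0 a1; elim: k => [|k ih].
  by rewrite expr0 fact0 !divr1 mulr1.
rewrite bessel_coefS// factS natrM -natr1 exprSr.
have f0 : (0 : R) < k`!%:R by rewrite ltr0n fact_gt0.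
have k0 := gamma_arg_gt0 k a1.
have kp : 0 < k%:R + 1 :> R by rewrite natr1.
have mk := mulr_gt0 m0 kp.
apply: (@le_trans _ _ (bessel_coef a k / ((k%:R + 1) * (slope a * (k%:R + 1))))).
  apply: ler_wpM2l; first exact: ltW (bessel_coef_gt0 k a1).
  rewrite lef_pV2 ?posrE ?(mulr_gt0 kp k0) ?(mulr_gt0 kp mk)//.
  by rewrite (ler_pM2l kp) slope_le.
rewrite ler_pdivrMr ?(mulr_gt0 kp mk)//.
apply: le_trans ih _; rewrite le_eqVlt; apply/orP; left; apply/eqP.
by field; rewrite !gt_eqF//; lra.
Qed.

(** The coefficients decrease like m^(-k) / (k!)^2 with m = [slope a]. One
    factorial pays for the bound w^k / k! <= exp w, the other for summing (v /
    m)^k. With w = y^2 / (4 t) the factor exp w is exactly what the Gaussian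
    absorbs, so that the resulting heat kernel bound is uniform in y. *)
Lemma bessel_series_mul_partial a v w n : -1 < a -> 0 <= v -> 0 <= w ->
  series (fun k => (v * w) ^+ k * bessel_coef a k) n <=
  bessel_coef a 0 * expR (v / slope a) * expR w.
Proof.
move=> a1 v0 w0; have m0 := slope_gt0 a1; have c0 := bessel_coef_gt0 0 a1.
have vm0 : 0 <= v / slope a by rewrite divr_ge0// ltW.
apply: (@le_trans _ _ (\sum_(0 <= k < n)
    (bessel_coef a 0 * expR w) * ((v / slope a) ^+ k / k`!%:R))).
  rewrite /series/=; apply: ler_sum => k _.
  apply: le_trans (ler_wpM2l _ (bessel_coef_le k a1)) _; first by rewrite exprn_ge0 ?mulr_ge0.
  have := exprn_div_fact_le_expR k w0.
  have h : 0 <= bessel_coef a 0 * ((v / slope a) ^+ k / k`!%:R).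
    by rewrite mulr_ge0 ?(ltW c0)// divr_ge0// exprn_ge0.
  move=> /(ler_wpM2l h); rewrite !exprMn exprVn => hh.
  by apply: le_trans (le_trans _ hh) _; rewrite le_eqVlt; apply/orP; left; apply/eqP; ring.
rewrite -mulr_sumr [leRHS]mulrAC ler_wpM2l ?mulr_ge0 ?(ltW c0) ?expR_ge0//.
exact: series_exp_coeff_le_expR.
Qed.

Lemma bessel_term_ge0 a v k : -1 < a -> 0 <= v -> 0 <= v ^+ k * bessel_coef a k.
Proof. by move=> a1 v0; rewrite mulr_ge0 ?exprn_ge0// ltW// bessel_coef_gt0. Qed.

Lemma bessel_series_cvg a v : -1 < a -> 0 <= v ->
  cvgn (series (fun k => v ^+ k * bessel_coef a k)).
Proof.
move=> a1 v0.
have h n : series (fun k => v ^+ k * bessel_coef a k) n <=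
    bessel_coef a 0 * expR (v / slope a) * expR 1.
  by have := bessel_series_mul_partial n a1 v0 ler01; rewrite mulr1.
by have [] := nneg_series_bounded (fun k => bessel_term_ge0 k a1 v0) h.
Qed.

Lemma bessel_series_le a v M : -1 < a -> 0 <= v ->
  (forall n, series (fun k => v ^+ k * bessel_coef a k) n <= M) -> bessel_series a v <= M.
Proof.
by move=> a1 v0 h; have [] := nneg_series_bounded (fun k => bessel_term_ge0 k a1 v0) h.
Qed.

Lemma bessel_series_ge_partial a v n : -1 < a -> 0 <= v ->
  series (fun k => v ^+ k * bessel_coef a k) n <= bessel_series a v.
Proof.
move=> a1 v0; apply: nneg_series_le_lim; last exact: bessel_series_cvg.
by move=> k; exact: bessel_term_ge0.
Qed.

Lemma bessel_series_ge a v : -1 < a -> 0 <= v -> bessel_coef a 0 <= bessel_series a v.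
Proof.
move=> a1 v0; have := bessel_series_ge_partial 1 a1 v0.
by rewrite /series/= big_nat1 expr0 mul1r.
Qed.

Lemma bessel_series_ge0 a v : -1 < a -> 0 <= v -> 0 <= bessel_series a v.
Proof. by move=> a1 v0; apply: le_trans (bessel_series_ge a1 v0); rewrite ltW// bessel_coef_gt0. Qed.

Lemma bessel_series_mul_le a v w : -1 < a -> 0 <= v -> 0 <= w ->
  bessel_series a (v * w) <= bessel_coef a 0 * expR (v / slope a) * expR w.
Proof.
move=> a1 v0 w0; apply: bessel_series_le => // [|n]; first exact: mulr_ge0.
exact: bessel_series_mul_partial.
Qed.

(** This is I_(a+1) <= C I_a. Termwise, u b'_k = b_k u / (k + a + 1), where b
    and b' are the coefficients for a and a + 1; the inequality u <= (k + 1) +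
    u^2 / (k + 1) splits this between the terms of index k and k + 1 of the
    series for a, as b_(k+1) = b_k / ((k+1)(k+a+1)). *)
Lemma bessel_series_shift_le a u : -1 < a -> 0 <= u ->
  u * bessel_series (a + 1) (u ^+ 2) <= 2 / slope a * bessel_series a (u ^+ 2).
Proof.
move=> a1 u0; have a2 : -1 < a + 1 by lra.
have m0 := slope_gt0 a1; have uu0 : 0 <= u ^+ 2 by rewrite exprn_ge0.
have [->|un0] := eqVneq u 0.
  by rewrite mul0r mulr_ge0 ?bessel_series_ge0 ?divr_ge0 ?expr0n// ltW.
have up : 0 < u by rewrite lt_neqAle eq_sym un0.
rewrite -ler_pdivlMl//; apply: bessel_series_le => // n.
rewrite ler_pdivlMl// /series/= mulr_sumr.
apply: (@le_trans _ _ (\sum_(0 <= k < n) (slope a)^-1 *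
   ((u ^+ 2) ^+ k * bessel_coef a k + (u ^+ 2) ^+ k.+1 * bessel_coef a k.+1))).
  apply: ler_sum => k _.
  have k0 := gamma_arg_gt0 k a1; have c0 := bessel_coef_gt0 k a1; have kk := ler0n R k.
  have ck0 : 0 <= (u ^+ 2) ^+ k * bessel_coef a k by exact: bessel_term_ge0.
  rewrite bessel_coef_shift// bessel_coefS// (exprSr (u ^+ 2) k).
  set c := bessel_coef a k in ck0 *; set q := (u ^+ 2) ^+ k in ck0 *.
  have -> : u * (q * (c / (k%:R + a + 1))) = (q * c) * (u / (k%:R + a + 1)) by ring.
  have -> : (slope a)^-1 * (q * c + q * u ^+ 2 * (c / ((k%:R + 1) * (k%:R + a + 1)))) =
    (q * c) * ((slope a)^-1 * ((k%:R + a + 1) + u ^+ 2 / (k%:R + 1)) / (k%:R + a + 1)).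
    by field; rewrite !gt_eqF//; lra.
  apply: ler_wpM2l => //; rewrite ler_pM2r ?invr_gt0//.
  rewrite ler_pdivlMl//.
  have h := slope_le a k.
  have m1 : slope a <= 1 by rewrite ge_min lexx.
  have ? : 0 < k%:R + 1 :> R by lra.
  have h2 : slope a * u <= slope a * (k%:R + 1) + slope a * (u ^+ 2 / (k%:R + 1)).
    rewrite -mulrDr ler_pM2l// -(ler_pM2r (x := k%:R + 1))// mulrDl divfK ?gt_eqF//.
    by nra.
  apply: (le_trans h2); apply: lerD => //.
  by rewrite ler_piMl// divr_ge0// ltW.
rewrite -mulr_sumr big_split/= -mulrA [_ * (_ * bessel_series _ _)]mulrCA ler_pM2l ?invr_gt0//.
rewrite [_ * bessel_series _ _](_ : _ = bessel_series a (u ^+ 2) + bessel_series a (u ^+ 2)); last by ring.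
apply: lerD; first exact: bessel_series_ge_partial.
apply: le_trans (bessel_series_ge_partial n.+1 a1 uu0).
by rewrite /series/= big_nat_recl//= lerDr bessel_term_ge0.
Qed.

(** At a = -1/2 this is the equality k! (1/2)(3/2)...(k - 1/2) = (2k)! / 4^k,
    and every factor k + a + 1 of the recursion increases with a. *)
Lemma bessel_coef_le_half a k : - (1 / 2) <= a ->
  bessel_coef a k <= bessel_coef a 0 * (4 ^+ k / (2 * k)`!%:R).
Proof.
move=> a1; have a2 : -1 < a by lra.
elim: k => [|k ih]; first by rewrite muln0 expr0 fact0 divr1 mulr1.
have f0 : (0 : R) < (2 * k)`!%:R by rewrite ltr0n fact_gt0.
have k0 := gamma_arg_gt0 k a2.
have kp : 0 < k%:R + 1 :> R by rewrite natr1.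
have kh : 0 < k%:R + 2^-1 :> R by rewrite ltr_wpDl.
rewrite bessel_coefS// mulnS (factS (2 * k).+1) (factS (2 * k)) !natrM exprSr.
rewrite -(natr1 (2 * k).+1) -(natr1 (2 * k)) natrM.
apply: (@le_trans _ _ (bessel_coef a k / ((k%:R + 1) * (k%:R + 2^-1)))).
  apply: ler_wpM2l; first exact: ltW (bessel_coef_gt0 k a2).
  rewrite lef_pV2 ?posrE ?(mulr_gt0 kp k0) ?(mulr_gt0 kp kh)//.
  by rewrite (ler_pM2l kp); lra.
rewrite ler_pdivrMr ?(mulr_gt0 kp kh)//.
apply: le_trans ih _; rewrite le_eqVlt; apply/orP; left; apply/eqP.
by field; rewrite !gt_eqF//; lra.
Qed.

Lemma sum_even_le (f : nat -> R) n : (forall k, 0 <= f k) ->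
  \sum_(0 <= k < n) f (2 * k)%N <= \sum_(0 <= k < 2 * n) f k.
Proof.
move=> f0; elim: n => [|n ih]; first by rewrite muln0 !big_geq.
rewrite mulnS !big_nat_recr//=.
by rewrite -addrA lerD// lerDl.
Qed.

(** The bounds of [bessel_coef_le_half] are the even terms of the exponential
    series at 2 u. *)
Lemma bessel_series_le_expR a u : - (1 / 2) <= a -> 0 <= u ->
  bessel_series a (u ^+ 2) <= bessel_coef a 0 * expR (2 * u).
Proof.
move=> a1 u0; have a2 : -1 < a by lra.
have c0 := bessel_coef_gt0 0 a2.
apply: bessel_series_le => // [|n]; first exact: exprn_ge0.
apply: (@le_trans _ _ (\sum_(0 <= k < n)
    (bessel_coef a 0 * ((2 * u) ^+ (2 * k) / (2 * k)`!%:R)))).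
  rewrite /series/=; apply: ler_sum => k _.
  apply: le_trans (ler_wpM2l _ (bessel_coef_le_half k a1)) _; first by rewrite !exprn_ge0.
  rewrite le_eqVlt; apply/orP; left; apply/eqP.
  have -> : (2 * u) ^+ (2 * k) = 4 ^+ k * (u ^+ 2) ^+ k :> R.
    by rewrite exprM (_ : (2 * u) ^+ 2 = 4 * u ^+ 2) ?exprMn; last by ring.
  ring.
rewrite -mulr_sumr ler_pM2l//.
have u20 : 0 <= 2 * u by rewrite mulr_ge0.
apply: le_trans (series_exp_coeff_le_expR (2 * n) u20).
apply: (@sum_even_le (fun k => (2 * u) ^+ k / k`!%:R)) => k.
by rewrite divr_ge0// exprn_ge0.
Qed.

End bessel.

(** * The weighted measure *)

Section dw_sigma_finite.
Context {R : realType}.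
Implicit Types (alpha : R).
Local Notation leb := (@lebesgue_measure R).

Lemma measurable_dw_density alpha (D : set (measurableTypeR R)) :
  measurable_fun D (fun x : measurableTypeR R => (`|x| `^ (2 * alpha + 1))%:E).
Proof. by apply: measurable_funTS; solve_meas. Qed.

Lemma measurable_set_le d (T : measurableType d) (f g : T -> R) :
  measurable_fun setT f -> measurable_fun setT g ->
  measurable [set x | f x <= g x].
Proof.
by move=> mf mg; rewrite -[X in measurable X]setTI; exact: measurable_fun_le.
Qed.

Lemma measurable_set_lt d (T : measurableType d) (f g : T -> R) :
  measurable_fun setT f -> measurable_fun setT g ->
  measurable [set x | f x < g x].
Proof.
move=> mf mg; have mb := measurable_fun_ltr mf mg.
have := mb measurableT [set true] I; rewrite setTI.
by congr measurable; apply/seteqP; split.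
Qed.

Lemma dw_sigma_finite alpha : sigma_finite setT (dw alpha).
Proof.
(* The density is unbounded near 0 when 2 alpha + 1 < 0, hence the second cut. *)
pose F n := [set x : measurableTypeR R | `|x| <= n%:R] `&`
  [set x : measurableTypeR R | `|x| `^ (2 * alpha + 1) <= n%:R].
have mF n : measurable (F n).
  by apply: measurableI; apply: measurable_set_le; solve_meas.
exists F.
  apply/esym/seteqP; split => // x _.
  exists (Num.truncn (Num.max `|x| (`|x| `^ (2 * alpha + 1)))).+1 => //=.
  by split; apply: le_trans (ltW (truncnS_gt _)); rewrite le_max lexx ?orbT.
move=> n; split => //.
apply: (@le_lt_trans _ _ (\int[leb]_(x in F n) (n%:R)%:E)%E).
  apply: ge0_le_integral => //.
  - exact: measurable_dw_density.
  - by move=> x; case=> _ h; rewrite lee_fin.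
rewrite integral_cst// lte_mul_pinfty//.
apply: (@le_lt_trans _ _ (leb `[- n%:R, n%:R]%classic)).
  apply: le_measure; rewrite ?inE; [exact: mF|exact: measurable_itv|].
  by move=> x [/= h _]; rewrite /= in_itv/= -ler_norml.
by rewrite lebesgue_measure_itv/=; case: ifP => _; rewrite ?ltry// -EFinB ltry.
Qed.

HB.instance Definition _ (alpha : R) :=
  @Measure_isSigmaFinite.Build _ _ _ (dw alpha) (dw_sigma_finite alpha).

End dw_sigma_finite.

Section density.
Context {R : realType} {d} {T : measurableType d}.
Local Notation leb := (@lebesgue_measure R).

Lemma integral_indic_lt (c : R) : 0 <= c ->
  (\int[leb]_(l in `]0%R, +oo[) (if l < c then 1 else 0)%:E = c%:E)%E.
Proof.
move=> c0.
transitivity (\int[leb]_(l in `]0%R, c[) (cst 1 l))%E.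
  rewrite integral_mkcond [RHS]integral_mkcond; apply: eq_integral => l _.
  rewrite !patchE !mem_setE !in_itv/= andbT.
  by case: (0 < l) => //=; case: ifP.
rewrite integral_cst// mul1e [LHS]lebesgue_measure_itv/= lte_fin.
case: ltP => [_|c0']; first by rewrite -EFinB subr0.
by congr EFin; apply/eqP; rewrite eq_le c0.
Qed.

(** By the layer cake formula f(x) is the integral of 1 over 0 < l < f(x), so
    that after an exchange of integrals only the sets {l < f} matter, where
    the hypothesis on [nu] applies. *)
Lemma integral_density (mu nu : {sigma_finite_measure set T -> \bar R})
    (h f : T -> R) :
  measurable_fun setT h -> (forall x, 0 <= h x) ->
  (forall A, measurable A -> nu A = \int[mu]_(x in A) (h x)%:E)%E ->
  measurable_fun setT f -> (forall x, 0 <= f x) ->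
  (\int[nu]_x (f x)%:E = \int[mu]_x (h x * f x)%:E)%E.
Proof.
move=> mh h0 nuE mf f0.
have mlt : measurable_fun setT (fun z : T * measurableTypeR R => z.2 < f z.1).
  by apply: measurable_fun_ltr; [solve_meas|exact: measurableT_comp].
pose g (x : T) (l : measurableTypeR R) : \bar R := (if l < f x then 1 else 0)%:E.
have g0 x l : (0 <= g x l)%E by rewrite lee_fin; case: ifP.
have mg : measurable_fun setT (fun z : T * measurableTypeR R => g z.1 z.2).
  by rewrite /g; apply/measurable_EFinP; apply: measurable_fun_ifT.
transitivity (\int[nu]_(x in setT) \int[leb]_(l in `]0%R, +oo[) g x l)%E.
  by apply: eq_integral => x _; rewrite integral_indic_lt.
rewrite tonelli_on//.
pose g2 (x : T) (l : measurableTypeR R) : \bar R := ((h x)%:E * g x l)%E.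
transitivity (\int[leb]_(l in `]0%R, +oo[) \int[mu]_(x in setT) g2 x l)%E.
  apply: eq_integral => l _.
  have mA : measurable [set x | l < f x].
    by apply: measurable_set_lt => //; exact: measurable_cst.
  transitivity (nu [set x | l < f x]).
    transitivity (\int[nu]_x (\1_[set x | l < f x] x)%:E)%E.
      apply: eq_integral => x _; rewrite /g indicE.
      by case: ifPn => lf; [rewrite mem_set|rewrite memNset//; exact/negP].
    by rewrite integral_indic// setIT.
  rewrite nuE// integral_mkcond; apply: eq_integral => x _.
  rewrite patchE /g2 /g; case: (ltP l (f x)) => lf.
    by rewrite mem_set// mule1.
  by rewrite memNset ?mule0//; apply/negP; rewrite -leNgt.
rewrite -tonelli_on//.
- apply: eq_integral => x _; rewrite /g2.
  rewrite ge0_integralZl_EFin//; first by rewrite integral_indic_lt// EFinM.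
  apply: measurable_funTS; apply/measurable_EFinP; apply: measurable_fun_ifT => //.
  by apply: measurable_fun_ltr; solve_meas.
- rewrite /g2; apply: emeasurable_funM => //.
  by apply/measurable_EFinP; apply: measurableT_comp.
- by move=> x l; rewrite mule_ge0// lee_fin.
Qed.

End density.

Section dw_integral.
Context {R : realType}.
Implicit Types (alpha : R).
Local Notation leb := (@lebesgue_measure R).

Lemma integral_dwE alpha (f : measurableTypeR R -> R) :
  measurable_fun setT f -> (forall x, 0 <= f x) ->
  (\int[dw alpha]_x (f x)%:E = \int[leb]_x (`|x| `^ (2 * alpha + 1) * f x)%:E)%E.
Proof.
move=> mf f0; apply: integral_density => //.
by apply/measurable_EFinP; exact: measurable_dw_density.
Qed.

Lemma integral_dw_pos alpha (f : measurableTypeR R -> R) :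
  measurable_fun setT f -> (forall x, 0 <= f x) ->
  (\int[dw alpha]_(x in `]0%R, +oo[) (f x)%:E =
   \int[leb]_(x in `]0%R, +oo[) (x `^ (2 * alpha + 1) * f x)%:E)%E.
Proof.
move=> mf f0.
rewrite integral_mkcond [RHS]integral_mkcond.
transitivity (\int[dw alpha]_x ((if 0 < x then f x else 0)%:E))%E.
  by apply: eq_integral => x _; rewrite patchE mem_setE in_itv/= andbT; case: ifP.
rewrite integral_dwE; last 2 first.
- by apply: measurable_fun_ifT => //; apply: measurable_fun_ltr; solve_meas.
- by move=> x; case: ifP.
apply: eq_integral => x _; rewrite patchE mem_setE in_itv/= andbT.
by case: ifPn => [x0|_]; [rewrite gtr0_norm|rewrite mulr0].
Qed.

Lemma integral_dw_even alpha (f : measurableTypeR R -> R) :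
  measurable_fun setT f -> (forall x, 0 <= f x) -> (forall x, f (- x) = f x) ->
  (\int[dw alpha]_x (f x)%:E =
   2%:E * \int[dw alpha]_(x in `]0%R, +oo[) (f x)%:E)%E.
Proof.
move=> mf f0 fN; rewrite integral_dwE// integral_dw_pos//.
have mg D : measurable_fun D
    (fun x : measurableTypeR R => (`|x| `^ (2 * alpha + 1) * f x)%:E).
  by apply: measurable_funTS; solve_meas.
have g0 x : (0 <= (`|x| `^ (2 * alpha + 1) * f x)%:E)%E.
  by rewrite lee_fin mulr_ge0 ?powR_ge0.
have -> : [set: measurableTypeR R] = `]-oo, 0%R] `|` `]0%R, +oo[.
  by apply/esym/seteqP; split => // x _ /=; rewrite !in_itv/= andbT; case: (leP x 0); [left|right].
rewrite ge0_integral_setU//=; last first.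
  rewrite disj_set2E; apply/eqP/seteqP; split => // x /=; rewrite !in_itv/= andbT => -[].
  by move=> x0; rewrite ltNge x0.
have := @ge0_integration_by_substitution0 _ _ (mg setT) g0.
under [X in _ = X -> _]eq_integral do rewrite normrN fN.
move=> <-.
rewrite -integral_itv_obnd_cbnd; last exact: mg.
have -> : (\int[leb]_(r in `]0%R, +oo[) (`|r| `^ (2 * alpha + 1) * f r)%:E =
   \int[leb]_(r in `]0%R, +oo[) (r `^ (2 * alpha + 1) * f r)%:E)%E.
  by apply: eq_integral => x; rewrite inE/= in_itv/= andbT => x0; rewrite gtr0_norm.
have -> : (2%:E = 1 + 1 :> \bar R)%E by rewrite -EFinD.
by rewrite ge0_muleDl// mul1e.
Qed.

End dw_integral.

(** * The heat kernels *)

Section kernel.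
Context {R : realType}.
Implicit Types (a t x y : R) (k n : nat).

(** Equal to 1 / (4 t) for t > 0; as a power it is nonnegative and measurable
    in t on the whole line. *)
Definition inv4 t : R := (4 * t) `^ (-1).

(** For t > 0 this is half of the Bessel heat kernel at (|x|, |y|). In terms
    of [bessel_series] it needs no limits on the axes, and it is jointly
    measurable. *)
Definition bheat a t x y : R :=
  (4 * t) `^ (- (a + 1)) * expR (- (x ^+ 2 * inv4 t + y ^+ 2 * inv4 t)) *
  bessel_series a (x ^+ 2 * inv4 t * (y ^+ 2 * inv4 t)).

(** The Dunkl heat kernel; for t > 0, [WW] agrees with it off the axes, which
    is enough since they are null. *)
Definition dheat a t x y : R :=
  bheat a t x y + (4 * t) `^ (- (a + 1)) *
    expR (- (x ^+ 2 * inv4 t + y ^+ 2 * inv4 t)) *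
    (x * y * inv4 t * bessel_series (a + 1) (x ^+ 2 * inv4 t * (y ^+ 2 * inv4 t))).

Lemma inv4_ge0 t : 0 <= inv4 t.
Proof. exact: powR_ge0. Qed.

Lemma inv4_arg_ge0 t x y : 0 <= x ^+ 2 * inv4 t * (y ^+ 2 * inv4 t).
Proof. by apply: mulr_ge0; apply: mulr_ge0; rewrite ?sqr_ge0 ?inv4_ge0. Qed.

Lemma inv4E t : 0 < t -> inv4 t = (4 * t)^-1.
Proof. by move=> t0; rewrite /inv4 powR_inv1// mulr_ge0// ltW. Qed.

Lemma measurable_bessel_series d (T : measurableType d) a (v : T -> R) :
  -1 < a -> measurable_fun setT v -> (forall z, 0 <= v z) ->
  measurable_fun setT (fun z => bessel_series a (v z)).
Proof.
move=> a1 mv v0.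
apply: (@measurable_fun_cvg _ _ _ _ (fun n z => series (fun k => v z ^+ k * bessel_coef a k) n)).
  move=> n; rewrite /series/=.
  by apply: measurable_sum => k; solve_meas.
by move=> z _; exact: bessel_series_cvg.
Qed.

Lemma measurable_bheat d (T : measurableType d) a (t x y : T -> R) : -1 < a ->
  measurable_fun setT t -> measurable_fun setT x -> measurable_fun setT y ->
  measurable_fun setT (fun z => bheat a (t z) (x z) (y z)).
Proof.
move=> a1 mt mx my; rewrite /bheat /inv4; apply: measurable_funM; first by solve_meas.
apply: measurable_bessel_series => //; first by solve_meas.
by move=> z; exact: inv4_arg_ge0.
Qed.

Lemma measurable_dheat d (T : measurableType d) a (t x y : T -> R) : -1 < a ->
  measurable_fun setT t -> measurable_fun setT x -> measurable_fun setT y ->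
  measurable_fun setT (fun z => dheat a (t z) (x z) (y z)).
Proof.
move=> a1 mt mx my; rewrite /dheat; apply: measurable_funD; first exact: measurable_bheat.
rewrite /inv4; apply: measurable_funM; first by solve_meas.
apply: measurable_funM; first by solve_meas.
apply: measurable_bessel_series => //; [lra|by solve_meas|].
by move=> z; exact: inv4_arg_ge0.
Qed.

Lemma besselIE a z : -1 < a -> 0 < z ->
  besselI a z = (z / 2) `^ a * bessel_series a ((z / 2) ^+ 2).
Proof.
move=> a1 z0; have u0 : 0 < z / 2 by rewrite divr_gt0.
rewrite /besselI; apply/cvg_lim => //.
have -> : series (fun k => (z / 2) `^ (2 * k%:R + a) / (k`!%:R * Gamma (k%:R + a + 1))) =
    (fun n => (z / 2) `^ a * series (fun k => ((z / 2) ^+ 2) ^+ k * bessel_coef a k) n).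
  apply/funext => n; rewrite /series/= mulr_sumr; apply: eq_bigr => k _.
  rewrite powRD; last by rewrite (gt_eqF u0) implybT.
  have -> : (z / 2) `^ (2 * k%:R) = ((z / 2) ^+ 2) ^+ k.
    by rewrite -natrM powR_mulrn ?(ltW u0)// exprM.
  by rewrite /bessel_coef; ring.
apply: cvgM; first exact: cvg_cst.
by apply: bessel_series_cvg => //; exact: exprn_ge0 (ltW u0).
Qed.

Lemma W_posE a t x y : -1 < a -> 0 < t -> 0 < x -> 0 < y ->
  W_pos a t x y = 2 * bheat a t x y.
Proof.
move=> a1 t0 x0 y0; have t4 : 0 < 4 * t by rewrite mulr_gt0.
have xy0 : 0 < x * y by rewrite mulr_gt0.
rewrite /W_pos besselIE//; last by rewrite divr_gt0// mulr_gt0.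
have -> : x * y / (2 * t) / 2 = (x * y) * inv4 t by rewrite inv4E//; field; lra.
rewrite /bheat.
have -> : ((x * y) * inv4 t) ^+ 2 = x ^+ 2 * inv4 t * (y ^+ 2 * inv4 t) by ring.
set B := bessel_series _ _.
have -> : - (x ^+ 2 + y ^+ 2) / (4 * t) = - (x ^+ 2 * inv4 t + y ^+ 2 * inv4 t).
  by rewrite inv4E//; field; lra.
set E := expR _.
have -> : (2 * t)^-1 = 2 * (4 * t) `^ (-1).
  by rewrite powR_inv1 ?ltW//; field; lra.
rewrite (@powRM _ (x * y) (inv4 t) a) ?(ltW xy0) ?inv4_ge0// /inv4 -(powRrM (4 * t)) mulN1r opprD.
rewrite [in RHS](powRD (x := 4 * t)); last by rewrite (gt_eqF t4) implybT.
rewrite powRN; have h : (x * y) `^ a != 0 by rewrite gt_eqF// powR_gt0.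
by field.
Qed.

Lemma WWE a t x y : -1 < a -> 0 < t -> x != 0 -> y != 0 ->
  WW a t x y = dheat a t x y.
Proof.
move=> a1 t0 x0 y0; have t4 : 0 < 4 * t by rewrite mulr_gt0.
rewrite /WW /W !normr_gt0 x0 y0/= !W_posE ?normr_gt0//; last by lra.
rewrite /dheat /bheat !real_normK ?num_real//.
set B := bessel_series a _; set B' := bessel_series (a + 1) _; set E := expR _.
have -> : (4 * t) `^ (- (a + 1 + 1)) = (4 * t) `^ (- (a + 1)) * inv4 t.
  by rewrite opprD powRD// (gt_eqF t4) implybT.
by field.
Qed.

Lemma bheat_ge0 a t x y : -1 < a -> 0 <= bheat a t x y.
Proof.
move=> a1; rewrite /bheat mulr_ge0 ?mulr_ge0 ?powR_ge0 ?expR_ge0//.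
by apply: bessel_series_ge0 => //; exact: inv4_arg_ge0.
Qed.

Lemma bheat_sym a t x y : bheat a t x y = bheat a t y x.
Proof.
by rewrite /bheat [x ^+ 2 * _ + _]addrC [x ^+ 2 * _ * (y ^+ 2 * _)]mulrC.
Qed.

Lemma bheat_opp a t x y : bheat a t x (- y) = bheat a t x y.
Proof. by rewrite /bheat sqrrN. Qed.

(** By [bessel_series_shift_le] the odd part is at most a multiple of the even
    one, on both sides of the origin. *)
Lemma dheat_le a t x y : -1 < a -> `|dheat a t x y| <= (1 + 2 / slope a) * bheat a t x y.
Proof.
move=> a1; apply: le_trans (ler_normD _ _) _.
rewrite [leRHS]mulrDl mul1r ger0_norm ?bheat_ge0// lerD2l.
rewrite normrM ger0_norm ?mulr_ge0 ?powR_ge0 ?expR_ge0//.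
rewrite /bheat [leRHS]mulrCA ler_wpM2l ?mulr_ge0 ?powR_ge0 ?expR_ge0//.
have -> : x ^+ 2 * inv4 t * (y ^+ 2 * inv4 t) = `|x * y * inv4 t| ^+ 2.
  by rewrite real_normK ?num_real//; ring.
rewrite normrM [X in _ * X]ger0_norm; first exact: bessel_series_shift_le.
by apply: bessel_series_ge0; [lra|exact: sqr_ge0].
Qed.

Lemma dheat_ge a t x y : -1 < a -> 0 <= x * y -> bheat a t x y <= dheat a t x y.
Proof.
move=> a1 xy0; rewrite /dheat lerDl; apply: mulr_ge0.
  by rewrite mulr_ge0 ?powR_ge0 ?expR_ge0.
apply: mulr_ge0; first by rewrite mulr_ge0 ?inv4_ge0.
by apply: bessel_series_ge0; [lra|exact: inv4_arg_ge0].
Qed.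

(** Ultracontractivity: the growth exp(2 |x y| / (4 t)) of the Bessel factor
    completes the square in the Gaussian, leaving exp(- (|x| - |y|)^2 / (4 t))
    <= 1. *)
Lemma bheat_le a t x y : - (1 / 2) <= a -> bheat a t x y <= bessel_coef a 0 * (4 * t) `^ (- (a + 1)).
Proof.
move=> a1; have a2 : -1 < a by lra.
rewrite /bheat -mulrA [leRHS]mulrC ler_wpM2l ?powR_ge0//.
have -> : x ^+ 2 * inv4 t * (y ^+ 2 * inv4 t) = (`|x| * `|y| * inv4 t) ^+ 2.
  by rewrite !exprMn !real_normK ?num_real//; ring.
have u0 : 0 <= `|x| * `|y| * inv4 t by rewrite !mulr_ge0 ?inv4_ge0.
apply: le_trans (ler_wpM2l (expR_ge0 _) (bessel_series_le_expR a1 u0)) _.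
rewrite mulrCA -expRD ler_piMr ?(ltW (bessel_coef_gt0 _ _))// -[leRHS]expR0 ler_expR.
have -> : - (x ^+ 2 * inv4 t + y ^+ 2 * inv4 t) + 2 * (`|x| * `|y| * inv4 t) =
  - ((`|x| - `|y|) ^+ 2 * inv4 t).
  by rewrite -(real_normK (num_real x)) -(real_normK (num_real y)); ring.
by rewrite oppr_le0 mulr_ge0 ?sqr_ge0 ?inv4_ge0.
Qed.

(** Substitute for [bheat_le] when a < -1/2, locally uniform in x: the factor
    exp(y^2 / (4 t)) from [bessel_series_mul_le] cancels the Gaussian in y. *)
Lemma bheat_le_loc a t x y : -1 < a -> 1 <= t ->
  bheat a t x y <= bessel_coef a 0 * expR (x ^+ 2 / slope a) * (4 * t) `^ (- (a + 1)).
Proof.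
move=> a1 t1; have m0 := slope_gt0 a1; have c0 := bessel_coef_gt0 0 a1.
have t0 : 0 < t by lra.
rewrite /bheat -mulrA [leRHS]mulrC ler_wpM2l ?powR_ge0//.
have v0 : 0 <= x ^+ 2 * inv4 t by rewrite mulr_ge0 ?inv4_ge0 ?sqr_ge0.
have w0 : 0 <= y ^+ 2 * inv4 t by rewrite mulr_ge0 ?inv4_ge0 ?sqr_ge0.
apply: le_trans (ler_wpM2l (expR_ge0 _) (bessel_series_mul_le a1 v0 w0)) _.
rewrite mulrC -!mulrA ler_pM2l// -!expRD ler_expR.
have h : inv4 t <= 1 by rewrite inv4E// invf_le1; lra.
have : x ^+ 2 * inv4 t / slope a <= x ^+ 2 / slope a.
  by rewrite ler_pM2r ?invr_gt0// ler_piMr// sqr_ge0.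
lra.
Qed.

Lemma bheat_ge a t x y : -1 < a ->
  (4 * t) `^ (- (a + 1)) * expR (- (x ^+ 2 * inv4 t + y ^+ 2 * inv4 t)) * bessel_coef a 0 <=
  bheat a t x y.
Proof.
move=> a1; rewrite /bheat ler_wpM2l ?mulr_ge0 ?powR_ge0 ?expR_ge0//.
by apply: bessel_series_ge => //; exact: inv4_arg_ge0.
Qed.

End kernel.

(** * Mass and variance of the heat kernel *)

Section mass.
Context {R : realType}.
Local Notation leb := (@lebesgue_measure R).
Implicit Types (a t x y r l : R) (k n : nat).

Lemma gauss_moment a r n : -1 < a -> 0 < r ->
  (\int[leb]_(y in `]0%R, +oo[)
     (y `^ (2 * a + 1) * ((y ^+ 2 / r) ^+ n * expR (- (y ^+ 2 / r))))%:E =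
   (2^-1 * r `^ (a + 1) * Gamma (n%:R + a + 1))%:E)%E.
Proof.
move=> a1 r0; have s0 := gamma_arg_gt0 n a1; have rn : 0 <= r^-1 ^+ n by rewrite exprn_ge0 ?invr_ge0 ?ltW.
transitivity (\int[leb]_(y in `]0%R, +oo[) ((r^-1 ^+ n)%:E *
    (y `^ (2 * (n%:R + a + 1) - 1) * expR (- (y ^+ 2 / r)))%:E))%E.
  apply: eq_integral => y; rewrite inE/= in_itv/= andbT => y0.
  rewrite -EFinM; congr EFin.
  have -> : 2 * (n%:R + a + 1) - 1 = (2 * a + 1) + (2 * n)%:R.
    by rewrite natrM; ring.
  rewrite (@powRD _ y (2 * a + 1)); last by rewrite (gt_eqF y0) implybT.
  by rewrite powR_mulrn ?(ltW y0)// exprM exprMn; ring.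
rewrite ge0_integralZl_EFin//; last 2 first.
- by move=> y _; rewrite lee_fin mulr_ge0 ?powR_ge0 ?expR_ge0.
- by apply: measurable_funTS; solve_meas.
rewrite integral_gauss_powR// -EFinM; congr EFin.
have -> : r `^ (n%:R + a + 1) = r ^+ n * r `^ (a + 1).
  by rewrite -addrA (@powRD _ r n%:R) ?(gt_eqF r0) ?implybT// powR_mulrn// ltW.
rewrite exprVn; field; rewrite gt_eqF// exprn_gt0//.
Qed.

Lemma eseriesZ (u : R ^nat) (c : R) : cvgn (series u) ->
  (\sum_(k <oo) (c * u k)%:E)%E = (c * limn (series u))%:E.
Proof.
move=> cu.
have E : series (fun k => c * u k) = (fun n => c * series u n).
  by apply/funext => n; rewrite /series/= mulr_sumr.
have cv : (fun n => c * series u n) @ \oo --> c * limn (series u).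
  by apply: cvgM => //; exact: cvg_cst.
rewrite eseries_EFin E.
  by congr EFin; apply/cvg_lim.
by apply/cvg_ex; eexists; exact: cv.
Qed.

(** Expanding the Bessel series exhibits the heat kernel as a Poisson mixture,
    of parameter x^2 / (4 t), of Gamma densities in y^2 / (4 t): integrals
    against it reduce to Gamma integrals. *)
Lemma integral_bheat_pos a t x (h : measurableTypeR R -> R) : -1 < a -> 0 < t ->
  measurable_fun setT h -> (forall y, 0 <= h y) ->
  (\int[dw a]_(y in `]0%R, +oo[) (bheat a t x y * h y)%:E =
   \sum_(k <oo) ((4 * t) `^ (- (a + 1)) * expR (- (x ^+ 2 / (4 * t))) *
       (x ^+ 2 / (4 * t)) ^+ k * bessel_coef a k)%:E *
     \int[leb]_(y in `]0%R, +oo[) (y `^ (2 * a + 1) *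
       ((y ^+ 2 / (4 * t)) ^+ k * expR (- (y ^+ 2 / (4 * t)))) * h y)%:E)%E.
Proof.
move=> a1 t0 mh h0; set i := (4 * t)^-1; have i0 : 0 < i by rewrite invr_gt0 mulr_gt0.
have ti : inv4 t = i by rewrite inv4E.
rewrite integral_dw_pos; last 2 first.
- by apply: measurable_funM => //; apply: measurable_bheat.
- by move=> y; rewrite mulr_ge0 ?bheat_ge0.
pose A k := (4 * t) `^ (- (a + 1)) * expR (- (x ^+ 2 * i)) * (x ^+ 2 * i) ^+ k * bessel_coef a k.
have A0 k : 0 <= A k.
  rewrite /A !mulr_ge0 ?powR_ge0 ?expR_ge0 ?exprn_ge0 ?(ltW (bessel_coef_gt0 _ _))//.
  by rewrite mulr_ge0 ?sqr_ge0 ?ltW.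
pose f k (y : measurableTypeR R) : \bar R := ((A k)%:E * (y `^ (2 * a + 1) *
       ((y ^+ 2 * i) ^+ k * expR (- (y ^+ 2 * i))) * h y)%:E)%E.
have B0 k y : 0 <= y `^ (2 * a + 1) *
       ((y ^+ 2 * i) ^+ k * expR (- (y ^+ 2 * i))) * h y.
  rewrite mulr_ge0// mulr_ge0 ?powR_ge0// mulr_ge0 ?expR_ge0// exprn_ge0//.
  by rewrite mulr_ge0 ?sqr_ge0 ?ltW.
transitivity (\int[leb]_(y in `]0%R, +oo[) \sum_(k <oo) f k y)%E.
  apply: eq_integral => y _.
  have v0 : 0 <= x ^+ 2 * i * (y ^+ 2 * i).
    by rewrite -ti; exact: inv4_arg_ge0.
  transitivity (((y `^ (2 * a + 1) * h y * (4 * t) `^ (- (a + 1)) *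
     expR (- (x ^+ 2 * i + y ^+ 2 * i))) *
     limn (series (fun k => (x ^+ 2 * i * (y ^+ 2 * i)) ^+ k * bessel_coef a k)))%:E)%E.
    by congr EFin; rewrite /bheat ti /bessel_series; ring.
  rewrite -eseriesZ; last exact: bessel_series_cvg.
  apply: eq_eseriesr => k _; rewrite /f /A -EFinM; congr EFin.
  by rewrite (opprD (x ^+ 2 * i)) expRD exprMn; ring.
rewrite integral_nneseries//.
- apply: eq_eseriesr => k _; rewrite /f ge0_integralZl_EFin//.
    by move=> y _; rewrite lee_fin B0.
  by apply: measurable_funTS; solve_meas.
- by move=> k; apply: measurable_funTS; rewrite /f; solve_meas.
- by move=> k y _; rewrite /f mule_ge0 ?lee_fin.
Qed.

Lemma bheat_mass a t x : -1 < a -> 0 < t -> (\int[dw a]_y (bheat a t x y)%:E = 1)%E.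
Proof.
move=> a1 t0; have r0 : 0 < 4 * t by rewrite mulr_gt0.
rewrite integral_dw_even; last 3 first.
- exact: measurable_bheat.
- by move=> y; exact: bheat_ge0.
- by move=> y; exact: bheat_opp.
under eq_integral do rewrite -[bheat _ _ _ _]mulr1.
rewrite (@integral_bheat_pos _ _ _ (fun=> 1))//.
set l := x ^+ 2 / (4 * t).
transitivity (2%:E * \sum_(k <oo) ((2^-1 * expR (- l)) * exp_coeff l k)%:E)%E.
  congr (_ * _)%E; apply: eq_eseriesr => k _.
  under eq_integral do rewrite mulr1.
  rewrite gauss_moment// -EFinM; congr EFin.
  rewrite powRN /bessel_coef /exp_coeff/=.
  have G0 := Gamma_gt0 (gamma_arg_gt0 k a1).
  have f0 : (0 : R) < k`!%:R by rewrite ltr0n fact_gt0.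
  have p0 : 0 < (4 * t) `^ (a + 1) by rewrite powR_gt0.
  by field; rewrite !gt_eqF.
rewrite eseriesZ; last exact: is_cvg_series_exp_coeff.
rewrite -/(expR l) -EFinM; congr EFin.
by rewrite expRN; have := expR_gt0 l => e0; field; rewrite gt_eqF.
Qed.

(** For K a Poisson variable of parameter l, the right-hand side is e^l times
    the expectation of (K + N - l)^2 + (K + N). *)
Lemma poisson_second_moment (N l : R) n : 0 <= N -> 0 <= l ->
  series (fun k => l ^+ k / k`!%:R * ((k%:R + N - l) ^+ 2 + (k%:R + N))) n <=
  (2 * l + N * (N + 1)) * expR l.
Proof.
move=> N0 l0; set u := fun k => _; set c := 2 * l + N * (N + 1).
have c0 : 0 <= c by rewrite /c; nra.
have f0 k : (0 : R) < k`!%:R by rewrite ltr0n fact_gt0.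
have u0 k : 0 <= u k.
  by rewrite /u mulr_ge0 ?divr_ge0 ?exprn_ge0 ?addr_ge0 ?sqr_ge0.
(* Telescoping form; the remainder is nonpositive as soon as m >= l. *)
have S m : series u m = c * series (exp_coeff l) m +
    l ^+ m / m`!%:R * (m%:R * (l - 2 * N - 1 - m%:R)).
  elim: m => [|m ih]; first by rewrite /series/= !big_geq// mulr0 mul0r mulr0 add0r.
  rewrite !seriesSr ih /exp_coeff/= /u /c factS natrM -(natr1 m) (exprSr l m).
  have := ler0n R m => m0; have := f0 m => fm.
  by field; rewrite !gt_eqF//; lra.
set m := maxn n (Num.truncn l).+1.
apply: (@le_trans _ _ (series u m)).
  by apply: nneg_series_homo => //; exact: leq_maxl.
rewrite S.
have h1 : c * series (exp_coeff l) m <= c * expR l.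
  by rewrite ler_wpM2l//; exact: series_exp_coeff_le_expR.
have lm : l <= m%:R.
  by apply: ltW; apply: lt_le_trans (truncnS_gt l) _; rewrite ler_nat leq_maxr.
have h2 : l ^+ m / m`!%:R * (m%:R * (l - 2 * N - 1 - m%:R)) <= 0.
  by rewrite mulr_ge0_le0 ?divr_ge0 ?exprn_ge0// mulr_ge0_le0//; lra.
by rewrite -[leRHS]addr0 lerD.
Qed.

(** The second moment about l of a Gamma variable of shape n + a + 1. The
    square is expanded with its cross term moved to the other side, so that
    all the integrands are nonnegative. *)
Lemma gauss_variance a r l n : -1 < a -> 0 < r -> 0 <= l ->
  (\int[leb]_(y in `]0%R, +oo[)
     (y `^ (2 * a + 1) * ((y ^+ 2 / r) ^+ n * expR (- (y ^+ 2 / r))) *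
       (y ^+ 2 / r - l) ^+ 2)%:E =
   (2^-1 * r `^ (a + 1) * Gamma (n%:R + a + 1) *
     ((n%:R + (a + 1) - l) ^+ 2 + (n%:R + (a + 1))))%:E)%E.
Proof.
move=> a1 r0 l0.
set F := fun (m : nat) (y : R) =>
  y `^ (2 * a + 1) * ((y ^+ 2 / r) ^+ m * expR (- (y ^+ 2 / r))).
have F0 m y : 0 <= F m y.
  rewrite /F mulr_ge0 ?powR_ge0// mulr_ge0 ?expR_ge0// exprn_ge0//.
  by rewrite divr_ge0 ?sqr_ge0 ?ltW.
have mF m : measurable_fun setT (F m : measurableTypeR R -> R) by rewrite /F; solve_meas.
set V := LHS.
have mV : measurable_fun setT
    (fun y : measurableTypeR R => F n y * (y ^+ 2 / r - l) ^+ 2).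
  by have mFn := mF n; solve_meas.
have : (V + (2 * l)%:E * \int[leb]_(y in `]0%R, +oo[) (F n.+1 y)%:E =
    \int[leb]_(y in `]0%R, +oo[) (F n.+2 y)%:E +
    (l ^+ 2)%:E * \int[leb]_(y in `]0%R, +oo[) (F n y)%:E)%E.
  have m2 c m D : measurable_fun D (fun y : measurableTypeR R => (c%:E * (F m y)%:E)%E).
    by apply: measurable_funTS; have mFm := mF m; solve_meas.
  have m3 m D : measurable_fun D (fun y : measurableTypeR R => (F m y)%:E).
    by apply: measurable_funTS; have mFm := mF m; solve_meas.
  have p2 m (D : set (measurableTypeR R)) y : D y -> (0 <= (F m y)%:E)%E.
    by move=> _; rewrite lee_fin F0.
  have p3 c m (D : set (measurableTypeR R)) : 0 <= c ->
      forall y, D y -> (0 <= c%:E * (F m y)%:E)%E.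
    by move=> c0 y _; rewrite mule_ge0 ?lee_fin ?F0.
  have l20 : 0 <= 2 * l by rewrite mulr_ge0.
  rewrite -!ge0_integralZl_EFin ?sqr_ge0//; do ?[exact: p2].
  have mV' D : measurable_fun D (fun y : measurableTypeR R =>
      (F n y * (y ^+ 2 / r - l) ^+ 2)%:E).
    by apply: measurable_funTS; apply/measurable_EFinP.
  have pV (D : set (measurableTypeR R)) y :
      D y -> (0 <= (F n y * (y ^+ 2 / r - l) ^+ 2)%:E)%E.
    by move=> _; rewrite lee_fin mulr_ge0 ?sqr_ge0 ?F0.
  rewrite /V -!ge0_integralD//; do ?[exact: p2|exact: p3 (sqr_ge0 _)|exact: p3|exact: pV].
  apply: eq_integral => y _; rewrite -!EFinM -!EFinD; congr EFin.
  by rewrite /F (exprSr _ n.+1) (exprSr _ n); ring.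
rewrite !gauss_moment//.
have -> : n.+2%:R + a + 1 = (n%:R + a + 1) + 1 + 1 :> R by rewrite -(natr1 n.+1) -(natr1 n); ring.
have -> : n.+1%:R + a + 1 = (n%:R + a + 1) + 1 :> R by rewrite -(natr1 n); ring.
have s0 := gamma_arg_gt0 n a1.
rewrite (GammaS (addr_gt0 s0 ltr01)) (GammaS s0).
have V0 : (0 <= V)%E.
  by apply: integral_ge0 => y _; rewrite lee_fin mulr_ge0 ?sqr_ge0 ?F0.
clearbody V; case: V V0 => [v| |]// _; rewrite -!EFinM -!EFinD => -[] h; congr EFin.
set G := Gamma _ in h *; set p := r `^ _ in h *.
apply: (addIr (2 * l * (2^-1 * p * ((n%:R + a + 1) * G)))); rewrite h.
by ring.
Qed.

(** Given the Poisson index k, the variable y^2 / (4 t) follows the Gamma law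
    of shape k + a + 1; averaging [gauss_variance] over k leaves
    [poisson_second_moment]. *)
Lemma bheat_variance a t x : -1 < a -> 0 < t ->
  (\int[dw a]_(y in `]0%R, +oo[)
     (bheat a t x y * (y ^+ 2 / (4 * t) - x ^+ 2 / (4 * t)) ^+ 2)%:E <=
   (2^-1 * (2 * (x ^+ 2 / (4 * t)) + (a + 1) * (a + 2)))%:E)%E.
Proof.
move=> a1 t0; have r0 : 0 < 4 * t by rewrite mulr_gt0.
set l := x ^+ 2 / (4 * t).
have l0 : 0 <= l by rewrite divr_ge0 ?sqr_ge0 ?ltW.
have N0 : 0 <= a + 1 by lra.
rewrite integral_bheat_pos//; last 2 first.
- by solve_meas.
- by move=> y; exact: sqr_ge0.
rewrite -/l.
set u := (fun k => l ^+ k / k`!%:R * ((k%:R + (a + 1) - l) ^+ 2 + (k%:R + (a + 1)))).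
have u0 k : 0 <= u k.
  apply: mulr_ge0; first by rewrite divr_ge0 ?exprn_ge0.
  by rewrite addr_ge0 ?sqr_ge0 ?(addr_ge0 (ler0n _ _) N0).
have [cu lu] := nneg_series_bounded u0 (fun n => poisson_second_moment n N0 l0).
rewrite (@eq_eseriesr _ _ (fun k => (2^-1 * expR (- l) * u k)%:E)); last first.
  move=> k _; rewrite gauss_variance// -EFinM; congr EFin.
  rewrite powRN /bessel_coef /u.
  have G0 := Gamma_gt0 (gamma_arg_gt0 k a1).
  have f0 : (0 : R) < k`!%:R by rewrite ltr0n fact_gt0.
  have p0 : 0 < (4 * t) `^ (a + 1) by rewrite powR_gt0.
  by field; rewrite !gt_eqF.
rewrite eseriesZ// lee_fin -mulrA ler_pM2l ?invr_gt0//.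
rewrite expRN ler_pdivrMl ?expR_gt0// mulrC.
apply: le_trans lu _; rewrite le_eqVlt; apply/orP; left; apply/eqP.
by rewrite (_ : a + 2 = a + 1 + 1)//; ring.
Qed.

End mass.

(** * The potential operator and its majorant *)

Section operator.
Context {R : realType}.
Local Notation leb := (@lebesgue_measure R).
Implicit Types (a s t x y : R) (f g : measurableTypeR R -> R).

(** The potential kernel built on [dheat]; it is jointly measurable, and
    equals [KK] off the axes. *)
Definition dpot a s x y : \bar R :=
  (((Gamma s)^-1)%:E *
   \int[leb]_(t in `]0%R, +oo[) (dheat a t x y * t `^ (s - 1))%:E)%E.

Lemma measurable_dpot a s : -1 < a ->
  measurable_fun setT (fun z : measurableTypeR R * measurableTypeR R => dpot a s z.1 z.2).
Proof.
move=> a1; rewrite /dpot; apply: emeasurable_funM; first exact: measurable_cst.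
apply: (@measurable_integral_param _ _ _ _ _ leb _
  (fun (z : measurableTypeR R * measurableTypeR R) t => (dheat a t z.1 z.2 * t `^ (s - 1))%:E)) => //.
apply/measurable_EFinP; apply: measurable_funM; last by solve_meas.
by apply: measurable_dheat => //; solve_meas.
Qed.

Lemma KK_dpot a s x y : -1 < a -> x != 0 -> y != 0 -> KK a s x y = dpot a s x y.
Proof.
move=> a1 x0 y0; rewrite /KK /dpot; congr (_ * _)%E.
by apply: eq_integral => t; rewrite inE/= in_itv/= andbT => t0; rewrite WWE.
Qed.

Lemma dw_set1 a (x : R) : dw a [set x] = 0%E.
Proof. by rewrite /dw/= integral_set1. Qed.

Lemma dw_ae_neq0 a : {ae dw a, forall y : R, y != 0}.
Proof.
exists [set 0]; split; [exact: measurable_set1|exact: dw_set1|].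
by move=> y /= /negP; rewrite negbK => /eqP.
Qed.

Lemma ae_dw_sub a (P Q : set R) : P `<=` Q ->
  {ae dw a, forall y, P y} -> {ae dw a, forall y, Q y}.
Proof.
move=> PQ [N [mN N0 hN]]; exists N; split=> //.
by apply: subset_trans hN; exact: subsetC.
Qed.

Lemma measurable_eq0 : measurable_fun setT (fun y : measurableTypeR R => y == 0).
Proof.
apply: (measurable_fun_bool true); rewrite setTI preimage_true.
rewrite (_ : [set _ | _] = [set 0]); first exact: measurable_set1.
by apply/seteqP; split => y /= /eqP.
Qed.

Lemma measurable_dpot_f a s x f : -1 < a -> measurable_fun setT f ->
  measurable_fun setT (fun y : measurableTypeR R => dpot a s x y * (f y)%:E)%E.
Proof.
move=> a1 mf; apply: emeasurable_funM; last exact/measurable_EFinP.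
have := measurable_dpot s a1.
by move=> h; apply: (measurableT_comp h (pair1_measurable x)).
Qed.

Lemma measurable_KK_f a s x f : -1 < a -> x != 0 -> measurable_fun setT f ->
  measurable_fun setT (fun y : measurableTypeR R => KK a s x y * (f y)%:E)%E.
Proof.
move=> a1 x0 mf.
rewrite (_ : (fun y => _) = (fun y : measurableTypeR R =>
    if y == 0%R then KK a s x 0%R * (f 0%R)%:E else dpot a s x y * (f y)%:E)%E).
  by apply: measurable_fun_ifT; [exact: measurable_eq0|exact: measurable_cst|
    exact: measurable_dpot_f].
by apply/funext => y; case: eqVneq => [->//|y0]; rewrite KK_dpot.
Qed.

Lemma IIE a s x f : -1 < a -> x != 0 -> measurable_fun setT f ->
  II a s f x = (\int[dw a]_y (dpot a s x y * (f y)%:E))%E.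
Proof.
move=> a1 x0 mf; apply: ae_eq_integral => //.
- exact: measurable_KK_f.
- exact: measurable_dpot_f.
- by apply: ae_dw_sub (dw_ae_neq0 a) => y y0 _; rewrite KK_dpot.
Qed.

Lemma measurable_II a s f : -1 < a -> measurable_fun setT f ->
  measurable_fun setT (II a s f : measurableTypeR R -> \bar R).
Proof.
move=> a1 mf.
rewrite (_ : II a s f = (fun x : measurableTypeR R => if x == 0%R then II a s f 0%R
    else \int[dw a]_y (dpot a s x y * (f y)%:E))%E); last first.
  by apply/funext => x; case: eqVneq => [->//|x0]; rewrite IIE.
apply: measurable_fun_ifT; [exact: measurable_eq0|exact: measurable_cst|].
apply: (@measurable_integral_param _ _ _ _ _ (dw a) setT
  (fun x y => dpot a s x y * (f y)%:E)%E) => //.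
apply: emeasurable_funM; first exact: measurable_dpot.
by apply/measurable_EFinP; apply: measurableT_comp.
Qed.

(** The potential of [g] for the positive kernel [bheat], without the factor 1
    / Gamma(s), using only the times in [D]. *)
Definition bpot a s (D : set (measurableTypeR R)) g x : \bar R :=
  (\int[dw a]_y \int[leb]_(t in D) (t `^ (s - 1) * (bheat a t x y * g y))%:E)%E.

Definition dom_cst a s : R := (Gamma s)^-1 * (1 + 2 / slope a).

Lemma dom_cst_ge0 a s : -1 < a -> 0 <= dom_cst a s.
Proof.
move=> a1; rewrite mulr_ge0 ?invr_ge0 ?Gamma_ge0// addr_ge0// divr_ge0//.
by rewrite ltW// slope_gt0.
Qed.

Lemma measurable_bheat_time a s x y (D : set (measurableTypeR R)) : -1 < a ->
  measurable_fun D (fun t : measurableTypeR R => (bheat a t x y * t `^ (s - 1))%:E).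
Proof.
move=> a1; apply: measurable_funTS; apply/measurable_EFinP.
by apply: measurable_funM; [apply: measurable_bheat|solve_meas].
Qed.

Lemma abse_dpot_le a s x y : -1 < a ->
  (`|dpot a s x y| <= (dom_cst a s)%:E *
    \int[leb]_(t in `]0%R, +oo[) (bheat a t x y * t `^ (s - 1))%:E)%E.
Proof.
move=> a1; have m0 := slope_gt0 a1.
have C0 : 0 <= 1 + 2 / slope a by rewrite addr_ge0// divr_ge0// ltW.
have h0 t : (0 <= (bheat a t x y * t `^ (s - 1))%:E)%E.
  by rewrite lee_fin mulr_ge0 ?powR_ge0 ?bheat_ge0.
have mw (D : set (measurableTypeR R)) :
    measurable_fun D (fun t : measurableTypeR R => (dheat a t x y * t `^ (s - 1))%:E).
  apply: measurable_funTS; apply/measurable_EFinP.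
  by apply: measurable_funM; [apply: measurable_dheat|solve_meas].
rewrite /dpot abseM /dom_cst EFinM -muleA gee0_abs ?lee_fin ?invr_ge0 ?Gamma_ge0//.
apply: lee_wpmul2l; first by rewrite lee_fin invr_ge0 Gamma_ge0.
apply: le_trans (le_abse_integral _ _ _) _ => //.
rewrite -ge0_integralZl_EFin//; last exact: measurable_bheat_time.
apply: ge0_le_integral => //.
- by apply: measurableT_comp.
- apply: emeasurable_funM; [exact: measurable_cst|exact: measurable_bheat_time].
- move=> t _; rewrite -EFinM lee_fin normrM [X in _ * X]ger0_norm ?powR_ge0//.
  by rewrite mulrA ler_wpM2r ?powR_ge0// dheat_le.
Qed.

Lemma measurable_bpot_integrand a s g d (T : measurableType d)
    (x y t : T -> measurableTypeR R) : -1 < a -> measurable_fun setT g ->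
  measurable_fun setT x -> measurable_fun setT y -> measurable_fun setT t ->
  measurable_fun setT (fun z => (t z `^ (s - 1) * (bheat a (t z) (x z) (y z) * g (y z)))%:E).
Proof.
move=> a1 mg mx my mt; apply/measurable_EFinP.
apply: measurable_funM; first by solve_meas.
by apply: measurable_funM; [apply: measurable_bheat|apply: measurableT_comp].
Qed.

Lemma bpot_integrand_ge0 a s g x y t : -1 < a -> (forall z, 0 <= g z) ->
  (0 <= (t `^ (s - 1) * (bheat a t x y * g y))%:E)%E.
Proof.
by move=> a1 g0; rewrite lee_fin mulr_ge0 ?powR_ge0// mulr_ge0 ?bheat_ge0.
Qed.

Lemma integral_abs_KK_le a s x f : -1 < a -> x != 0 -> measurable_fun setT f ->
  (\int[dw a]_y `|KK a s x y * (f y)%:E| <=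
   (dom_cst a s)%:E * bpot a s `]0%R, +oo[%classic (fun y => `|f y|%R) x)%E.
Proof.
move=> a1 x0 mf; rewrite /bpot.
have mf' : measurable_fun setT (fun y : measurableTypeR R => `|f y|) by solve_meas.
have m1 : measurable_fun setT (fun y : measurableTypeR R =>
    \int[leb]_(t in `]0%R, +oo[) (t `^ (s - 1) * (bheat a t x y * `|f y|%R))%:E)%E.
  apply: (@measurable_integral_param _ _ _ _ _ leb _
    (fun (y t : measurableTypeR R) => (t `^ (s - 1) * (bheat a t x y * `|f y|%R))%:E)) => //.
  by apply: (@measurable_bpot_integrand _ _ (fun y => `|f y|) _ _ (fun=> x)) => //; solve_meas.
rewrite -ge0_integralZl_EFin ?dom_cst_ge0//; last first.
  by move=> y _; apply: integral_ge0 => t _; apply: (@bpot_integrand_ge0 _ _ (fun y => `|f y|)).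
have -> : (\int[dw a]_y `|KK a s x y * (f y)%:E| =
           \int[dw a]_y `|dpot a s x y * (f y)%:E|)%E.
  apply: ae_eq_integral => //.
  - by apply: measurableT_comp => //; exact: measurable_KK_f.
  - by apply: measurableT_comp => //; exact: measurable_dpot_f.
  - by apply: ae_dw_sub (dw_ae_neq0 a) => y y0 _; rewrite KK_dpot.
apply: ge0_le_integral => //.
- by apply: measurableT_comp => //; exact: measurable_dpot_f.
- by apply: emeasurable_funM => //.
- move=> y _; rewrite abseM.
  apply: le_trans (lee_wpmul2r _ (abse_dpot_le s x y a1)) _ => //.
  rewrite -muleA lee_wpmul2l ?lee_fin ?dom_cst_ge0//.
  rewrite -ge0_integralZr//; last 2 first.
  * exact: measurable_bheat_time.
  * by move=> t _; rewrite lee_fin mulr_ge0 ?powR_ge0 ?bheat_ge0.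
  rewrite le_eqVlt; apply/orP; left; apply/eqP; apply: eq_integral => t _.
  by rewrite -EFinM; congr EFin; rewrite -mulrA mulrC [bheat _ _ _ _ * _]mulrC !mulrA.
Qed.

Lemma abse_II_le a s x f : -1 < a -> x != 0 -> measurable_fun setT f ->
  (`|II a s f x| <=
   (dom_cst a s)%:E * bpot a s `]0%R, +oo[%classic (fun y => `|f y|%R) x)%E.
Proof.
move=> a1 x0 mf; apply: le_trans (integral_abs_KK_le s a1 x0 mf).
by apply: le_abse_integral => //; exact: measurable_KK_f.
Qed.

Lemma lebesgue_nullU0 (N : set (measurableTypeR R)) : measurable N ->
  leb N = 0%E -> leb (N `|` [set 0]) = 0%E.
Proof.
move=> mN N0; apply/eqP; rewrite eq_le measure_ge0 andbT.
apply: le_trans (measureU2 leb mN (measurable_set1 _)) _.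
by rewrite [X in (X + _)%E]N0 add0e [leLHS]lebesgue_measure_set1.
Qed.

(** The density vanishes at most at the origin. *)
Lemma lebesgue_null_of_dw_null a (A : set (measurableTypeR R)) : measurable A ->
  dw a A = 0%E -> leb A = 0%E.
Proof.
move=> mA A0.
have h : measurable_fun A (fun x : measurableTypeR R => (`|x| `^ (2 * a + 1))%:E).
  exact: measurable_dw_density.
have : (\int[leb]_(x in A) `|(`|x| `^ (2 * a + 1))%:E| = 0)%E.
  by rewrite -[RHS]A0; apply: eq_integral => x _; rewrite gee0_abs// lee_fin powR_ge0.
move=> /(ae_eq_integral_abs leb mA h) [N [mN N0 hN]].
apply/eqP; rewrite eq_le measure_ge0 andbT.
apply: (@le_trans _ _ (leb (N `|` [set 0]))).
  apply: le_measure; rewrite ?inE//; first by apply: measurableU => //; exact: measurable_set1.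
  move=> x Ax; have [->|x0] := eqVneq x 0; [by right|left].
  apply: hN => /(_ Ax)/= [] /eqP; rewrite powR_eq0 normr_eq0 (negbTE x0)//.
by rewrite lebesgue_nullU0.
Qed.

Lemma Dom_II_bpot a s f : -1 < a -> measurable_fun setT f ->
  {ae dw a, forall x, (bpot a s `]0%R, +oo[%classic (fun y => `|f y|%R) x < +oo)%E} ->
  Dom_II a s f.
Proof.
move=> a1 mf [N [mN N0 hN]].
exists (N `|` [set 0]); split.
- by apply: measurableU => //; exact: measurable_set1.
- by apply: lebesgue_nullU0 => //; exact: lebesgue_null_of_dw_null N0.
- move=> x /= hx; have [->|x0] := eqVneq x 0; [by right|left].
  apply: hN => /= fin; apply: hx; apply/integrableP; split.
    exact: measurable_KK_f.
  apply: le_lt_trans (integral_abs_KK_le s a1 x0 mf) _.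
  by rewrite lte_mul_pinfty// ?lee_fin ?dom_cst_ge0.
Qed.

End operator.

Section majorant.
Context {R : realType}.
Local Notation leb := (@lebesgue_measure R).
Local Notation RM := (measurableTypeR R).
Variables (a s : R).
Hypotheses (a1 : -1 < a) (s0 : 0 < s).
Implicit Types (t x y T : R) (g : RM -> R) (D : set RM).

Lemma measurable_bpot D g : measurable D -> measurable_fun setT g -> (forall y, 0 <= g y) ->
  measurable_fun setT (bpot a s D g : RM -> \bar R).
Proof.
move=> mD mg g0; rewrite /bpot.
apply: (@measurable_integral_param _ _ _ _ _ (dw a) setT (fun x y : RM =>
  \int[leb]_(t in D) (t `^ (s - 1) * (bheat a t x y * g y))%:E)%E) => //.
apply: (@measurable_integral_param _ _ _ _ _ leb D (fun (z : RM * RM) (t : RM) =>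
  (t `^ (s - 1) * (bheat a t z.1 z.2 * g z.2))%:E)) => //.
by apply: measurable_bpot_integrand => //; solve_meas.
Qed.

Lemma measurable_bpot_inner D g x : measurable D -> measurable_fun setT g ->
  measurable_fun setT (fun y : RM =>
    \int[leb]_(t in D) (t `^ (s - 1) * (bheat a t x y * g y))%:E)%E.
Proof.
move=> mD mg.
apply: (@measurable_integral_param _ _ _ _ _ leb D (fun (y t : RM) =>
  (t `^ (s - 1) * (bheat a t x y * g y))%:E)) => //.
by apply: (@measurable_bpot_integrand _ _ _ g _ _ (fun=> x)) => //; solve_meas.
Qed.

Lemma measurable_bpot_t D g x y :
  measurable_fun D (fun t : RM => (t `^ (s - 1) * (bheat a t x y * g y))%:E).
Proof.
apply: measurable_funTS; apply/measurable_EFinP.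
apply: measurable_funM; first by solve_meas.
by apply: measurable_funM; [apply: measurable_bheat|exact: measurable_cst].
Qed.

Lemma measurable_bheat_y g t x : measurable_fun setT g ->
  measurable_fun setT (fun y : RM => (bheat a t x y * g y)%:E).
Proof.
by move=> mg; apply/measurable_EFinP; apply: measurable_funM => //; apply: measurable_bheat.
Qed.

Lemma bheat_y_ge0 g t x y : (forall y, 0 <= g y) -> (0 <= (bheat a t x y * g y)%:E)%E.
Proof. by move=> g0; rewrite lee_fin mulr_ge0// bheat_ge0. Qed.

Lemma bpot_inner_ge0 D g x y : (forall y, 0 <= g y) ->
  (0 <= \int[leb]_(t in D) (t `^ (s - 1) * (bheat a t x y * g y))%:E)%E.
Proof. by move=> g0; apply: integral_ge0 => t _; exact: bpot_integrand_ge0. Qed.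

Lemma bpot_ge0 D g x : (forall y, 0 <= g y) -> (0 <= bpot a s D g x)%E.
Proof. by move=> g0; apply: integral_ge0 => y _; exact: bpot_inner_ge0. Qed.

Lemma bpot_swap D g x : measurable D -> measurable_fun setT g -> (forall y, 0 <= g y) ->
  bpot a s D g x =
  (\int[leb]_(t in D) ((t `^ (s - 1))%:E * \int[dw a]_y (bheat a t x y * g y)%:E))%E.
Proof.
move=> mD mg g0; rewrite /bpot.
rewrite (@tonelli_on _ _ _ _ _ (dw a) leb setT D (fun y t : RM =>
  (t `^ (s - 1) * (bheat a t x y * g y))%:E)) //; last 2 first.
- by apply: (@measurable_bpot_integrand _ _ _ g _ _ (fun=> x)) => //; solve_meas.
- by move=> y t; exact: bpot_integrand_ge0.
apply: eq_integral => t _; under eq_integral do rewrite EFinM.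
rewrite ge0_integralZl_EFin ?powR_ge0//.
- by move=> y _; exact: bheat_y_ge0.
- exact: measurable_bheat_y.
Qed.

Lemma le_bpot D g1 g2 x : measurable D -> measurable_fun setT g1 -> measurable_fun setT g2 ->
  (forall y, 0 <= g1 y) -> (forall y, g1 y <= g2 y) ->
  (bpot a s D g1 x <= bpot a s D g2 x)%E.
Proof.
move=> mD m1 m2 g10 g12; have g20 y : 0 <= g2 y by exact: le_trans (g10 y) (g12 y).
apply: ge0_le_integral => //.
- by move=> y _; exact: bpot_inner_ge0.
- exact: measurable_bpot_inner.
- exact: measurable_bpot_inner.
- move=> y _; apply: ge0_le_integral => //.
  + by move=> t _; exact: bpot_integrand_ge0.
  + exact: measurable_bpot_t.
  + exact: measurable_bpot_t.
  + by move=> t _; rewrite lee_fin ler_wpM2l ?powR_ge0// ler_wpM2l ?bheat_ge0.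
Qed.

Lemma bpotD D g1 g2 x : measurable D -> measurable_fun setT g1 -> measurable_fun setT g2 ->
  (forall y, 0 <= g1 y) -> (forall y, 0 <= g2 y) ->
  bpot a s D (fun y => g1 y + g2 y) x = (bpot a s D g1 x + bpot a s D g2 x)%E.
Proof.
move=> mD m1 m2 g10 g20; rewrite /bpot -ge0_integralD//.
- apply: eq_integral => y _; rewrite -ge0_integralD//.
  + by apply: eq_integral => t _; rewrite -EFinD; congr EFin; ring.
  + by move=> t _; exact: bpot_integrand_ge0.
  + exact: measurable_bpot_t.
  + by move=> t _; exact: bpot_integrand_ge0.
  + exact: measurable_bpot_t.
- by move=> y _; exact: bpot_inner_ge0.
- exact: measurable_bpot_inner.
- by move=> y _; exact: bpot_inner_ge0.
- exact: measurable_bpot_inner.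
Qed.

Lemma bpotZ D g (c : R) x : measurable D -> measurable_fun setT g -> (forall y, 0 <= g y) ->
  0 <= c -> bpot a s D (fun y => c * g y) x = (c%:E * bpot a s D g x)%E.
Proof.
move=> mD mg g0 c0; rewrite /bpot -ge0_integralZl_EFin//.
- apply: eq_integral => y _; rewrite -ge0_integralZl_EFin//.
  + by apply: eq_integral => t _; rewrite -EFinM; congr EFin; ring.
  + by move=> t _; exact: bpot_integrand_ge0.
  + exact: measurable_bpot_t.
- by move=> y _; exact: bpot_inner_ge0.
- exact: measurable_bpot_inner.
Qed.

Lemma bpot_split T g x : 0 < T -> measurable_fun setT g -> (forall y, 0 <= g y) ->
  (bpot a s `]0%R, +oo[%classic g x <=
   bpot a s `]0%R, T]%classic g x + bpot a s `[T, +oo[%classic g x)%E.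
Proof.
move=> T0 mg g0; rewrite /bpot -ge0_integralD//; last 4 first.
- by move=> y _; exact: bpot_inner_ge0.
- exact: measurable_bpot_inner.
- by move=> y _; exact: bpot_inner_ge0.
- exact: measurable_bpot_inner.
apply: ge0_le_integral => //.
- by move=> y _; exact: bpot_inner_ge0.
- exact: measurable_bpot_inner.
- by apply: emeasurable_funD; exact: measurable_bpot_inner.
move=> y _.
have -> : `]0%R, +oo[%classic = `]0%R, T] `|` `]T, +oo[ :> set RM.
  by rewrite -itv_bndbnd_setU// bnd_simp// ltW.
rewrite ge0_integral_setU//=; last 3 first.
- by apply: measurable_funTS; exact: measurable_bpot_t.
- by move=> t _; exact: bpot_integrand_ge0.
- rewrite disj_set2E; apply/eqP/seteqP; split => // t /=; rewrite !in_itv/= => -[].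
  by move=> /andP[_ x1]; rewrite andbT ltNge x1.
rewrite leeD2l// integral_itv_obnd_cbnd//.
exact: measurable_bpot_t.
Qed.

Lemma integral_powR_0T T : 0 <= T ->
  (\int[leb]_(t in `]0%R, T]) (t `^ (s - 1))%:E = (T `^ s / s)%:E)%E.
Proof. by move=> T0; exact: integral_powR_0c. Qed.

(** The heat operators are contractions on bounded functions, as their kernels
    have mass 1 in y. *)
Lemma bpot_bounded T g x (c : R) : 0 <= T -> measurable_fun setT g ->
  (forall y, 0 <= g y) -> (forall y, g y <= c) ->
  (bpot a s `]0%R, T]%classic g x <= (c * (T `^ s / s))%:E)%E.
Proof.
move=> T0 mg g0 gc; have c0 : 0 <= c by exact: le_trans (g0 0) (gc 0).
rewrite bpot_swap// EFinM -integral_powR_0T// -ge0_integralZl_EFin//; last 2 first.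
- by move=> t _; rewrite lee_fin powR_ge0.
- exact: measurable_EFin_powR.
have mh : measurable_fun setT (fun t : RM => \int[dw a]_y (bheat a t x y * g y)%:E)%E.
  apply: (@measurable_integral_param _ _ _ _ _ (dw a) setT (fun t y : RM =>
     (bheat a t x y * g y)%:E)) => //.
  apply/measurable_EFinP; apply: measurable_funM; first by apply: measurable_bheat => //; solve_meas.
  exact: measurableT_comp.
apply: ge0_le_integral => //.
- move=> t _; rewrite mule_ge0 ?lee_fin ?powR_ge0//.
  by apply: integral_ge0 => y _; exact: bheat_y_ge0.
- apply: emeasurable_funM; first exact: measurable_EFin_powR.
  exact: measurable_funTS.
- apply: emeasurable_funM; first exact: measurable_cst.
  exact: measurable_EFin_powR.
move=> t; rewrite /= in_itv/= => /andP[t0 _].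
rewrite [leRHS]muleC lee_wpmul2l ?lee_fin ?powR_ge0//.
apply: (@le_trans _ _ (\int[dw a]_y (c%:E * (bheat a t x y)%:E))%E).
  apply: ge0_le_integral => //.
  - by move=> y _; exact: bheat_y_ge0.
  - exact: measurable_bheat_y.
  - by apply: emeasurable_funM => //; apply/measurable_EFinP; apply: measurable_bheat.
  - by move=> y _; rewrite -EFinM lee_fin mulrC ler_wpM2r ?bheat_ge0.
rewrite ge0_integralZl_EFin//.
- by rewrite bheat_mass// mule1.
- by move=> y _; rewrite lee_fin bheat_ge0.
- by apply/measurable_EFinP; apply: measurable_bheat.
Qed.

(** The heat operators preserve the integral, as their kernels have mass 1 in
    x by symmetry. *)
Lemma integral_bpot T g : 0 <= T -> measurable_fun setT g -> (forall y, 0 <= g y) ->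
  (\int[dw a]_x bpot a s `]0%R, T]%classic g x =
   (T `^ s / s)%:E * \int[dw a]_y (g y)%:E)%E.
Proof.
move=> T0 mg g0; rewrite /bpot.
rewrite (@tonelli_on _ _ _ _ _ (dw a) (dw a) setT setT (fun x y : RM =>
  \int[leb]_(t in `]0%R, T]) (t `^ (s - 1) * (bheat a t x y * g y))%:E)%E) //; last 2 first.
- apply: (@measurable_integral_param _ _ _ _ _ leb _ (fun (z : RM * RM) (t : RM) =>
    (t `^ (s - 1) * (bheat a t z.1 z.2 * g z.2))%:E)) => //.
  by apply: measurable_bpot_integrand => //; solve_meas.
- by move=> x y; exact: bpot_inner_ge0.
rewrite -ge0_integralZl_EFin//; last 3 first.
- by move=> y _; rewrite lee_fin.
- exact/measurable_EFinP.
- by rewrite divr_ge0 ?powR_ge0 ?ltW.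
apply: eq_integral => y _.
rewrite (@tonelli_on _ _ _ _ _ (dw a) leb setT `]0%R, T]%classic (fun x t : RM =>
  (t `^ (s - 1) * (bheat a t x y * g y))%:E)%E) //; last 2 first.
- by apply: (@measurable_bpot_integrand _ _ _ g _ _ _ (fun=> y)) => //; solve_meas.
- by move=> x t; exact: bpot_integrand_ge0.
transitivity (\int[leb]_(t in `]0%R, T]) ((g y)%:E * (t `^ (s - 1))%:E))%E; last first.
  rewrite ge0_integralZl_EFin//.
  - by rewrite integral_powR_0T// muleC.
  - by move=> t _; rewrite lee_fin powR_ge0.
  - exact: measurable_EFin_powR.
apply: eq_integral => t; rewrite inE/= in_itv/= => /andP[t0 _].
transitivity (\int[dw a]_x ((g y * t `^ (s - 1))%:E * (bheat a t y x)%:E))%E.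
  by apply: eq_integral => x _; rewrite -EFinM bheat_sym; congr EFin; ring.
rewrite ge0_integralZl_EFin ?mulr_ge0 ?powR_ge0//.
- by rewrite bheat_mass// mule1 EFinM.
- by move=> x _; rewrite lee_fin bheat_ge0.
- by apply/measurable_EFinP; apply: measurable_bheat.
Qed.

Lemma young_split p (u tau : R) : 1 <= p -> 0 < tau -> 0 <= u ->
  u <= tau + u `^ p * tau `^ (1 - p).
Proof.
move=> p1 tau0 u0; have [ut|tu] := leP u tau.
  by apply: (le_trans ut); rewrite lerDl mulr_ge0 ?powR_ge0.
have up : 0 < u by exact: lt_trans tu.
apply: (@le_trans _ _ (u `^ p * tau `^ (1 - p))); last by rewrite lerDr ltW.
have -> : tau `^ (1 - p) = (tau `^ (p - 1))^-1 by rewrite -powRN opprB.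
rewrite ler_pdivlMr ?powR_gt0//.
have -> : u `^ p = u * u `^ (p - 1) by rewrite mulr_powRB1//; lra.
by rewrite ler_pM2l// ge0_ler_powR ?nnegrE//; lra.
Qed.

(** At time t take tau = t^(-(a+1)/p) in g <= tau + g^p tau^(1-p). The mass of
    the kernel controls the first term and its pointwise bound the second,
    both by a multiple of tau, and t^(s-1) tau is integrable at infinity
    because s p < a + 1. The kernel bound is a hypothesis on the single point
    x, so as to cover both [bheat_le] and [bheat_le_loc]. *)
Lemma bpot_tail p T B g x : 1 <= p -> s * p < a + 1 -> 0 < T -> 0 <= B ->
  (forall t y, T <= t -> bheat a t x y <= B * t `^ (- (a + 1))) ->
  measurable_fun setT g -> (forall y, 0 <= g y) ->
  (\int[dw a]_y (g y `^ p)%:E <= 1)%E ->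
  (bpot a s `[T, +oo[%classic g x <=
   ((1 + B) / ((a + 1) / p - s) * T `^ (- ((a + 1) / p - s)))%:E)%E.
Proof.
move=> p1 sp T0 B0 hB mg g0 gp; set e := (a + 1) / p - s.
have p0 : 0 < p by lra.
have e0 : 0 < e by rewrite subr_gt0 ltr_pdivlMr.
have mgp : measurable_fun setT (fun y : RM => g y `^ p) by solve_meas.
rewrite bpot_swap//.
apply: (@le_trans _ _ (\int[leb]_(t in `[T, +oo[) ((1 + B)%:E * (t `^ (- e - 1))%:E))%E); last first.
  rewrite ge0_integralZl_EFin//; last 3 first.
  - by move=> t _; rewrite lee_fin powR_ge0.
  - exact: measurable_EFin_powR.
  - by lra.
  by rewrite integral_powR_pinfty// -EFinM lee_fin -mulrA [e^-1 * _]mulrC.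
have mh : measurable_fun setT (fun t : RM => \int[dw a]_y (bheat a t x y * g y)%:E)%E.
  apply: (@measurable_integral_param _ _ _ _ _ (dw a) setT (fun t y : RM =>
     (bheat a t x y * g y)%:E)) => //.
  apply/measurable_EFinP; apply: measurable_funM; first by apply: measurable_bheat => //; solve_meas.
  exact: measurableT_comp.
apply: ge0_le_integral => //.
- move=> t _; rewrite mule_ge0 ?lee_fin ?powR_ge0//.
  by apply: integral_ge0 => y _; exact: bheat_y_ge0.
- apply: emeasurable_funM; first exact: measurable_EFin_powR.
  exact: measurable_funTS.
- apply: emeasurable_funM; first exact: measurable_cst.
  exact: measurable_EFin_powR.
move=> t; rewrite /= in_itv/= andbT => Tt; have t0 : 0 < t by exact: lt_le_trans Tt.
set tau := t `^ (- ((a + 1) / p)); have tau0 : 0 < tau by rewrite powR_gt0.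
apply: (@le_trans _ _ ((t `^ (s - 1))%:E * ((1 + B) * tau)%:E)%E); last first.
  rewrite -!EFinM lee_fin le_eqVlt; apply/orP; left; apply/eqP.
  rewrite mulrCA /tau -powRD; last by rewrite (gt_eqF t0) implybT.
  by congr (_ * _ `^ _); rewrite /e; ring.
rewrite lee_wpmul2l ?lee_fin ?powR_ge0//.
set c := B * t `^ (- (a + 1)) * tau `^ (1 - p).
have c0 : 0 <= c by rewrite !mulr_ge0 ?powR_ge0.
apply: (@le_trans _ _ (\int[dw a]_y (tau%:E * (bheat a t x y)%:E + c%:E * (g y `^ p)%:E))%E).
  apply: ge0_le_integral => //.
  - by move=> y _; exact: bheat_y_ge0.
  - exact: measurable_bheat_y.
  - apply: emeasurable_funD; apply: emeasurable_funM => //; apply/measurable_EFinP => //.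
    by apply: measurable_bheat.
  - move=> y _; rewrite -!EFinM -EFinD lee_fin.
    have := young_split p1 tau0 (g0 y).
    move=> /(ler_wpM2l (bheat_ge0 t x y a1)) h; apply: (le_trans h).
    rewrite mulrDr mulrC lerD2l /c mulrCA [_ * g y `^ p]mulrC ler_wpM2l ?powR_ge0//.
    by rewrite ler_wpM2r ?powR_ge0// hB.
rewrite ge0_integralD//; last 4 first.
- by move=> y _; rewrite mule_ge0 ?lee_fin ?bheat_ge0// ltW.
- by apply: emeasurable_funM => //; apply/measurable_EFinP; apply: measurable_bheat.
- by move=> y _; rewrite mule_ge0 ?lee_fin ?powR_ge0.
- by apply: emeasurable_funM => //; apply/measurable_EFinP.
rewrite ge0_integralZl_EFin ?(ltW tau0)//; last 2 first.
- by move=> y _; rewrite lee_fin bheat_ge0.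
- by apply/measurable_EFinP; apply: measurable_bheat.
rewrite bheat_mass// mule1.
rewrite ge0_integralZl_EFin//; last 2 first.
- by move=> y _; rewrite lee_fin powR_ge0.
- exact/measurable_EFinP.
apply: (@le_trans _ _ (tau%:E + c%:E * 1)%E); first by rewrite leeD2l// lee_wpmul2l ?lee_fin.
rewrite mule1 -EFinD lee_fin mulrDl mul1r lerD2l.
rewrite /c -mulrA ler_wpM2l// /tau -powRrM -powRD; last by rewrite (gt_eqF t0) implybT.
rewrite le_eqVlt; apply/orP; left; apply/eqP; congr (_ `^ _).
by field; rewrite gt_eqF.
Qed.

End majorant.

(** * The distribution inequality *)

Section distribution_inequality.
Context {R : realType}.
Local Notation leb := (@lebesgue_measure R).
Local Notation RM := (measurableTypeR R).
Variables (a s : R).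
Hypotheses (a1 : -1 < a) (s0 : 0 < s) (sN : s < a + 1).
Implicit Types (t x y T p l : R) (g f : RM -> R).

Definition ultra_cst : R := bessel_coef a 0 * 4 `^ (- (a + 1)).

Lemma ultra_cst_gt0 : 0 < ultra_cst.
Proof. by rewrite mulr_gt0 ?bessel_coef_gt0 ?powR_gt0. Qed.

Lemma powRM4 t : 0 < t -> (4 * t) `^ (- (a + 1)) = 4 `^ (- (a + 1)) * t `^ (- (a + 1)).
Proof. by move=> t0; rewrite powRM// ltW. Qed.

Lemma measurable_powR_fun g p : measurable_fun setT g ->
  measurable_fun setT (fun y : RM => g y `^ p).
Proof. by move=> mg; solve_meas. Qed.

(** By [bpot_tail] the contribution of times above 1 is finite everywhere. For
    times below 1, g <= 1 + g^p bounds the potential by a bounded function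
    plus an integrable one. *)
Lemma bpot_ae_finite p g : 1 <= p -> s * p < a + 1 ->
  measurable_fun setT g -> (forall y, 0 <= g y) ->
  (\int[dw a]_y (g y `^ p)%:E <= 1)%E ->
  {ae dw a, forall x, (bpot a s `]0%R, +oo[%classic g x < +oo)%E}.
Proof.
move=> p1 sp mg g0 gp; have mgp := measurable_powR_fun p mg.
have gp0 y : 0 <= g y `^ p by exact: powR_ge0.
have : (dw a).-integrable setT (bpot a s `]0%R, 1%R]%classic (fun y => g y `^ p)
   : RM -> \bar R).
  apply/integrableP; split; first exact: measurable_bpot.
  under eq_integral do rewrite gee0_abs ?bpot_ge0//.
  rewrite integral_bpot// lte_mul_pinfty// ?lee_fin ?divr_ge0 ?powR_ge0 ?(ltW s0)//.
  by apply: le_lt_trans gp _; rewrite ltry.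
move=> /(integrable_ae measurableT); apply: ae_dw_sub => x /(_ I) fx.
apply: le_lt_trans (bpot_split s a1 x ltr01 mg g0) _.
apply: lte_add_pinfty.
  apply: (@le_lt_trans _ _ (bpot a s `]0%R, 1%R]%classic (fun y => 1 + g y `^ p) x)).
    apply: le_bpot => //; first by apply: measurable_funD => //; exact: measurable_cst.
    move=> y; have := young_split p1 ltr01 (g0 y).
    by rewrite powR1 mulr1.
  rewrite (@bpotD _ _ _ a1 _ (fun=> 1))//.
  apply: lte_add_pinfty; last by rewrite -ge0_fin_numE ?bpot_ge0.
  apply: (@le_lt_trans _ _ (1 * (1 `^ s / s))%:E); last by rewrite ltry.
  by apply: bpot_bounded.
have B0 : 0 <= bessel_coef a 0 * expR (x ^+ 2 / slope a) * 4 `^ (- (a + 1)).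
  by rewrite !mulr_ge0 ?expR_ge0 ?powR_ge0// ltW// bessel_coef_gt0.
apply: le_lt_trans (bpot_tail a1 (p := p) (B := _) p1 sp ltr01 B0 _ mg g0 gp) _.
  move=> t y t1; apply: le_trans (bheat_le_loc x y a1 t1) _.
  by rewrite powRM4 ?mulrA//; lra.
by rewrite ltry.
Qed.

Section distribution.
Variable p : R.
Hypotheses (a2 : - (1 / 2) <= a) (p1 : 1 <= p) (sp : s * p < a + 1).

(** This is (a + 1) / q, for 1 / q = 1 / p - s / (a + 1). *)
Definition hls_gap : R := (a + 1) / p - s.
(** This is q / p for the same q. *)
Definition hls_ratio : R := 1 + s / hls_gap.
(** Scale of the height [hls_level * l `^ hls_ratio] at which a function is cut when
    its potential is compared with l; see the choice of T in [bpot_distribution]. *)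
Definition hls_level : R := s / 4 * (2 * ((1 + ultra_cst) / hls_gap)) `^ (- (s / hls_gap)).

Lemma hls_gap_gt0 : 0 < hls_gap.
Proof. by rewrite subr_gt0 ltr_pdivlMr//; exact: lt_le_trans p1. Qed.

Lemma hls_ratio_gt0 : 0 < hls_ratio.
Proof. by rewrite addr_gt0// divr_gt0// hls_gap_gt0. Qed.

Lemma hls_level_gt0 : 0 < hls_level.
Proof.
have h := ultra_cst_gt0; have h' := hls_gap_gt0.
rewrite mulr_gt0 ?divr_gt0// powR_gt0// mulr_gt0// divr_gt0//; lra.
Qed.

(** T makes the times above T contribute at most l / 2, and tau makes the part
    of g below tau contribute at most l / 4 over the times below T. Where the
    potential exceeds l, the part of g above tau thus contributes at least l /
    4; its total integral is T^s / s times that of g over {g > tau}. *)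
Lemma bpot_distribution g l : 0 < l -> measurable_fun setT g -> (forall y, 0 <= g y) ->
  (\int[dw a]_y (g y `^ p)%:E <= 1)%E ->
  (dw a [set x : RM | l%:E < bpot a s `]0%R, +oo[%classic g x] <=
   ((hls_level * l `^ hls_ratio)^-1)%:E *
     \int[dw a]_y (if hls_level * l `^ hls_ratio < g y then g y else 0)%:E)%E.
Proof.
move=> l0 mg g0 gp; set tau := hls_level * l `^ hls_ratio.
have e0 := hls_gap_gt0; have B0 := ultra_cst_gt0.
set B' := (1 + ultra_cst) / hls_gap; have B'0 : 0 < B' by rewrite divr_gt0//; lra.
(* The time at which the tail bound B' T^(-gap) equals l / 2. *)
set T := (2 * B' / l) `^ hls_gap^-1.
have BB0 : 0 < 2 * B' / l by rewrite divr_gt0// mulr_gt0.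
have T0 : 0 < T by rewrite powR_gt0.
have Te : B' * T `^ (- hls_gap) = l / 2.
  rewrite /T -powRrM mulrN mulVf ?gt_eqF// powRN powRr1 ?ltW//.
  by field; rewrite !gt_eqF.
have Ts0 : 0 < T `^ s by rewrite powR_gt0.
have tauE : tau = s * l / (4 * T `^ s).
  rewrite /tau /hls_level /hls_ratio -/B' powRD; last by rewrite (gt_eqF l0) implybT.
  rewrite powRr1 ?ltW// /T -powRrM [hls_gap^-1 * s]mulrC.
  have B2 : 0 <= 2 * B' by rewrite mulr_ge0// ltW.
  have li : 0 <= l^-1 by rewrite invr_ge0 ltW.
  rewrite (powRM _ B2 li).
  rewrite -[in RHS](powR_inv1 (ltW l0)) -(powRrM l) mulN1r !powRN.
  have h1 : 0 < (2 * B') `^ (s / hls_gap) by rewrite powR_gt0// mulr_gt0.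
  have h2 : 0 < l `^ (s / hls_gap) by rewrite powR_gt0.
  by field; rewrite !gt_eqF.
have tau0 : 0 < tau by rewrite tauE divr_gt0 ?mulr_gt0.
pose g1 y := if tau < g y then g y else 0.
pose g2 y := if tau < g y then 0 else g y.
have mc : measurable_fun setT (fun y : RM => tau < g y) by solve_meas.
have m1 : measurable_fun setT (g1 : RM -> R) by apply: measurable_fun_ifT.
have m2 : measurable_fun setT (g2 : RM -> R) by apply: measurable_fun_ifT.
have g10 y : 0 <= g1 y by rewrite /g1; case: ifP.
have g20 y : 0 <= g2 y by rewrite /g2; case: ifP.
have g2t y : g2 y <= tau by rewrite /g2; case: ltP => // _; exact: ltW.
have gE : g = (fun y => g1 y + g2 y).
  by apply/funext => y; rewrite /g1 /g2; case: ifP => _; rewrite ?addr0 ?add0r.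
have key x : (bpot a s `]0%R, +oo[%classic g x <=
    bpot a s `]0%R, T]%classic g1 x + (3 / 4 * l)%:E)%E.
  apply: le_trans (bpot_split s a1 x T0 mg g0) _.
  have H1 : (bpot a s `]0%R, T]%classic g x <=
      bpot a s `]0%R, T]%classic g1 x + (l / 4)%:E)%E.
    rewrite [in leLHS]gE bpotD// leeD2l//.
    apply: le_trans (bpot_bounded a1 s0 x (ltW T0) m2 g20 g2t) _.
    rewrite lee_fin tauE le_eqVlt; apply/orP; left; apply/eqP.
    by field; rewrite !gt_eqF.
  have H2 : (bpot a s `[T, +oo[%classic g x <= (l / 2)%:E)%E.
    apply: le_trans (bpot_tail (p := p) (B := ultra_cst) a1 p1 sp T0 (ltW B0) _ mg g0 gp) _.
      move=> t y Tt; have t0 : 0 < t by exact: lt_le_trans Tt.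
      by apply: le_trans (bheat_le t x y a2) _; rewrite powRM4// mulrA.
    by rewrite lee_fin -/hls_gap -/B' Te.
  apply: le_trans (leeD H1 H2) _.
  by rewrite -addeA -EFinD (_ : l / 4 + l / 2 = 3 / 4 * l)//; field.
set A := [set x : RM | _].
have sub : A `<=` [set: RM] `&` [set x : RM | ((l / 4)%:E <=
    `|bpot a s `]0%R, T]%classic g1 x|)%E].
  move=> x; rewrite /A/= => lx; split=> //.
  rewrite gee0_abs; last exact: bpot_ge0.
  have := lt_le_trans lx (key x).
  have : (0 <= bpot a s `]0%R, T]%classic g1 x)%E by exact: bpot_ge0.
  case: (bpot a s `]0%R, T]%classic g1 x) => [r| |]//; rewrite ?leey//.
  by rewrite -EFinD !lee_fin lte_fin => _ h; lra.
have mm : measurable_fun setT (bpot a s `]0%R, T]%classic g1 : RM -> \bar R).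
  exact: measurable_bpot.
have mA : measurable A.
  have mm' : measurable_fun setT (bpot a s `]0%R, +oo[%classic g : RM -> \bar R).
    exact: measurable_bpot.
  rewrite /A -[X in measurable X]setTI.
  exact: emeasurable_fun_o_infty.
have l40 : 0 < l / 4 by rewrite divr_gt0.
have := le_integral_abse (dw a) measurableT mm l40.
under eq_integral do rewrite gee0_abs ?bpot_ge0//.
rewrite integral_bpot ?(ltW T0)// => mk.
have : ((l / 4)%:E * dw a A <= (T `^ s / s)%:E * \int[dw a]_y (g1 y)%:E)%E.
  apply: le_trans mk; rewrite lee_wpmul2l ?lee_fin ?(ltW l40)//.
  apply: le_measure; rewrite ?inE//.
  apply: emeasurable_fun_c_infty => //.
  by apply: measurableT_comp.
have -> : tau^-1 = (l / 4)^-1 * (T `^ s / s).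
  by rewrite tauE; field; rewrite !gt_eqF.
move=> h; rewrite -(@lee_pmul2l _ (l / 4)%:E)//.
by rewrite [leRHS]muleA -EFinM mulrA mulfV ?gt_eqF// mul1r.
Qed.

End distribution.
End distribution_inequality.

Lemma integral_bool01 d (T : measurableType d) (R : realType)
    (mu : {measure set T -> \bar R}) (b : T -> bool) :
  measurable [set x | b x] ->
  (\int[mu]_x (if b x then 1 else 0) = mu [set x | b x])%E.
Proof.
move=> mb; transitivity (\int[mu]_x (\1_[set x | b x] x)%:E)%E.
  apply: eq_integral => x _; rewrite indicE.
  by case: ifPn => bx; [rewrite mem_set|rewrite memNset//; exact/negP].
by rewrite integral_indic// setIT.
Qed.

(** * The strong type inequality *)

Section layer_cake.
Context {R : realType}.
Local Notation leb := (@lebesgue_measure R).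
Local Notation RM := (measurableTypeR R).
Implicit Types (a s t x y T p l q M : R) (g f : RM -> R).

Lemma integral_powR_0y q : 0 < q ->
  (\int[leb]_(l in `]0%R, +oo[) (l `^ (q - 1))%:E = +oo)%E.
Proof.
move=> q0; apply/eqyP => M M0.
have T0 : 0 <= (q * M) `^ q^-1 by exact: powR_ge0.
apply: (@le_trans _ _ (\int[leb]_(l in `]0%R, ((q * M) `^ q^-1)%R]) (l `^ (q - 1))%:E)%E).
  rewrite integral_powR_0c// -powRrM mulVf ?gt_eqF// powRr1; last by rewrite mulr_ge0 ?ltW.
  by rewrite lee_fin mulrAC divff ?mul1r// gt_eqF.
apply: ge0_subset_integral => //.
- exact: measurable_EFin_powR.
- by move=> l _; rewrite lee_fin powR_ge0.
- by apply: subset_itvl; rewrite bnd_simp.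
Qed.

Lemma layer_cake_le q (Y : \bar R) : 0 < q -> (0 <= Y)%E ->
  (Y `^ q <= \int[leb]_(l in `]0%R, +oo[)
     ((q * l `^ (q - 1))%:E * (if l%:E < Y then 1 else 0)))%E.
Proof.
move=> q0; have mq (D : set RM) : measurable_fun D (fun l : RM => (q * l `^ (q - 1))%:E).
  by apply: measurable_funTS; solve_meas.
have q0' (l : R) : (0 <= (q * l `^ (q - 1))%:E)%E by rewrite lee_fin mulr_ge0 ?powR_ge0 ?ltW.
case: Y => [r| |]//.
- rewrite lee_fin => r0.
  apply: (@le_trans _ _ (\int[leb]_(l in `]0%R, r]) (q%:E * (l `^ (q - 1))%:E))%E).
    rewrite ge0_integralZl_EFin ?(ltW q0)//; last 2 first.
    - by move=> l _; rewrite lee_fin powR_ge0.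
    - exact: measurable_EFin_powR.
    by rewrite integral_powR_0c// -EFinM lee_fin mulrCA divff ?mulr1// gt_eqF.
  rewrite -integral_itv_bndo_bndc; last first.
    by apply: emeasurable_funM => //; exact: measurable_EFin_powR.
  rewrite integral_mkcond [leRHS]integral_mkcond le_eqVlt; apply/orP; left; apply/eqP.
  apply: eq_integral => l _; rewrite !patchE !mem_setE !in_itv/= andbT lte_fin.
  by case: (0 < l) => //=; case: (l < r); rewrite ?mule1 ?mule0 ?EFinM.
- move=> _; apply: (@le_trans _ _ +oo%E); first by rewrite leey.
  under eq_integral => l _ do rewrite ltry mule1 EFinM.
  rewrite ge0_integralZl_EFin ?(ltW q0)//.
  + by rewrite integral_powR_0y// gt0_muley.
  + by move=> l _; rewrite lee_fin powR_ge0.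
  + exact: measurable_EFin_powR.
Qed.

Section strong_type.
Variables (a s p : R).
Hypotheses (a2 : - (1 / 2) <= a) (s0 : 0 < s) (p1 : 1 < p) (sp : s * p < a + 1).

Local Notation k := (hls_ratio a s p).
Local Notation c := (hls_level a s p).

(** Integrate [bpot_distribution] against q l^(q-1) dl, with q = p k. For a
    fixed y the variable l then runs over c l^k < g(y), and the integral of
    l^(q-k-1) g(y) is a multiple of g(y)^(1 + (q-k)/k) = g(y)^p. *)
Lemma bpot_strong g : measurable_fun setT g -> (forall y, 0 <= g y) ->
  (\int[dw a]_y (g y `^ p)%:E <= 1)%E ->
  (\int[dw a]_x (bpot a s `]0%R, +oo[%classic g x) `^ (p * k) <=
   (p * k / c * c `^ (- (p - 1)) / (p * k - k))%:E)%E.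
Proof.
move=> mg g0 gp.
have a1 : -1 < a by apply: lt_le_trans a2; lra.
have p1' := ltW p1; have p0 : 0 < p by exact: lt_trans p1.
have k0 : 0 < k by apply: hls_ratio_gt0.
have c0 : 0 < c by apply: hls_level_gt0.
set q := p * k; have q0 : 0 < q by rewrite mulr_gt0.
have qk : 0 < q - k.
  by rewrite /q -[X in _ - X]mul1r -mulrBl mulr_gt0// subr_gt0.
pose F x := bpot a s `]0%R, +oo[%classic g x.
have mF : measurable_fun setT (F : RM -> \bar R) by exact: measurable_bpot.
have F0 x : (0 <= F x)%E by exact: bpot_ge0.
pose h (x l : RM) : \bar R := ((q * l `^ (q - 1))%:E * (if l%:E < F x then 1 else 0))%E.
have q0' (l : R) : 0 <= q * l `^ (q - 1) by rewrite mulr_ge0 ?powR_ge0 ?ltW.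
have i01 (b : bool) : (0 <= (if b then 1 else 0 : \bar R))%E by case: b.
have h0 x l : (0 <= h x l)%E by rewrite mule_ge0// lee_fin.
have mq (D : set RM) : measurable_fun D (fun l : RM => (q * l `^ (q - 1))%:E).
  by apply: measurable_funTS; solve_meas.
have mh : measurable_fun setT (fun z : RM * RM => h z.1 z.2).
  rewrite /h; apply: emeasurable_funM.
    exact: (measurableT_comp (mq setT) measurable_snd).
  apply: measurable_fun_ifT => //; apply: measurable_fun_lte.
    by apply/measurable_EFinP; exact: measurable_snd.
  exact: (measurableT_comp mF measurable_fst).
have mi : measurable_fun setT (fun x => \int[leb]_(l in `]0%R, +oo[) h x l)%E.
  exact: measurable_fun_integral_on.
apply: (@le_trans _ _ (\int[dw a]_(x in setT) \int[leb]_(l in `]0%R, +oo[) h x l)%E).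
  apply: ge0_le_integral => //.
  - by move=> x _; exact: poweR_ge0.
  - exact: (measurableT_comp (measurable_poweR _) mF).
  - by move=> x _; exact: layer_cake_le.
rewrite tonelli_on//.
pose w (y l : RM) : \bar R := (q / c * (l `^ (q - k - 1)) * (if c * l `^ k < g y then g y else 0))%:E.
have w0 y l : (0 <= w y l)%E.
  by rewrite lee_fin mulr_ge0//; [rewrite mulr_ge0 ?powR_ge0// divr_ge0// ltW|case: ifP].
have mw : measurable_fun setT (fun z : RM * RM => w z.1 z.2).
  have mg1 : measurable_fun setT (fun z : RM * RM => g z.1).
    exact: (measurableT_comp mg measurable_fst).
  by rewrite /w; solve_meas.
have mcut l : measurable_fun setT (fun y : RM => if c * l `^ k < g y then g y else 0).
  by solve_meas.
apply: (@le_trans _ _ (\int[leb]_(l in `]0%R, +oo[) \int[dw a]_(y in setT) w y l)%E).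
  apply: ge0_le_integral.
  - exact: measurable_itv.
  - by move=> l _; apply: integral_ge0 => x _; exact: h0.
  - apply: measurable_funTS; apply: (@measurable_fun_integral_on _ _ _ _ _ (dw a) setT
      (fun l x => h x l)); first exact: measurableT; last by move=> l x; exact: h0.
    exact: (measurableT_comp mh (measurable_fun_pair measurable_snd measurable_fst)).
  - apply: measurable_funTS; apply: (@measurable_fun_integral_on _ _ _ _ _ (dw a) setT
      (fun l y => w y l)); first exact: measurableT; last by move=> l x; exact: w0.
    exact: (measurableT_comp mw (measurable_fun_pair measurable_snd measurable_fst)).
  - move=> l; rewrite /= in_itv/= andbT => l0.
    have mA : measurable [set x : RM | (l%:E < F x)%E].
      by rewrite -[X in measurable X]setTI; exact: emeasurable_fun_o_infty.
    rewrite ge0_integralZl_EFin//; last first.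
      apply: measurable_fun_ifT => //; apply: measurable_fun_lte => //.
    have -> : (\int[dw a]_x (if l%:E < F x then 1 else 0) = dw a [set x : RM | l%:E < F x])%E.
      exact: (integral_bool01 (dw a) mA).
    have := bpot_distribution a1 s0 a2 p1' sp l0 mg g0 gp.
    move=> hd; apply: le_trans (lee_wpmul2l _ hd) _; first by rewrite lee_fin.
    rewrite muleA -EFinM -ge0_integralZl_EFin//; last 3 first.
    - by move=> y _; rewrite lee_fin; case: ifP.
    - exact/measurable_EFinP.
    - by rewrite mulr_ge0// invr_ge0 mulr_ge0 ?powR_ge0 ?ltW.
    rewrite le_eqVlt; apply/orP; left; apply/eqP; apply: eq_integral => y _.
    rewrite -EFinM /w; congr (_ * _)%:E.
    have -> : q - k - 1 = (q - 1) + - k by ring.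
    rewrite (@powRD _ l (q - 1)); last by rewrite (gt_eqF l0) implybT.
    rewrite powRN; have lk : 0 < l `^ k by rewrite powR_gt0.
    by field; rewrite !gt_eqF.
rewrite -tonelli_on//.
have C0 : 0 <= q / c * c `^ (- (p - 1)) / (q - k).
  apply: divr_ge0; last exact: ltW.
  by apply: mulr_ge0; [apply: divr_ge0; exact: ltW|exact: powR_ge0].
apply: (@le_trans _ _ (\int[dw a]_y ((q / c * c `^ (- (p - 1)) / (q - k))%:E * (g y `^ p)%:E))%E); last first.
  have mgp : measurable_fun setT (fun y : RM => g y `^ p) by solve_meas.
  rewrite ge0_integralZl_EFin//; last 2 first.
  - by move=> y _; rewrite lee_fin powR_ge0.
  - exact/measurable_EFinP.
  by rewrite -[leRHS]mule1 lee_wpmul2l// lee_fin.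
rewrite le_eqVlt; apply/orP; left; apply/eqP; apply: eq_integral => y _.
set Y := (g y / c) `^ k^-1; have Y0 : 0 <= Y by exact: powR_ge0.
have gc0 : 0 <= g y / c by rewrite divr_ge0// ltW.
transitivity (\int[leb]_(l in `]0%R, Y[) ((q / c * g y)%:E * (l `^ (q - k - 1))%:E))%E.
  rewrite [LHS]integral_mkcond [RHS]integral_mkcond; apply: eq_integral => l _.
  rewrite !patchE !mem_setE !in_itv/= andbT.
  have [l0|//] := ltP 0 l.
  rewrite /w; have -> : (c * l `^ k < g y) = (l < Y).
    rewrite mulrC -ltr_pdivlMr// !ltNge; congr negb; rewrite /Y; apply/idP/idP => hle.
      have := @ge0_ler_powR _ k^-1 _ _ _ gc0 (powR_ge0 _ _) hle.
      by rewrite -powRrM divff ?gt_eqF// powRr1 ?(ltW l0)//; apply; rewrite invr_ge0 ltW.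
    have := @ge0_ler_powR _ k (ltW k0) _ _ (powR_ge0 _ _) (ltW l0) hle.
    by rewrite -powRrM mulVf ?gt_eqF// powRr1.
  case: (l < Y) => //=; last by rewrite mulr0.
  by rewrite -EFinM; congr EFin; ring.
rewrite integral_itv_bndo_bndc; last first.
  by apply: emeasurable_funM => //; exact: measurable_EFin_powR.
rewrite ge0_integralZl_EFin//; last 3 first.
- by move=> l _; rewrite lee_fin powR_ge0.
- exact: measurable_EFin_powR.
- by rewrite mulr_ge0// divr_ge0// ltW.
rewrite integral_powR_0c// -!EFinM; congr EFin.
have -> : Y `^ (q - k) = g y `^ (p - 1) * c `^ (- (p - 1)).
  rewrite /Y -powRrM (_ : k^-1 * (q - k) = p - 1); last by rewrite /q; field; rewrite gt_eqF.
  rewrite powRM ?invr_ge0 ?(ltW c0)//; congr (_ * _).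
  by rewrite -[c^-1]powR_inv1 ?(ltW c0)// -powRrM mulN1r.
have -> : g y `^ p = g y * g y `^ (p - 1) by rewrite mulr_powRB1.
by field; rewrite !gt_eqF.
Qed.

End strong_type.
End layer_cake.

(** * Sufficiency *)

Section sufficiency.
Context {R : realType}.
Local Notation leb := (@lebesgue_measure R).
Local Notation RM := (measurableTypeR R).

Lemma Lfun_measurable d (T : measurableType d) (mu : {measure set T -> \bar R})
    (p : \bar R) (f : T -> R) : f \in Lfun mu p -> measurable_fun setT f.
Proof. by move=> /sub_Lfun_mfun; rewrite inE. Qed.

Lemma Lfun_Lnorm_lty d (T : measurableType d) (mu : {measure set T -> \bar R})
    (p : \bar R) (f : T -> R) : f \in Lfun mu p -> ('N[mu]_p[EFin \o f] < +oo)%E.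
Proof. by move=> /sub_Lfun_finLfun; rewrite inE. Qed.

Lemma Lfun_intro d (T : measurableType d) (mu : {measure set T -> \bar R})
    (p : \bar R) (f : T -> R) : measurable_fun setT f ->
  ('N[mu]_p[EFin \o f] < +oo)%E -> f \in Lfun mu p.
Proof. by move=> mf Nf; rewrite inE/=; apply/andP; split; rewrite inE. Qed.

Lemma Lnorm_normalize d (T : measurableType d) (mu : {measure set T -> \bar R})
    (p M : R) (f : T -> R) : 0 < p -> 0 < M -> measurable_fun setT f ->
  ('N[mu]_p%:E[EFin \o f] <= M%:E)%E ->
  (\int[mu]_y ((`|f y| / M) `^ p)%:E <= 1)%E.
Proof.
move=> p0 M0 mf Nf.
have mfp : measurable_fun setT (fun y => `|f y| `^ p) by solve_meas.
have Mp0 : 0 < M `^ p by rewrite powR_gt0.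
have h : (\int[mu]_y (`|f y| `^ p)%:E <= (M `^ p)%:E)%E.
  have := @poweR_Lnorm _ _ _ mu (EFin \o f) p; rewrite gt_eqF// => /(_ isT).
  rewrite (_ : \int[mu]_x _ = \int[mu]_y (`|f y| `^ p)%:E)%E// => <-.
  rewrite -poweR_EFin gt0_ler_poweR ?(ltW p0)// in_itv/= ?Lnorm_ge0 ?leey//.
  by rewrite lee_fin ltW.
rewrite (_ : \int[mu]_y _ = \int[mu]_y ((M `^ p)^-1%:E * (`|f y| `^ p)%:E))%E; last first.
  apply: eq_integral => y _; rewrite -EFinM powRM ?invr_ge0 ?(ltW M0)//.
  by rewrite -(powR_inv1 (ltW M0)) -powRrM mulN1r powRN mulrC.
rewrite ge0_integralZl_EFin ?invr_ge0 ?(ltW Mp0)//; last exact/measurable_EFinP.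
apply: (@le_trans _ _ ((M `^ p)^-1%:E * (M `^ p)%:E)%E).
  by rewrite lee_wpmul2l// lee_fin invr_ge0 ltW.
by rewrite -EFinM mulVf// gt_eqF.
Qed.

(** Testing against all M > 0 above the norm, instead of the norm itself,
    allows dividing by M also when the norm vanishes. *)
Lemma le_mul_norm (C : R) (X Nf : \bar R) : 0 <= C -> (0 <= Nf < +oo)%E ->
  (forall M, 0 < M -> (Nf <= M%:E)%E -> (X <= (C * M)%:E)%E) ->
  (X <= C%:E * Nf)%E.
Proof.
move=> C0; case: Nf => [r| |]//; rewrite ?ltxx ?andbF// => /andP[+ _] h.
rewrite lee_fin le_eqVlt => /predU1P[r0|r0]; last by rewrite -EFinM; apply: h.
rewrite -r0 mule0; apply/lee_addgt0Pr => e e0; rewrite add0e.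
have C1 : 0 < C + 1 by lra.
apply: le_trans (h (e / (C + 1)) _ _) _; first by rewrite divr_gt0.
  by rewrite lee_fin -r0 divr_ge0// ltW.
rewrite lee_fin mulrA ler_pdivrMr// mulrC ler_wpM2l//; first exact: ltW.
by lra.
Qed.

Variables (a s : R).
Hypotheses (a1 : -1 < a) (s0 : 0 < s) (sN : s < a + 1).

Lemma exists_norm_bound d (T : measurableType d) (mu : {measure set T -> \bar R})
    (p : \bar R) (f : T -> R) : f \in Lfun mu p ->
  exists2 M : R, 0 < M & ('N[mu]_p[EFin \o f] <= M%:E)%E.
Proof.
move=> /Lfun_Lnorm_lty; have := Lnorm_ge0 mu p (EFin \o f).
case: ('N[mu]_p[EFin \o f])%E => [r| |]//; rewrite lee_fin => r0 _.
by exists (r + 1); [lra|rewrite lee_fin; lra].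
Qed.

Section normalization.
Variables (f : RM -> R) (M : R).
Hypotheses (mf : measurable_fun setT f) (M0 : 0 < M).

Definition normalized (y : RM) : R := `|f y| / M.

Lemma measurable_normalized : measurable_fun setT normalized.
Proof. by rewrite /normalized; solve_meas. Qed.

Lemma normalized_ge0 y : 0 <= normalized y.
Proof. by rewrite divr_ge0// ltW. Qed.

Lemma bpot_normalized x : bpot a s `]0%R, +oo[%classic (fun y => `|f y|) x =
  (M%:E * bpot a s `]0%R, +oo[%classic normalized x)%E.
Proof.
rewrite -(bpotZ s a1 x (measurable_itv _) (measurable_normalized)
  normalized_ge0 (ltW M0)).
congr (bpot a s _ _ x); apply/funext => y.
by rewrite /normalized mulrC divfK// gt_eqF.
Qed.

Lemma abse_II_normalized x : x != 0 ->
  (`|II a s f x| <= (dom_cst a s * M)%:E * bpot a s `]0%R, +oo[%classic normalized x)%E.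
Proof.
by move=> x0; apply: le_trans (abse_II_le s a1 x0 mf) _; rewrite bpot_normalized muleA.
Qed.

End normalization.

Lemma Dom_II_sufficient (p : R) : 1 <= p -> s * p < a + 1 ->
  [set` Lfun (dw a) p%:E] `<=` Dom_II a s.
Proof.
move=> p1 sp f /= Lf; have mf := Lfun_measurable Lf.
have [M M0 NM] := exists_norm_bound Lf.
have p0 : 0 < p by exact: lt_le_trans p1.
apply: Dom_II_bpot => //.
have := bpot_ae_finite a1 s0 p1 sp (measurable_normalized M mf) (normalized_ge0 f M0)
  (Lnorm_normalize p0 M0 mf NM).
apply: ae_dw_sub => x fx; rewrite (bpot_normalized mf M0).
by rewrite lte_mul_pinfty// lee_fin ltW.
Qed.

Section bounds.
Hypothesis a2 : - (1 / 2) <= a.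

Lemma strong_sufficient (p q : R) : 1 < p -> s * p < a + 1 ->
  q = p * hls_ratio a s p -> II_bounded a s p%:E q%:E.
Proof.
move=> p1 sp qE; have p0 : 0 < p by exact: lt_trans p1.
have k0 : 0 < hls_ratio a s p by apply: hls_ratio_gt0 => //; exact: ltW.
have q0 : 0 < q by rewrite qE mulr_gt0.
split; first by apply: Dom_II_sufficient => //; exact: ltW.
set K := p * hls_ratio a s p / hls_level a s p * hls_level a s p `^ (- (p - 1)) /
  (p * hls_ratio a s p - hls_ratio a s p).
have C0 := dom_cst_ge0 s a1.
exists (dom_cst a s * K `^ q^-1) => f Lf; have mf := Lfun_measurable Lf.
have mII := measurable_II s a1 mf; split; first exact: mII.
apply: le_mul_norm; first by rewrite mulr_ge0 ?powR_ge0.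
  by rewrite Lnorm_ge0 (Lfun_Lnorm_lty Lf).
move=> M M0 NM.
have mn := measurable_normalized M mf; have n0 := normalized_ge0 f M0.
have := bpot_strong a2 s0 p1 sp mn n0 (Lnorm_normalize p0 M0 mf NM).
rewrite -/K -qE; set J := (\int[dw a]_x _)%E => JK.
have mbpot : measurable_fun setT (bpot a s `]0%R, +oo[%classic (normalized f M) : RM -> \bar R).
  exact: measurable_bpot.
have bpot0 x : (0 <= bpot a s `]0%R, +oo[%classic (normalized f M) x)%E by exact: bpot_ge0.
have J0 : (0 <= J)%E by apply: integral_ge0 => x _; exact: poweR_ge0.
have K0 : 0 <= K by rewrite -lee_fin; exact: le_trans J0 JK.
have CM0 : 0 <= dom_cst a s * M by rewrite mulr_ge0// ltW.
have mp (h : RM -> \bar R) : measurable_fun setT h ->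
  measurable_fun setT (fun x => poweR (h x) q).
  by move=> mh; exact: (measurableT_comp (measurable_poweR _) mh).
have h1 : (\int[dw a]_x `|II a s f x| `^ q <= ((dom_cst a s * M) `^ q)%:E * J)%E.
  rewrite /J -ge0_integralZl_EFin ?powR_ge0//; last 2 first.
  - by move=> x _; exact: poweR_ge0.
  - exact: mp.
  apply: ae_ge0_le_integral => //.
  - by move=> x _; exact: poweR_ge0.
  - by apply: mp; exact: measurableT_comp.
  - by move=> x _; rewrite mule_ge0 ?lee_fin ?powR_ge0// poweR_ge0.
  - by apply: emeasurable_funM; [exact: measurable_cst|exact: mp].
  - apply: ae_dw_sub (dw_ae_neq0 a) => x x0 _.
    rewrite -poweR_EFin -poweRM// ?lee_fin//.
    apply: gt0_ler_poweR; rewrite ?(ltW q0)// ?in_itv/= ?leey ?andbT//.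
      by rewrite mule_ge0.
    exact: (abse_II_normalized mf M0 x0).
rewrite unlock.
apply: (@le_trans _ _ ((((dom_cst a s * M) `^ q)%:E * K%:E) `^ q^-1)%E).
  apply: gt0_ler_poweR; rewrite ?invr_ge0 ?(ltW q0)// ?in_itv/= ?leey ?andbT//.
  - by apply: integral_ge0 => x _; exact: poweR_ge0.
  - by rewrite mule_ge0 ?lee_fin ?powR_ge0.
  - by apply: le_trans h1 _; rewrite lee_wpmul2l ?lee_fin ?powR_ge0.
rewrite -EFinM poweR_EFin lee_fin (powRM _ (powR_ge0 _ _) K0).
by rewrite -powRrM divff ?gt_eqF// powRr1// mulrAC.
Qed.

Lemma weak_sufficient (q : R) : q = (a + 1) / (a + 1 - s) ->
  II_weak_bounded a s 1%E q.
Proof.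
move=> qE; have N0 : 0 < a + 1 by move: a1; lra.
have q0 : 0 < q by rewrite qE divr_gt0// subr_gt0.
have sp : s * 1 < a + 1 by rewrite mulr1.
have kE : hls_ratio a s 1 = q.
  by rewrite /hls_ratio /hls_gap divr1 qE; field; rewrite gt_eqF// subr_gt0.
have c0 : 0 < hls_level a s 1 by apply: hls_level_gt0.
split; first exact: Dom_II_sufficient.
set c := hls_level a s 1 in c0.
have C0 := dom_cst_ge0 s a1.
have Cp : 0 < dom_cst a s.
  by rewrite mulr_gt0 ?invr_gt0 ?Gamma_gt0// addr_gt0// divr_gt0// slope_gt0.
exists (dom_cst a s * c `^ (- q^-1)) => f Lf; have mf := Lfun_measurable Lf.
have mII := measurable_II s a1 mf; split; first exact: mII.
apply: le_mul_norm; first by rewrite mulr_ge0 ?powR_ge0.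
  by rewrite Lnorm_ge0 (Lfun_Lnorm_lty Lf).
move=> M M0 NM.
have mn := measurable_normalized M mf; have n0 := normalized_ge0 f M0.
have Nn := Lnorm_normalize ltr01 M0 mf NM.
have CM0 : 0 < dom_cst a s * M by rewrite mulr_gt0.
apply: ge_ereal_sup => _ [l /= l0 <-].
have l1 : 0 < l / (dom_cst a s * M) by rewrite divr_gt0.
have hd := bpot_distribution a1 s0 a2 (lexx 1) sp l1 mn n0 Nn.
rewrite kE -/c in hd.
set tau := c * (l / (dom_cst a s * M)) `^ q in hd.
have tau0 : 0 < tau by rewrite mulr_gt0// powR_gt0.
have h1 : (dw a [set x | (l%:E < `|II a s f x|)%E] <= (tau^-1)%:E)%E.
  apply: (@le_trans _ _ (dw a ([set x : RM | ((l / (dom_cst a s * M))%:E <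
      bpot a s `]0%R, +oo[%classic (normalized f M) x)%E] `|` [set 0]))).
    apply: le_measure; rewrite ?inE.
    - rewrite -[X in measurable X]setTI; apply: emeasurable_fun_o_infty => //.
      exact: measurableT_comp.
    - apply: measurableU; last exact: measurable_set1.
      rewrite -[X in measurable X]setTI; apply: emeasurable_fun_o_infty => //.
      exact: measurable_bpot.
    - move=> x /= lx; have [->|x0] := eqVneq x 0; [by right|left].
      have := lt_le_trans lx (abse_II_normalized mf M0 x0).
      have : (0 <= bpot a s `]0%R, +oo[%classic (normalized f M) x)%E by exact: bpot_ge0.
      case: (bpot a s `]0%R, +oo[%classic (normalized f M) x) => [r| |]//; rewrite ?ltry//.
      by move=> _; rewrite -EFinM !lte_fin ltr_pdivrMr// mulrC.
  apply: le_trans (measureU2 _ _ _) _.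
  - rewrite -[X in measurable X]setTI; apply: emeasurable_fun_o_infty => //.
    exact: measurable_bpot.
  - exact: measurable_set1.
  rewrite [X in (_ + X)%E]dw_set1 adde0; apply: le_trans hd _.
  rewrite -[leRHS]mule1 lee_wpmul2l ?lee_fin ?invr_ge0 ?(ltW tau0)//.
  apply: le_trans Nn; apply: ge0_le_integral => //.
  - by move=> y _; rewrite lee_fin; case: ifP.
  - by apply/measurable_EFinP; solve_meas.
  - by apply/measurable_EFinP; apply: measurable_powR_fun.
  - by move=> y _; rewrite lee_fin powRr1 ?n0//; case: ifP => // _; exact: n0.
apply: (@le_trans _ _ (l%:E * (tau^-1)%:E `^ q^-1)%E).
  rewrite lee_wpmul2l ?lee_fin ?(ltW l0)//.
  apply: gt0_ler_poweR; rewrite ?invr_ge0 ?(ltW q0)// ?in_itv/= ?leey ?andbT ?measure_ge0//.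
  by rewrite lee_fin invr_ge0 ltW.
rewrite poweR_EFin -EFinM lee_fin le_eqVlt; apply/orP; left; apply/eqP.
rewrite -[tau^-1](powR_inv1 (ltW tau0)) -powRrM mulN1r /tau (powRM _ (ltW c0) (powR_ge0 _ _)).
rewrite -powRrM mulrN divff ?gt_eqF// powR_inv1 ?(ltW l1)//.
by field; rewrite !gt_eqF.
Qed.

End bounds.
End sufficiency.

Lemma ler_powR_nneg (R : realType) (c x y : R) : 0 <= c -> 0 <= x -> x <= y ->
  x `^ c <= y `^ c.
Proof.
move=> c0 x0 xy; have y0 : 0 <= y by exact: le_trans xy.
exact: (ge0_ler_powR c0 x0 y0 xy).
Qed.

(** * Lower bounds *)

Section lower.
Context {R : realType}.
Local Notation leb := (@lebesgue_measure R).
Local Notation RM := (measurableTypeR R).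
Implicit Types (t x y T l M C : R) (f g : RM -> R) (D : set RM).
Variables (a s : R).
Hypotheses (a1 : -1 < a) (s0 : 0 < s) (sN : s < a + 1).

Lemma dpot_ge x y : 0 <= x * y ->
  (((Gamma s)^-1)%:E * \int[leb]_(t in `]0%R, +oo[) (bheat a t x y * t `^ (s - 1))%:E <=
   dpot a s x y)%E.
Proof.
move=> xy0; rewrite /dpot lee_wpmul2l ?lee_fin ?invr_ge0 ?Gamma_ge0//.
have hw t : bheat a t x y * t `^ (s - 1) <= dheat a t x y * t `^ (s - 1).
  by rewrite ler_wpM2r ?powR_ge0// dheat_ge.
apply: ge0_le_integral => //.
- by move=> t _; rewrite lee_fin mulr_ge0 ?powR_ge0 ?bheat_ge0.
- exact: measurable_bheat_time.
- apply: measurable_funTS; apply/measurable_EFinP.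
  by apply: measurable_funM; [apply: measurable_dheat|solve_meas].
- by move=> t _; rewrite lee_fin; exact: hw.
Qed.

(** On functions supported in ]0, +oo[ only pairs with x y > 0 occur, for
    which the odd part of the kernel is nonnegative. *)
Lemma II_ge x f : 0 < x -> measurable_fun setT f -> (forall y, 0 <= f y) ->
  (forall y, y <= 0 -> f y = 0) ->
  (((Gamma s)^-1)%:E * bpot a s `]0%R, +oo[%classic f x <= II a s f x)%E.
Proof.
move=> x0 mf f0 fneg; rewrite IIE ?gt_eqF// /bpot.
rewrite -ge0_integralZl_EFin ?invr_ge0 ?Gamma_ge0//; last 2 first.
- by move=> y _; exact: bpot_inner_ge0.
- exact: measurable_bpot_inner.
apply: ge0_le_integral => //.
- by move=> y _; rewrite mule_ge0 ?lee_fin ?invr_ge0 ?Gamma_ge0//; exact: bpot_inner_ge0.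
- by apply: emeasurable_funM => //; exact: measurable_bpot_inner.
- exact: measurable_dpot_f.
move=> y _; have [y0|y0] := leP y 0.
  rewrite fneg// mule0 (_ : \int[leb]_(t in _) _ = 0)%E ?mule0//.
  by apply: integral0_eq => t _; rewrite !mulr0.
apply: le_trans (lee_wpmul2r _ (dpot_ge (mulr_ge0 (ltW x0) (ltW y0)))); last by rewrite lee_fin.
rewrite -muleA lee_wpmul2l ?lee_fin ?invr_ge0 ?Gamma_ge0//.
rewrite -ge0_integralZr ?lee_fin//; last 2 first.
- exact: measurable_bheat_time.
- by move=> t _; rewrite lee_fin mulr_ge0 ?powR_ge0 ?bheat_ge0.
rewrite le_eqVlt; apply/orP; left; apply/eqP; apply: eq_integral => t _.
by rewrite -EFinM; congr EFin; ring.
Qed.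

Definition pot_low_cst : R := 2^-1 * 8 `^ (- (a + 1)) * expR (- 1) * bessel_coef a 0.

Lemma pot_low_cst_gt0 : 0 < pot_low_cst.
Proof. by rewrite !mulr_gt0 ?powR_gt0 ?expR_gt0 ?bessel_coef_gt0. Qed.

(** For t between r = (x + y)^2 and 2 r the Gaussian is at least 1 / e, and
    the Bessel series is at least its first term. *)
Lemma integral_bheat_ge x y : 0 < x -> 0 < y ->
  ((pot_low_cst * (x + y) `^ (2 * (s - (a + 1))))%:E <=
   \int[leb]_(t in `]0%R, +oo[) (t `^ (s - 1) * bheat a t x y)%:E)%E.
Proof.
move=> x0 y0; have N0 : 0 < a + 1 by move: a1; lra.
set r := (x + y) ^+ 2; have xy0 : 0 < x + y by rewrite addr_gt0.
have r0 : 0 < r by rewrite exprn_gt0.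
have rE : (x + y) `^ (2 * (s - (a + 1))) = r `^ s * r `^ (- (a + 1)).
  by rewrite powRrM (powR_mulrn 2) ?(ltW xy0)// -powRD// (gt_eqF r0) implybT.
have hr : x ^+ 2 + y ^+ 2 <= r by rewrite /r; nra.
clearbody r.
have mt D : measurable_fun D (fun t : RM => (t `^ (s - 1) * bheat a t x y)%:E).
  apply: measurable_funTS; apply/measurable_EFinP.
  by apply: measurable_funM; [solve_meas|apply: measurable_bheat].
have t00 t : (0 <= (t `^ (s - 1) * bheat a t x y)%:E)%E.
  by rewrite lee_fin mulr_ge0 ?powR_ge0 ?bheat_ge0.
apply: (@le_trans _ _ (\int[leb]_(t in `[r, (2 * r)%R]) (t `^ (s - 1) * bheat a t x y)%:E)%E); last first.
  apply: ge0_subset_integral => //.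
  by move=> t; rewrite /= !in_itv/= andbT => /andP[rt _]; exact: lt_le_trans rt.
set m := (r `^ s / (2 * r)) * ((8 * r) `^ (- (a + 1)) * expR (- 1) * bessel_coef a 0).
apply: (@le_trans _ _ (\int[leb]_(t in `[r, (2 * r)%R]) (cst m%:E t))%E).
  rewrite integral_cst// [X in (_ * X)%E]lebesgue_measure_itv/= lte_fin.
  have r2 : r < 2 * r by lra.
  rewrite r2 -EFinB -EFinM lee_fin rE /m /pot_low_cst.
  rewrite powRM ?(ltW r0)// le_eqVlt; apply/orP; left; apply/eqP.
  by field; rewrite gt_eqF.
apply: ge0_le_integral => //.
- move=> t _; rewrite lee_fin /m; apply: mulr_ge0.
    by apply: divr_ge0; [exact: powR_ge0|rewrite mulr_ge0 ?(ltW r0)].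
  by rewrite !mulr_ge0 ?powR_ge0 ?expR_ge0 ?(ltW (bessel_coef_gt0 _ _)).
move=> t; rewrite /= in_itv/= => /andP[rt tr]; have t0 : 0 < t by exact: lt_le_trans rt.
rewrite lee_fin; apply: ler_pM.
- by rewrite divr_ge0 ?powR_ge0// mulr_ge0 ?(ltW r0).
- by rewrite !mulr_ge0 ?powR_ge0 ?expR_ge0 ?(ltW (bessel_coef_gt0 _ _)).
- have -> : t `^ (s - 1) = t `^ s / t.
    by rewrite powRB ?powRr1 ?(ltW t0)// (gt_eqF t0) implybT.
  apply: ler_pM; rewrite ?powR_ge0 ?invr_ge0 ?mulr_ge0 ?(ltW r0)//.
    by apply: ler_powR_nneg; rewrite ?(ltW s0) ?(ltW r0).
  by rewrite lef_pV2 ?posrE ?mulr_gt0.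
apply: le_trans (bheat_ge t x y a1).
rewrite ler_wpM2r ?(ltW (bessel_coef_gt0 _ _))//.
apply: ler_pM; rewrite ?powR_ge0 ?expR_ge0//.
  rewrite !powRN lef_pV2 ?posrE ?powR_gt0 ?mulr_gt0//.
  apply: ler_powR_nneg; rewrite ?mulr_ge0 ?(ltW N0) ?(ltW t0)//.
  by lra.
rewrite ler_expR lerN2 -mulrDl inv4E// ler_pdivrMr ?mulr_gt0// mul1r.
by lra.
Qed.

Lemma II_ge_powR x f : 0 < x -> measurable_fun setT f -> (forall y, 0 <= f y) ->
  (forall y, y <= 0 -> f y = 0) ->
  (((Gamma s)^-1 * pot_low_cst)%:E * \int[dw a]_(y in `]0%R, +oo[)
     ((x + y) `^ (2 * (s - (a + 1))) * f y)%:E <= II a s f x)%E.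
Proof.
move=> x0 mf f0 fneg; apply: le_trans (II_ge x0 mf f0 fneg).
rewrite EFinM -muleA lee_wpmul2l ?lee_fin ?invr_ge0 ?Gamma_ge0//.
have mxy (D : set RM) : measurable_fun D (fun y : RM => ((x + y) `^ (2 * (s - (a + 1))) * f y)%:E).
  by apply: measurable_funTS; solve_meas.
rewrite -ge0_integralZl_EFin ?(ltW pot_low_cst_gt0)//; last first.
  by move=> y _; rewrite lee_fin mulr_ge0 ?powR_ge0.
apply: (@le_trans _ _ (\int[dw a]_(y in `]0%R, +oo[) \int[leb]_(t in `]0%R, +oo[)
    (t `^ (s - 1) * (bheat a t x y * f y))%:E)%E); last first.
  apply: ge0_subset_integral => //; first exact: measurable_bpot_inner.
  by move=> y _; exact: bpot_inner_ge0.
apply: ge0_le_integral => //.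
- by move=> y _; rewrite mule_ge0 ?lee_fin ?(ltW pot_low_cst_gt0) ?mulr_ge0 ?powR_ge0.
- by apply: emeasurable_funM.
- by apply: measurable_funTS; exact: measurable_bpot_inner.
move=> y; rewrite /= in_itv/= andbT => y0.
have h := integral_bheat_ge x0 y0.
rewrite -EFinM mulrA EFinM.
apply: le_trans (lee_wpmul2r _ h) _; first by rewrite lee_fin.
rewrite -ge0_integralZr ?lee_fin//; last 2 first.
- apply: measurable_funTS; apply/measurable_EFinP.
  by apply: measurable_funM; [solve_meas|apply: measurable_bheat].
- by move=> t _; rewrite lee_fin mulr_ge0 ?powR_ge0 ?bheat_ge0.
rewrite le_eqVlt; apply/orP; left; apply/eqP; apply: eq_integral => t _.
by rewrite -EFinM mulrA.
Qed.

(** Large enough for L = [conc_radius] and P = (a + 1)(a + 2) to satisfy 4 t +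
    8 t^2 P <= L^2 / 4 when t <= 2: this is the requirement of Chebyshev's
    inequality in [bheat_concentration]. *)
Definition conc_radius : R := 32 + 128 * ((a + 1) * (a + 2)).

Lemma conc_radius_ge1 : 32 <= conc_radius.
Proof. by rewrite /conc_radius lerDl !mulr_ge0//; move: a1; lra. Qed.

(** Half of the mass lies on y > 0. There |y - x| > L implies |y^2 - x^2| >= L
    x, whereas y^2 has a standard deviation of order x by [bheat_variance]; so
    Chebyshev's inequality removes at most 1/4. *)
Lemma bheat_concentration t x : 1 <= x -> 1 <= t <= 2 ->
  ((1 / 4)%:E <= \int[dw a]_(y in `]0%R, +oo[)
     (bheat a t x y * (if `|y - x| <= conc_radius then 1 else 0))%:E)%E.
Proof.
move=> x1 /andP[t1 t2]; have t0 : 0 < t by lra. have x0 : 0 < x by lra.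
have L1 := conc_radius_ge1; set L := conc_radius in L1 *. have L0 : 0 < L by lra.
have mh (D : set RM) : measurable_fun D (fun y : RM => (bheat a t x y)%:E).
  by apply: measurable_funTS; apply/measurable_EFinP; apply: measurable_bheat.
have half : (\int[dw a]_(y in `]0%R, +oo[) (bheat a t x y)%:E = (1 / 2)%:E)%E.
  have := bheat_mass x a1 t0; rewrite integral_dw_even; last 3 first.
  - exact: measurable_bheat.
  - by move=> y; exact: bheat_ge0.
  - by move=> y; exact: bheat_opp.
  have : (0 <= \int[dw a]_(y in `]0%R, +oo[) (bheat a t x y)%:E)%E.
    by apply: integral_ge0 => y _; rewrite lee_fin bheat_ge0.
  case: (\int[dw a]_(y in `]0%R, +oo[) (bheat a t x y)%:E)%E => [r _| |]//.
    by rewrite -EFinM => -[h]; congr EFin; lra.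
  by rewrite gt0_muley.
set I1 := (X in (_ <= X)%E).
(* The inverse square of L x / (4 t), the deviation of y^2 / (4 t) in question. *)
pose c := 16 * t ^+ 2 / (L ^+ 2 * x ^+ 2).
have c0 : 0 <= c.
  by apply: divr_ge0; apply: mulr_ge0; rewrite ?sqr_ge0.
pose v y := bheat a t x y * (y ^+ 2 / (4 * t) - x ^+ 2 / (4 * t)) ^+ 2.
have v0 y : 0 <= v y by rewrite mulr_ge0 ?bheat_ge0 ?sqr_ge0.
have mv (D : set RM) : measurable_fun D (fun y : RM => (v y)%:E).
  apply: measurable_funTS; apply/measurable_EFinP.
  by apply: measurable_funM; [apply: measurable_bheat|solve_meas].
have mi (D : set RM) : measurable_fun D
    (fun y : RM => (bheat a t x y * (if `|y - x| <= L then 1 else 0))%:E).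
  apply: measurable_funTS; apply/measurable_EFinP.
  by apply: measurable_funM; [apply: measurable_bheat|solve_meas].
have i0 y : 0 <= bheat a t x y * (if `|y - x| <= L then 1 else 0).
  by rewrite mulr_ge0 ?bheat_ge0//; case: ifP.
have V := bheat_variance x a1 t0.
have cV : c * (2^-1 * (2 * (x ^+ 2 / (4 * t)) + (a + 1) * (a + 2))) <= 1 / 4.
  set P := (a + 1) * (a + 2); have P0 : 0 <= P by rewrite mulr_ge0//; move: a1; lra.
  have -> : c * (2^-1 * (2 * (x ^+ 2 / (4 * t)) + P)) =
    (4 * t + 8 * t ^+ 2 * P / x ^+ 2) / L ^+ 2.
    by rewrite /c; field; rewrite !gt_eqF.
  rewrite ler_pdivrMr ?exprn_gt0//.
  have h1 : 8 * t ^+ 2 * P / x ^+ 2 <= 32 * P.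
    rewrite ler_pdivrMr ?exprn_gt0//.
    have h2 : t ^+ 2 <= 4 by nra.
    have h3 : 1 <= x ^+ 2 by nra.
    apply: (@le_trans _ _ (32 * P)); first by nra.
    by rewrite ler_peMr// mulr_ge0.
  have -> : L ^+ 2 = L * (32 + 128 * P) by rewrite /L /conc_radius expr2.
  have : 32 + 128 * P <= L * (32 + 128 * P) by rewrite ler_peMl//; lra.
  lra.
have key : ((1 / 2)%:E <= I1 + (1 / 4)%:E)%E.
  rewrite -half.
  apply: (@le_trans _ _ (I1 + c%:E * \int[dw a]_(y in `]0%R, +oo[) (v y)%:E)%E); last first.
    rewrite leeD2l//; apply: (@le_trans _ _ (c * (2^-1 * (2 * (x ^+ 2 / (4 * t)) + (a + 1) * (a + 2))))%:E).
      by rewrite [leRHS]EFinM lee_wpmul2l.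
    by rewrite lee_fin.
  rewrite -ge0_integralZl_EFin//; last by move=> y _; rewrite lee_fin.
  rewrite /I1 -ge0_integralD//; last 3 first.
  - by move=> y _; rewrite lee_fin.
  - by move=> y _; rewrite mule_ge0 ?lee_fin.
  - by apply: emeasurable_funM.
  apply: ge0_le_integral => //.
  - by move=> y _; rewrite lee_fin bheat_ge0.
  - by apply: emeasurable_funD => //; apply: emeasurable_funM.
  move=> y; rewrite /= in_itv/= andbT => y0; rewrite -EFinM -EFinD lee_fin.
  have [yx|yx] := leP `|y - x| L; first by rewrite mulr1 lerDl mulr_ge0.
  rewrite mulr0 add0r /v mulrCA ler_peMr ?bheat_ge0//.
  have -> : c * (y ^+ 2 / (4 * t) - x ^+ 2 / (4 * t)) ^+ 2 =
    ((y - x) ^+ 2 * (y + x) ^+ 2) / (L ^+ 2 * x ^+ 2).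
    by rewrite /c; field; rewrite !gt_eqF.
  rewrite ler_pdivlMr ?mulr_gt0 ?exprn_gt0// mul1r.
  apply: ler_pM; rewrite ?sqr_ge0//.
    by rewrite -(real_normK (num_real (y - x))) lerXn2r ?nnegrE ?normr_ge0 ?(ltW L0)// ltW.
  by rewrite lerXn2r ?nnegrE ?addr_ge0 ?(ltW x0) ?(ltW y0)// lerDr ltW.
have : (0 <= I1)%E by apply: integral_ge0 => y _; rewrite lee_fin.
move: key; case: I1 => [r| |]//; rewrite ?leey//.
by rewrite -EFinD !lee_fin => h _; lra.
Qed.

End lower.

(** * Necessity of the relation between the exponents *)

Lemma powR_bounded_le0 (R : realType) (d C r0 : R) :
  (forall r, r0 <= r -> 0 < r -> r `^ d <= C) -> d <= 0.
Proof.
move=> h; rewrite leNgt; apply/negP => d0.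
set X := `|C| + 1; have X0 : 0 < X by rewrite /X; have := normr_ge0 C; lra.
set r := Num.max r0 (X `^ d^-1).
have Xr : X `^ d^-1 <= r by rewrite le_max lexx orbT.
have r_gt0 : 0 < r by apply: lt_le_trans Xr; rewrite powR_gt0.
have := h r; rewrite le_max lexx/= => /(_ isT r_gt0) hC.
have := ler_powR_nneg (ltW d0) (powR_ge0 _ _) Xr.
rewrite -powRrM mulVf ?gt_eqF// powRr1 ?(ltW X0)// => hX.
have := ler_norm C; have := le_trans hX hC; rewrite /X; lra.
Qed.

Section norm_bounds.
Context d (T : measurableType d) (R : realType) (mu : {measure set T -> \bar R}).

Lemma inve_fine (q : \bar R) : (1 <= q)%E -> (q^-1 = (fine q^-1)%:E)%E.
Proof.
case: q => [r| |]//; rewrite ?invey// lee_fin => r1.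
by rewrite inver gt_eqF//; exact: lt_le_trans r1.
Qed.

(** Covers q = +oo as well, where [fine q^-1] is 0. *)
Lemma Lnorm_ge (q : \bar R) (G : T -> \bar R) (A : set T) (v c : R) :
  (1 <= q)%E -> measurable A -> measurable_fun setT G ->
  (v%:E <= mu A)%E -> 0 < v -> 0 <= c ->
  (forall x, A x -> (c%:E <= `|G x|)%E) ->
  ((c * v `^ (fine q^-1%E))%:E <= 'N[mu]_q[G])%E.
Proof.
move=> q1 mA mG vA v0 c0 hG; rewrite unlock.
have muT : (0 < mu setT)%E.
  apply: lt_le_trans (_ : v%:E <= _)%E; first by rewrite lte_fin.
  by apply: le_trans vA _; apply: le_measure; rewrite ?inE.
case: q q1 => [r| |]//; last first.
  move=> _; rewrite muT invey/= powRr0 mulr1.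
  have [N [mN N0 hN]] := ess_sup_ge mu (abse \o G).
  have [x [Ax Nx]] : exists x, A x /\ ~ N x.
    apply: contrapT => /forallNP h.
    have AN : A `<=` N.
      by move=> x Ax; apply: contrapT => Nx; exact: (h x (conj Ax Nx)).
    have : (mu A <= mu N)%E by apply: le_measure; rewrite ?inE.
    by rewrite N0 => /(le_trans vA); rewrite lee_fin leNgt v0.
  apply: le_trans (hG x Ax) _.
  by apply: contrapT => hx; apply: Nx; apply: hN.
rewrite lee_fin => r1; have r0 : 0 < r by exact: lt_le_trans r1.
rewrite inver gt_eqF//=.
have mGr : measurable_fun setT (fun x => `|G x| `^ r)%E.
  have mG' : measurable_fun setT (fun x => `|G x|)%E by apply: measurableT_comp.
  exact: (measurableT_comp (measurable_poweR _) mG').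
have h : ((c `^ r * v)%:E <= \int[mu]_x `|G x| `^ r)%E.
  apply: (@le_trans _ _ (\int[mu]_(x in A) (cst (c `^ r)%:E x))%E).
    by rewrite integral_cst// EFinM lee_wpmul2l// lee_fin powR_ge0.
  apply: (@le_trans _ _ (\int[mu]_(x in A) `|G x| `^ r)%E).
    apply: ge0_le_integral => //.
    - by move=> x _; rewrite lee_fin powR_ge0.
    - exact: measurable_funTS.
    - move=> x Ax; rewrite -poweR_EFin; apply: gt0_ler_poweR;
        rewrite ?(ltW r0)// ?in_itv/= ?lee_fin ?leey ?andbT//.
      exact: hG.
  by apply: ge0_subset_integral => // x _; exact: poweR_ge0.
have -> : (c * v `^ r^-1)%:E = ((c `^ r * v)%:E `^ r^-1)%E.
  rewrite poweR_EFin powRM ?powR_ge0 ?(ltW v0)//.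
  by rewrite -powRrM divff ?gt_eqF// powRr1.
apply: gt0_ler_poweR; rewrite ?invr_ge0 ?(ltW r0)// in_itv/= ?leey ?andbT.
  by rewrite lee_fin mulr_ge0 ?powR_ge0 ?(ltW v0).
by apply: integral_ge0 => x _; exact: poweR_ge0.
Qed.

Lemma Lnorm_indic_le (p w : R) (A : set T) : 0 < p -> measurable A ->
  (mu A <= w%:E)%E ->
  ('N[mu]_p%:E[EFin \o (\1_A : T -> R)] <= (w `^ p^-1)%:E)%E.
Proof.
move=> p0 mA Aw; rewrite unlock.
have w0 : (0 <= w%:E)%E by exact: le_trans Aw.
have -> : (\int[mu]_x `|(EFin \o (\1_A : T -> R)) x| `^ p = mu A)%E.
  transitivity (\int[mu]_x (\1_A x)%:E)%E; last by rewrite integral_indic// setIT.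
  apply: eq_integral => x _ /=; rewrite indicE.
  by case: (x \in A); rewrite /= ?normr1 ?normr0 ?powR1 ?powR0// gt_eqF.
rewrite -poweR_EFin; apply: gt0_ler_poweR;
  by rewrite ?invr_ge0 ?(ltW p0)// in_itv/= ?leey ?andbT.
Qed.

Lemma indic_Lfun (p w : R) (A : set T) : 0 < p -> measurable A ->
  (mu A <= w%:E)%E -> (\1_A : T -> R) \in Lfun mu p%:E.
Proof.
move=> p0 mA Aw; apply: Lfun_intro; first exact: measurable_indic.
by apply: le_lt_trans (Lnorm_indic_le p0 mA Aw) _; rewrite ltry.
Qed.

End norm_bounds.

Section exponent_necessity.
Context {R : realType}.
Local Notation leb := (@lebesgue_measure R).
Local Notation RM := (measurableTypeR R).
Implicit Types (t x y T l M C r : R) (D : set RM).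
Variables (a s : R).
Hypotheses (a1 : -1 < a) (s0 : 0 < s) (sN : s < a + 1).

Let N0 : 0 < a + 1. Proof. by move: a1; lra. Qed.

Lemma II_low_cst_gt0 : 0 < (Gamma s)^-1 * pot_low_cst a.
Proof. by apply: mulr_gt0; [rewrite invr_gt0 Gamma_gt0|exact: pot_low_cst_gt0]. Qed.

Lemma dw_itv0c r : 0 <= r ->
  dw a `]0%R, r]%classic = (r `^ (2 * (a + 1)) / (2 * (a + 1)))%:E.
Proof.
move=> r0; have N20 : 0 < 2 * (a + 1) by rewrite mulr_gt0.
rewrite -(integral_powR_0c N20 r0) /dw; apply: eq_integral => x; rewrite inE/= in_itv/= => /andP[x0 _].
by rewrite gtr0_norm//; congr (_ `^ _)%:E; ring.
Qed.

Lemma integral_dw_itv (D : set RM) (h : RM -> R) : measurable D ->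
  (forall x, D x -> 0 < x) -> measurable_fun setT h -> (forall x, 0 <= h x) ->
  (\int[dw a]_(x in D) (h x)%:E = \int[leb]_(x in D) (x `^ (2 * a + 1) * h x)%:E)%E.
Proof.
move=> mD D0 mh h0; rewrite integral_mkcond [RHS]integral_mkcond.
have mhD : measurable_fun setT (fun x => h x * \1_D x).
  by apply: measurable_funM => //; exact: measurable_indic.
transitivity (\int[dw a]_x (h x * \1_D x)%:E)%E.
  apply: eq_integral => x _; rewrite patchE indicE.
  by case: (x \in D); rewrite ?mulr1 ?mulr0.
rewrite integral_dwE//; last by move=> x; rewrite mulr_ge0.
apply: eq_integral => x _; rewrite patchE indicE.
case: ifPn => [xD|_]; last by rewrite !mulr0.
by rewrite mulr1 gtr0_norm//; apply: D0; rewrite inE in xD.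
Qed.

Lemma II_indic_ge r x : 0 < r -> 0 < x ->
  (((Gamma s)^-1 * pot_low_cst a * ((x + r) `^ (2 * (s - (a + 1))) *
     (r `^ (2 * (a + 1)) / (2 * (a + 1)))))%:E <=
   II a s (\1_(`]0%R, r]%classic : set RM) : RM -> R) x)%E.
Proof.
move=> r0 x0; set S : set RM := `]0%R, r]%classic.
have mS : measurable S by exact: measurable_itv.
apply: le_trans (II_ge_powR a1 s0 x0 _ _ _); last 3 first.
- exact: measurable_indic.
- by [].
- move=> y y0; rewrite indicE memNset// /S/= in_itv/= => /andP[/lt_le_trans/(_ y0)].
  by rewrite ltxx.
rewrite [leLHS]EFinM lee_wpmul2l ?lee_fin ?(ltW II_low_cst_gt0)//.
have m1 D : measurable_fun D (fun y : RM => ((x + y) `^ (2 * (s - (a + 1))) * \1_S y)%:E).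
  apply: measurable_funTS; apply/measurable_EFinP.
  by apply: measurable_funM; [solve_meas|exact: measurable_indic].
apply: (@le_trans _ _ (\int[dw a]_(y in S) ((x + y) `^ (2 * (s - (a + 1))) * \1_S y)%:E)%E); last first.
  apply: ge0_subset_integral => //.
  - by move=> y _; rewrite lee_fin mulr_ge0 ?powR_ge0.
  - by move=> y; rewrite /S/= !in_itv/= => /andP[-> _].
apply: (@le_trans _ _ (\int[dw a]_(y in S) (cst ((x + r) `^ (2 * (s - (a + 1))))%:E y))%E).
  by rewrite integral_cst// [X in (_ * X)%E]dw_itv0c ?(ltW r0)// -EFinM.
apply: ge0_le_integral => //.
- by move=> y _; rewrite lee_fin powR_ge0.
- move=> y Sy; rewrite indicE mem_set// mulr1 lee_fin.
  move: Sy; rewrite /S/= in_itv/= => /andP[y0 yr].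
  have -> : 2 * (s - (a + 1)) = - (2 * (a + 1 - s)) by ring.
  rewrite !powRN lef_pV2 ?posrE ?powR_gt0 ?addr_gt0//.
  apply: ler_powR_nneg; rewrite ?addr_ge0 ?(ltW x0) ?(ltW y0) ?lerD2l//.
  by rewrite mulr_ge0// subr_ge0 ltW.
Qed.

(** On ]0, r] the potential of the indicator of ]0, r] is at least of order
    r^(2 s). A bound from L^p to L^q therefore gives r^d <= C for every r > 0,
    where d = 2 s + 2 (a + 1) (1/q - 1/p); letting r tend to infinity and to 0
    gives d = 0. *)
Lemma scaling_necessary (p : R) (q : \bar R) : 1 <= p -> (1 <= q)%E ->
  II_bounded a s p%:E q -> fine q^-1%E = p^-1 - s / (a + 1).
Proof.
move=> p1 q1 [_ [C hC]]; have p0 : 0 < p by exact: lt_le_trans p1.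
set iq := fine q^-1%E.
set NN := 2 * (a + 1); have NN0 : 0 < NN by rewrite mulr_gt0.
set k := (Gamma s)^-1 * pot_low_cst a.
have k0 : 0 < k by exact: II_low_cst_gt0.
set c2 := k * (2 `^ (2 * (s - (a + 1))) / NN).
have c20 : 0 < c2 by rewrite mulr_gt0// divr_gt0// powR_gt0.
have main r : 0 < r -> c2 * r `^ (2 * s) * (r `^ NN / NN) `^ iq <=
    `|C| * (r `^ NN / NN) `^ p^-1.
  move=> r0; set S : set RM := `]0%R, r]%classic.
  have mS : measurable S by exact: measurable_itv.
  have v0 : 0 < r `^ NN / NN by rewrite divr_gt0// powR_gt0.
  have SE : dw a S = (r `^ NN / NN)%:E by rewrite dw_itv0c// ltW.
  have SEle : (dw a S <= (r `^ NN / NN)%:E)%E by rewrite SE.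
  have SEge : ((r `^ NN / NN)%:E <= dw a S)%E by rewrite SE.
  have fL : (\1_S : RM -> R) \in Lfun (dw a) p%:E.
    exact: (indic_Lfun p0 mS SEle).
  have [mII hb] := hC _ fL.
  rewrite -lee_fin.
  apply: le_trans (_ : 'N[dw a]_q[II a s (\1_S : RM -> R)] <= _)%E.
    apply: (Lnorm_ge q1 mS mII SEge v0).
    - by rewrite mulr_ge0 ?powR_ge0 ?(ltW c20).
    move=> x; rewrite /S/= in_itv/= => /andP[x0 xr].
    have h := II_indic_ge r0 x0.
    apply: le_trans (lee_abs _); apply: le_trans h.
    rewrite lee_fin /c2 -/k -/NN.
    have -> : k * (2 `^ (2 * (s - (a + 1))) / NN) * r `^ (2 * s) =
      k * ((r + r) `^ (2 * (s - (a + 1))) * (r `^ NN / NN)).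
      have -> : r + r = 2 * r by ring.
      rewrite (powRM _ _ (ltW r0))//.
      have -> : r `^ (2 * s) = r `^ (2 * (s - (a + 1))) * r `^ NN.
        rewrite -powRD; last by rewrite (gt_eqF r0) implybT.
        by congr (_ `^ _); rewrite /NN; ring.
      by ring.
    rewrite ler_wpM2l ?(ltW k0)// ler_wpM2r ?(ltW v0)//.
    have -> : 2 * (s - (a + 1)) = - (2 * (a + 1 - s)) by ring.
    rewrite !powRN lef_pV2 ?posrE ?powR_gt0 ?addr_gt0//.
    apply: ler_powR_nneg; rewrite ?addr_ge0 ?(ltW x0) ?(ltW r0) ?lerD2r//.
    by rewrite mulr_ge0// subr_ge0 ltW.
  apply: le_trans hb _.
  apply: (@le_trans _ _ ((`|C|%R)%:E * 'N[dw a]_p%:E[EFin \o (\1_S : RM -> R)])%E).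
    by apply: lee_wpmul2r; [exact: Lnorm_ge0|rewrite lee_fin ler_norm].
  rewrite [leRHS]EFinM lee_wpmul2l ?lee_fin//.
  exact: (Lnorm_indic_le p0 mS SEle).
set dl := 2 * s + NN * iq - NN / p.
have bd r : 0 < r -> r `^ dl <= `|C| * (NN^-1) `^ p^-1 / (c2 * (NN^-1) `^ iq).
  move=> r0; have := main r r0.
  have NNi : 0 <= NN^-1 by rewrite invr_ge0 ltW.
  rewrite !(powRM _ (powR_ge0 _ _) NNi) -!powRrM.
  have i0 : 0 < c2 * (NN^-1) `^ iq by rewrite mulr_gt0// powR_gt0// invr_gt0.
  rewrite ler_pdivlMr// => h.
  have -> : r `^ dl = r `^ (2 * s) * r `^ (NN * iq) / r `^ (NN / p).
    rewrite -powRD ?(gt_eqF r0) ?implybT// -powRB ?(gt_eqF r0) ?implybT//.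
  rewrite mulrAC ler_pdivrMr ?powR_gt0//.
  apply: le_trans (le_trans _ h) _; rewrite le_eqVlt; apply/orP; left; apply/eqP; ring.
have d1 : dl <= 0 by apply: (powR_bounded_le0 (r0 := 0)) => r _ r0; exact: bd.
have d2 : - dl <= 0.
  apply: (powR_bounded_le0 (r0 := 0)) => r _ r0.
  have ri : 0 < r^-1 by rewrite invr_gt0.
  by rewrite -mulN1r powRrM powR_inv1 ?(ltW r0)//; exact: bd.
have : dl = 0 by apply/eqP; rewrite eq_le d1/=; lra.
rewrite /dl /NN => h; have aN : a + 1 != 0 by rewrite gt_eqF.
have : (2 * (a + 1)) * (iq - (p^-1 - s / (a + 1))) = 0.
  by rewrite -[RHS]h; field; rewrite aN gt_eqF.
by move/eqP; rewrite mulf_eq0 gt_eqF//= subr_eq0 => /eqP.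
Qed.

(** The potential of the indicator of ]0, 1] is at least k x^(2 s - 2 (a + 1))
    for x >= 1, whose q-th power times the density is a multiple of 1 / x. *)
Lemma strong_1_false (q : R) : q = (a + 1) / (a + 1 - s) -> ~ II_bounded a s 1%E q%:E.
Proof.
move=> qE [_ [C hC]].
have q0 : 0 < q by rewrite qE divr_gt0// subr_gt0.
set S : set RM := `]0%R, 1%R]%classic.
have mS : measurable S by exact: measurable_itv.
have SE : (dw a S <= (1 `^ (2 * (a + 1)) / (2 * (a + 1)))%:E)%E by rewrite dw_itv0c.
have [mII hb] := hC _ (indic_Lfun ltr01 mS SE).
have Nfin := Lfun_Lnorm_lty (indic_Lfun ltr01 mS SE).
set G := II a s (\1_S : RM -> R) in mII hb.
set k := (Gamma s)^-1 * pot_low_cst a * (2 `^ (2 * (s - (a + 1))) / (2 * (a + 1))).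
have k0 : 0 < k.
  by apply: mulr_gt0; [exact: II_low_cst_gt0|rewrite divr_gt0 ?powR_gt0 ?mulr_gt0].
have hG x : 1 <= x -> ((k * x `^ (2 * (s - (a + 1))))%:E <= `|G x|)%E.
  move=> x1; have x0 : 0 < x by lra.
  apply: le_trans (lee_abs _); apply: le_trans (II_indic_ge ltr01 x0).
  rewrite powR1 lee_fin /k -[leLHS]mulrA ler_wpM2l ?(ltW II_low_cst_gt0)//.
  rewrite mulrAC mul1r ler_wpM2r ?invr_ge0 ?mulr_ge0 ?(ltW N0)//.
  rewrite -(powRM _ _ (ltW x0))//.
  have -> : 2 * (s - (a + 1)) = - (2 * (a + 1 - s)) by ring.
  rewrite !powRN lef_pV2 ?posrE ?powR_gt0 ?addr_gt0 ?mulr_gt0//.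
  apply: ler_powR_nneg; rewrite ?addr_ge0 ?(ltW x0)//; last by lra.
  by rewrite mulr_ge0// subr_ge0 ltW.
have mGq : measurable_fun setT (fun x => `|G x| `^ q)%E.
  have mG' : measurable_fun setT (fun x => `|G x|)%E by apply: measurableT_comp.
  exact: (measurableT_comp (measurable_poweR _) mG').
have inf : (\int[dw a]_x `|G x| `^ q = +oo)%E.
  apply/eqyP => A A0.
  set T := expR (A / (k `^ q)); have kq0 : 0 < k `^ q by rewrite powR_gt0.
  have T1 : 1 <= T by rewrite -[leLHS]expR0 ler_expR divr_ge0// ltW.
  set D : set RM := `[1%R, T]%classic.
  have mD : measurable D by exact: measurable_itv.
  apply: (@le_trans _ _ (\int[dw a]_(x in D) (k `^ q * x `^ (- (2 * (a + 1))))%:E)%E).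
    rewrite integral_dw_itv//; last 3 first.
    - by move=> x; rewrite /D/= in_itv/= => /andP[x1 _]; lra.
    - by solve_meas.
    - by move=> x; rewrite mulr_ge0 ?powR_ge0.
    rewrite (_ : \int[leb]_(x in D) _ = \int[leb]_(x in D) ((k `^ q)%:E * (x^-1)%:E))%E; last first.
      apply: eq_integral => x; rewrite inE /D/= in_itv/= => /andP[x1 _].
      have x0 : 0 < x by lra.
      rewrite -EFinM mulrCA -powRD; last by rewrite (gt_eqF x0) implybT.
      rewrite (_ : 2 * a + 1 + - (2 * (a + 1)) = -1); last by ring.
      by rewrite powR_inv1// ltW.
    have mi : measurable_fun D (fun x : RM => (x^-1)%:E).
      apply: (eq_measurable_fun (fun x : RM => (x `^ (-1))%:E)).
        move=> x; rewrite inE /D/= in_itv/= => /andP[x1 _].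
        by rewrite powR_inv1//; lra.
      exact: measurable_EFin_powR.
    rewrite ge0_integralZl_EFin ?(ltW kq0)//; last first.
      move=> x; rewrite /D/= in_itv/= => /andP[x1 _]; rewrite lee_fin invr_ge0; lra.
    rewrite (_ : \int[leb]_(x in D) _ = (ln T - ln 1)%:E)%E; last first.
      apply: integral_derive_itv => // x /andP[x1 _]; have x0 : 0 < x by lra.
        exact: is_derive1_ln.
      by apply: cvgV; [rewrite gt_eqF|exact: cvg_id].
    rewrite ln1 subr0 /T expRK -EFinM lee_fin mulrCA divff ?mulr1// gt_eqF//.
  apply: (@le_trans _ _ (\int[dw a]_(x in D) `|G x| `^ q)%E); last first.
    by apply: ge0_subset_integral => // x _; exact: poweR_ge0.
  apply: ge0_le_integral => //.
  - by move=> x _; rewrite lee_fin mulr_ge0 ?powR_ge0.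
  - by apply: measurable_funTS; solve_meas.
  - exact: measurable_funTS.
  move=> x; rewrite /D/= in_itv/= => /andP[x1 _]; have x0 : 0 < x by lra.
  have -> : k `^ q * x `^ (- (2 * (a + 1))) = (k * x `^ (2 * (s - (a + 1)))) `^ q.
    rewrite (powRM _ (ltW k0) (powR_ge0 _ _)) -powRrM; congr (_ * _ `^ _).
    by rewrite qE; field; rewrite gt_eqF// subr_gt0.
  have kx0 : 0 <= k * x `^ (2 * (s - (a + 1))).
    by apply: mulr_ge0; [exact: ltW|exact: powR_ge0].
  rewrite -poweR_EFin; apply: gt0_ler_poweR;
    rewrite ?(ltW q0)// ?in_itv/= ?leey ?andbT ?lee_fin//.
  exact: hG.
have NG : ('N[dw a]_q%:E[G] = +oo)%E by rewrite unlock inf eqy_poweR ?invr_gt0.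
move: hb; rewrite NG leye_eq => /eqP h.
have : (C%:E * 'N[dw a]_1[EFin \o (\1_S : RM -> R)] < +oo)%E.
  have : (0 <= 'N[dw a]_1[EFin \o (\1_S : RM -> R)])%E by exact: Lnorm_ge0.
  move: Nfin; case: ('N[dw a]_1[EFin \o (\1_S : RM -> R)])%E => [r| |]//.
  by move=> _ _; rewrite -EFinM ltry.
by rewrite h ltxx.
Qed.

End exponent_necessity.

(** * Necessity of the upper bound on p *)

Section critical_function.
Context {R : realType}.
Local Notation leb := (@lebesgue_measure R).
Local Notation RM := (measurableTypeR R).
Implicit Types (t x y T l M C r : R) (D : set RM).
Variables (a s : R).
Hypotheses (a1 : -1 < a) (s0 : 0 < s) (sN : s < a + 1).

Let N0 : 0 < a + 1. Proof. by move: a1; lra. Qed.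

Let expR1_gt1 : (1 : R) < expR 1. Proof. by rewrite -[ltLHS]expR0 ltr_expR. Qed.

(** At infinity, a borderline case for both integrals involved: with P = (a +
    1) / s and the density y^(2 a + 1), its P-th power becomes 1 / (y (ln
    y)^P), which is integrable since P > 1, while its product with the lower
    bound (x + y)^(2 (s - (a + 1))) of the potential kernel becomes 1 / (y ln
    y), which is not. As it is bounded by 1, it lies in L^p for all p >= P. *)
Definition critical_fun (y : RM) : R :=
  if expR 1 < y then y `^ (- (2 * s)) * (ln y) `^ (-1) else 0.

Lemma measurable_critical_fun : measurable_fun setT critical_fun.
Proof.
rewrite /critical_fun; apply: measurable_fun_ifT; [| |exact: measurable_cst].
  by apply: measurable_fun_ltr; [exact: measurable_cst|exact: measurable_id].
apply: measurable_funM; first by solve_meas.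
by apply: measurable_fun_powRl; exact: measurable_ln.
Qed.

Lemma critical_fun_ge0 y : 0 <= critical_fun y.
Proof. by rewrite /critical_fun; case: ifP => // _; rewrite mulr_ge0 ?powR_ge0. Qed.

Lemma ln_gt1 y : expR 1 < y -> 1 < ln y.
Proof.
move=> ey; rewrite -[ltLHS]expRK ltr_ln ?posrE ?expR_gt0//.
by apply: lt_trans ey; exact: expR_gt0.
Qed.

Lemma critical_fun_le1 y : critical_fun y <= 1.
Proof.
rewrite /critical_fun; case: ifPn => // ey; have l1 := ln_gt1 ey.
have y1 : 1 < y by exact: lt_trans ey.
rewrite powR_inv1; last by lra.
rewrite ler_pdivrMr; last by lra.
rewrite mul1r powRN; apply: le_trans (ltW l1).
rewrite invf_le1 ?powR_gt0//; last by lra.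
have := ler_powR_nneg (c := 2 * s) _ ler01 (ltW y1).
by rewrite powR1; apply; rewrite mulr_ge0// ltW.
Qed.

Lemma integral_critical_fun_fin :
  (\int[dw a]_y (critical_fun y `^ ((a + 1) / s))%:E < +oo)%E.
Proof.
set P := (a + 1) / s; have P1 : 1 < P by rewrite ltr_pdivlMr ?mul1r.
have P0 : 0 < P by lra.
pose D : set RM := `[expR 1, +oo[%classic.
have mD : measurable D by exact: measurable_itv.
have mc : measurable_fun setT (fun y : RM => critical_fun y `^ P).
  by have m := measurable_critical_fun; solve_meas.
pose h (y : R) := (ln y) `^ (- P) * y^-1.
have hpos y : expR 1 <= y -> [/\ 0 < y, 0 < ln y & 0 <= h y].
  move=> ey; have y0 : 0 < y by exact: lt_le_trans (expR_gt0 _) ey.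
  have l0 : 0 < ln y.
    by rewrite ln_gt0//; exact: lt_le_trans expR1_gt1 ey.
  by split=> //; rewrite /h mulr_ge0 ?powR_ge0// invr_ge0 ltW.
have -> : (\int[dw a]_y (critical_fun y `^ P)%:E = \int[dw a]_(y in D) (critical_fun y `^ P)%:E)%E.
  rewrite [RHS]integral_mkcond; apply: eq_integral => y _; rewrite patchE.
  case: ifPn => // yD; rewrite /critical_fun ifF ?powR0 ?gt_eqF//.
  apply/negP => ey; move/negP: yD; apply; apply/mem_set; rewrite /D/= in_itv/= andbT.
  exact: ltW.
have Dpos y : D y -> 0 < y by rewrite /D/= in_itv/= andbT => /hpos[].
rewrite integral_dw_itv//; last by move=> y; exact: powR_ge0.
apply: (@le_lt_trans _ _ (\int[leb]_(y in D) (h y)%:E)%E).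
  apply: ge0_le_integral => //.
  - by move=> y _; rewrite lee_fin mulr_ge0 ?powR_ge0.
  - apply: measurable_funTS; apply/measurable_EFinP; apply: measurable_funM => //.
  - apply: (eq_measurable_fun (fun y : RM => (ln y `^ (- P) * y `^ (-1))%:E)).
      move=> y; rewrite inE /D/= in_itv/= andbT => /hpos[y0 _ _].
      by rewrite /h powR_inv1// ltW.
    apply: measurable_funTS; apply/measurable_EFinP; apply: measurable_funM.
      by apply: measurable_fun_powRl; exact: measurable_ln.
    by solve_meas.
  - move=> y; rewrite /D/= in_itv/= andbT => ey; have [y0 l0 h0] := hpos y ey.
    rewrite lee_fin /critical_fun; case: ifPn => [_|_]; last by rewrite powR0 ?gt_eqF// mulr0.
    rewrite powRM ?powR_ge0// -!powRrM mulrA -powRD; last by rewrite (gt_eqF y0) implybT.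
    have -> : 2 * a + 1 + - (2 * s) * P = -1.
      by rewrite /P; field; rewrite gt_eqF.
    by rewrite powR_inv1 ?(ltW y0)// mulN1r mulrC /h.
rewrite (_ : \int[leb]_(y in D) _ = (0 - (- (P - 1)^-1 * (ln (expR 1)) `^ (- (P - 1))))%:E)%E ?ltry//.
apply: (@integral_derive_pinfty _ h (fun y => - (P - 1)^-1 * (ln y) `^ (- (P - 1)))).
- by move=> y /hpos[].
- move=> y ey; have [y0 l0 _] := hpos y ey.
  have dl := is_derive1_ln y0.
  have dp := is_derive1_powR (- (P - 1)) l0.
  have dc := is_derive1_comp dp dl.
  apply: is_derive_eq; rewrite ?scaler0 ?addr0 /GRing.scale/= /h.
  rewrite (_ : - (P - 1) - 1 = - P); last by ring.
  by field; rewrite !gt_eqF// subr_gt0.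
- move=> y ey; have [y0 l0 _] := hpos y ey.
  apply: continuousM.
    apply: (@continuous_comp _ _ _ (fun y => ln y) (fun w => w `^ (- P))).
      exact: continuous_ln.
    exact: continuous_powR_gt0.
  by apply: cvgV; [rewrite gt_eqF|exact: cvg_id].
- rewrite -[X in _ --> X](mulr0 (- (P - 1)^-1)); apply: cvgM; first exact: cvg_cst.
  apply: (@cvg_comp _ _ _ (fun y => ln y) (fun w => w `^ (- (P - 1))) _ (pinfty_nbhs R)).
    apply/cvgryPge => A; near=> y.
    have Ay : expR A <= y by near: y; exact: nbhs_pinfty_ge.
    have y0 : 0 < y by exact: lt_le_trans (expR_gt0 _) Ay.
    by rewrite -[A]expRK ler_ln ?posrE ?expR_gt0.
  by apply: cvg_powRN_pinfty; rewrite subr_gt0.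
Unshelve. all: by end_near. Qed.

End critical_function.

Section necessity.
Context {R : realType}.
Local Notation leb := (@lebesgue_measure R).
Local Notation RM := (measurableTypeR R).
Implicit Types (t x y T l M C r : R) (D : set RM).
Variables (a s : R).
Hypotheses (a1 : -1 < a) (s0 : 0 < s) (sN : s < a + 1).

Let N0 : 0 < a + 1. Proof. by move: a1; lra. Qed.

Lemma critical_fun_Lfun (p : \bar R) : (1 <= p)%E -> (((a + 1) / s)%:E <= p)%E ->
  (critical_fun s : RM -> R) \in Lfun (dw a) p.
Proof.
move=> p1 pP; apply: Lfun_intro; first exact: measurable_critical_fun.
have f0 := critical_fun_ge0 s; have f1 := critical_fun_le1 s0.
have mf := measurable_critical_fun s.
rewrite unlock; case: p p1 pP => [r| |]//.
- rewrite !lee_fin => r1 Pr; apply: poweR_lty.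
  apply: le_lt_trans _ (integral_critical_fun_fin s0 sN).
  apply: ge0_le_integral => //.
  + by move=> y _; exact: poweR_ge0.
  + have m : measurable_fun setT (fun x : RM => (`|critical_fun s x| `^ r)%:E) by solve_meas.
    exact: m.
  + by apply/measurable_EFinP; solve_meas.
  + move=> y _ /=; rewrite lee_fin ger0_norm//.
    have [->|y0] := eqVneq (critical_fun s y) 0.
      rewrite !powR0 ?gt_eqF//; first by rewrite divr_gt0.
      exact: lt_le_trans r1.
    by apply: ger_powR => //; rewrite f1 lt_neqAle eq_sym y0 f0.
- move=> _ _; case: ifP => // _.
  apply: (@le_lt_trans _ _ 1%E); last exact: ltry.
  apply/ess_supP; exists set0; split => //.
  move=> y /= /negP; rewrite -ltNge => h; exfalso; move: h.
  by rewrite lte_fin ger0_norm// ltNge f1.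
Qed.

Lemma critical_fun_II x : 0 < x -> (\int[dw a]_(y in `]0%R, +oo[)
     ((x + y) `^ (2 * (s - (a + 1))) * critical_fun s y)%:E = +oo)%E.
Proof.
move=> x0; apply/eqyP => A A0.
have mf := measurable_critical_fun s; have f0 := critical_fun_ge0 s.
(* Beyond Y the function is nonzero, ln (ln y) is defined, and x + y <= 2 y. *)
set Y := Num.max x (expR 1 + 1).
have Yx : x <= Y by rewrite le_max lexx.
have Ye : expR 1 < Y by rewrite lt_max ltrDl ltr01 orbT.
have Y1 : 1 < Y by apply: lt_trans Ye; rewrite -[ltLHS]expR0 ltr_expR.
have Y0 : 0 < Y by lra.
have lY : 1 < ln Y by exact: ln_gt1.
set c := 2 `^ (2 * (s - (a + 1))) : R; have c0 : 0 < c by rewrite powR_gt0.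
(* The primitive of 1 / (y ln y) is ln (ln y), so [Y, T] contributes A. *)
set T := expR (expR (A / c + ln (ln Y))).
have lnT : ln (ln T) = A / c + ln (ln Y) by rewrite /T !expRK.
have YT : Y <= T.
  rewrite /T -[leLHS]lnK ?posrE// ler_expR -[leLHS]lnK ?posrE; last by lra.
  by rewrite ler_expR lerDr divr_ge0// ltW.
pose D : set RM := `[Y, T]%classic.
have mD : measurable D by exact: measurable_itv.
have DY y : D y -> Y <= y by rewrite /D/= in_itv/= => /andP[].
have D0 y : D y -> 0 < y by move=> /DY; exact: lt_le_trans.
have mi (B : set RM) : measurable_fun B (fun y : RM => ((x + y) `^ (2 * (s - (a + 1))) * critical_fun s y)%:E).
  by apply: measurable_funTS; solve_meas.
have i0 y : 0 <= (x + y) `^ (2 * (s - (a + 1))) * critical_fun s y by rewrite mulr_ge0 ?powR_ge0.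
apply: (@le_trans _ _ (\int[dw a]_(y in D) ((x + y) `^ (2 * (s - (a + 1))) * critical_fun s y)%:E)%E); last first.
  apply: ge0_subset_integral => //.
  - by move=> y _; rewrite lee_fin.
  - by move=> y /D0 y0; rewrite /= in_itv/= y0.
rewrite integral_dw_itv//; last by apply/measurable_EFinP.
pose h (y : R) := y^-1 * (ln y)^-1.
have hpos y : Y <= y -> 0 < y /\ 1 < ln y.
  move=> Yy; split; first exact: lt_le_trans Yy.
  by apply: ln_gt1; exact: lt_le_trans Yy.
have ih : (\int[leb]_(y in D) (h y)%:E = (A / c)%:E)%E.
  rewrite (_ : A / c = ln (ln T) - ln (ln Y)); last by rewrite lnT addrK.
  apply: (@integral_derive_itv _ h (fun y => ln (ln y))) => //.
  - move=> y /andP[Yy _]; have [y0 l1] := hpos y Yy; have l0 : 0 < ln y by lra.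
    have dl := is_derive1_ln y0; have dl2 := is_derive1_ln l0.
    have := is_derive1_comp dl2 dl; rewrite /h mulrC; exact.
  - move=> y /andP[Yy _]; have [y0 l1] := hpos y Yy; have l0 : 0 < ln y by lra.
    apply: continuousM; first by apply: cvgV; [rewrite gt_eqF|exact: cvg_id].
    by apply: cvgV; [rewrite gt_eqF|exact: continuous_ln].
have mh : measurable_fun D (fun y : RM => (h y)%:E).
  apply: (eq_measurable_fun (fun y : RM => (y `^ (-1) * ln y `^ (-1))%:E)).
    move=> y yD; have [y0 l1] := hpos y (DY y (set_mem yD)).
    by rewrite /h !powR_inv1//; lra.
  apply: measurable_funTS; apply/measurable_EFinP; apply: measurable_funM.
    by solve_meas.
  by apply: measurable_fun_powRl; exact: measurable_ln.
have h0 y : D y -> 0 <= h y.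
  by move=> /DY/hpos[y0 l1]; rewrite /h mulr_ge0// invr_ge0; lra.
apply: (@le_trans _ _ (\int[leb]_(y in D) (c%:E * (h y)%:E))%E).
  rewrite ge0_integralZl_EFin ?(ltW c0)//.
  by rewrite ih -EFinM lee_fin mulrCA divff ?mulr1// gt_eqF.
apply: ge0_le_integral => //.
- by move=> y Dy; rewrite mule_ge0 ?lee_fin ?h0// ltW.
- by apply: emeasurable_funM.
- apply: measurable_funTS; apply/measurable_EFinP; apply: measurable_funM; first by solve_meas.
  by apply/measurable_EFinP; exact: mi.
move=> y Dy; have Yy := DY y Dy; have [y0 l1] := hpos y Yy.
rewrite -EFinM lee_fin /critical_fun (lt_le_trans Ye Yy) powR_inv1; last by lra.
rewrite /h !mulrA; apply: ler_wpM2r; first by rewrite invr_ge0; lra.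
have -> : c * y^-1 = y `^ (2 * a + 1) * (2 * y) `^ (2 * (s - (a + 1))) * y `^ (- (2 * s)).
  rewrite (powRM _ _ (ltW y0))// -/c.
  have -> : y^-1 = y `^ (2 * a + 1) * y `^ (2 * (s - (a + 1))) * y `^ (- (2 * s)).
    rewrite -!powRD ?(gt_eqF y0) ?implybT//.
    rewrite (_ : _ + _ + _ = -1); last by ring.
    by rewrite powR_inv1// ltW.
  by ring.
rewrite ler_wpM2r ?powR_ge0// ler_wpM2l ?powR_ge0//.
have -> : 2 * (s - (a + 1)) = - (2 * (a + 1 - s)) by ring.
rewrite !powRN lef_pV2 ?posrE ?powR_gt0 ?mulr_gt0 ?addr_gt0//.
apply: ler_powR_nneg; rewrite ?addr_ge0 ?(ltW x0) ?(ltW y0)//.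
  by rewrite mulr_ge0// subr_ge0 ltW.
by lra.
Qed.

Lemma Dom_II_necessary (p : \bar R) : (1 <= p)%E ->
  [set` Lfun (dw a) p] `<=` Dom_II a s -> (p < ((a + 1) / s)%:E)%E.
Proof.
move=> p1 hD; rewrite ltNge; apply/negP => pP.
have [N [mN lN hN]] := hD _ (critical_fun_Lfun p1 pP).
have mf := measurable_critical_fun s; have f0 := critical_fun_ge0 s.
have sub : `]0%R, 1%R]%classic `<=` N.
  move=> x; rewrite /= in_itv/= => /andP[x0 _]; apply: hN => /= hx.
  have : (II a s (critical_fun s : RM -> R) x < +oo)%E.
    apply: le_lt_trans (lee_abs _) _.
    move/integrableP: hx => [mx ix].
    by apply: le_lt_trans (le_abse_integral _ _ _) ix.
  rewrite ltNge => /negP; apply.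
  apply: le_trans (II_ge_powR a1 s0 x0 mf f0 _).
    by rewrite critical_fun_II// gt0_muley// lte_fin II_low_cst_gt0.
  move=> y y0; rewrite /critical_fun ifF//; apply/negbTE; rewrite -leNgt.
  by apply: le_trans y0 _; exact: expR_ge0.
have : (leb `]0%R, 1%R]%classic <= leb N)%E.
  by apply: le_measure; rewrite ?inE.
rewrite lN lebesgue_measure_itv/= lte_fin ltr01 -EFinB subr0 lee_fin.
by rewrite leNgt ltr01.
Qed.

(** * Necessity of the lower bound on alpha *)

Section small_alpha.
Hypothesis a3 : a < - (1 / 2).

Local Notation L := (conc_radius a).

Let L1 : 32 <= L. Proof. exact: conc_radius_ge1. Qed.

Definition far_support r : set RM := `[r, (r + 2 * L + 1)%R]%classic.
Definition far_points r : set RM := `[(r + L)%R, (r + L + 1)%R]%classic.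

Definition far_cst : R := (Gamma s)^-1 * (1 / 8).

Lemma far_cst_gt0 : 0 < far_cst.
Proof. by rewrite mulr_gt0 ?invr_gt0 ?Gamma_gt0. Qed.

(** For x in [far_points r] the interval of radius L around x is contained in
    [far_support r], so [bheat_concentration] applies at all times t in [1,
    2]. *)
Lemma II_far_ge r x : 1 <= r -> far_points r x ->
  (far_cst%:E <= II a s (\1_(far_support r) : RM -> R) x)%E.
Proof.
move=> r1; rewrite /far_points/= in_itv/= => /andP[x1 x2].
have LL := L1; have xg1 : 1 <= x by lra. have x0 : 0 < x by lra.
have mS : measurable (far_support r) by exact: measurable_itv.
have mf : measurable_fun setT (\1_(far_support r) : RM -> R) by exact: measurable_indic.
have f0 y : 0 <= (\1_(far_support r) : RM -> R) y by [].
apply: le_trans (II_ge s a1 x0 mf f0 _); last first.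
  move=> y y0; rewrite indicE memNset// /far_support/= in_itv/= => /andP[ry _]; lra.
rewrite /far_cst EFinM lee_wpmul2l ?lee_fin ?invr_ge0 ?Gamma_ge0//.
rewrite bpot_swap//.
have mh : measurable_fun setT (fun t : RM => \int[dw a]_y (bheat a t x y * \1_(far_support r) y)%:E)%E.
  apply: (@measurable_integral_param _ _ _ _ _ (dw a) setT (fun t y : RM =>
     (bheat a t x y * \1_(far_support r) y)%:E)) => //.
  apply/measurable_EFinP; apply: measurable_funM; first by apply: measurable_bheat => //; solve_meas.
  exact: measurableT_comp.
have i0 t : (0 <= (t `^ (s - 1))%:E * \int[dw a]_y (bheat a t x y * \1_(far_support r) y)%:E)%E.
  rewrite mule_ge0 ?lee_fin ?powR_ge0//.
  by apply: integral_ge0 => y _; exact: bheat_y_ge0.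
have mi (B : set RM) : measurable_fun B (fun t : RM =>
    (t `^ (s - 1))%:E * \int[dw a]_y (bheat a t x y * \1_(far_support r) y)%:E)%E.
  apply: emeasurable_funM; first exact: measurable_EFin_powR.
  exact: measurable_funTS.
set B : set RM := `[1%R, 2%R]%classic.
have mB : measurable B by exact: measurable_itv.
apply: (@le_trans _ _ (\int[leb]_(t in B) ((t `^ (s - 1))%:E *
   \int[dw a]_y (bheat a t x y * \1_(far_support r) y)%:E))%E); last first.
  apply: ge0_subset_integral => //.
  by move=> t; rewrite /B/= !in_itv/= => /andP[t1 _]; rewrite andbT; lra.
apply: (@le_trans _ _ (\int[leb]_(t in B) (cst (1 / 8)%:E t))%E).
  rewrite integral_cst// [X in (_ * X)%E]lebesgue_measure_itv/= lte_fin.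
  by rewrite ltr1n/= -EFinB -EFinM lee_fin; lra.
apply: ge0_le_integral => //.
  by move=> t _; rewrite lee_fin; lra.
move=> t; rewrite /B/= in_itv/= => /andP[t1 t2]; have t0 : 0 < t by lra.
have -> : (1 / 8)%:E = ((1 / 2)%:E * (1 / 4)%:E)%E :> \bar R.
  by rewrite -EFinM; congr EFin; lra.
apply: (@le_trans _ _ ((t `^ (s - 1))%:E * (1 / 4)%:E)%E).
  rewrite -!EFinM lee_fin ler_wpM2r//.
  have -> : t `^ (s - 1) = t `^ s / t.
    by rewrite powRB ?powRr1 ?(ltW t0)// (gt_eqF t0) implybT.
  rewrite ler_pdivlMr//; have := ler_powR_nneg (ltW s0) ler01 t1.
  by rewrite powR1; lra.
rewrite lee_wpmul2l ?lee_fin ?powR_ge0//.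
have t12 : 1 <= t <= 2 by rewrite t1.
apply: le_trans (bheat_concentration a1 xg1 t12) _.
have mI : measurable_fun setT (fun y : RM => (bheat a t x y * \1_(far_support r) y)%:E).
  exact: measurable_bheat_y.
apply: (@le_trans _ _ (\int[dw a]_(y in `]0%R, +oo[) (bheat a t x y * \1_(far_support r) y)%:E)%E); last first.
  by apply: ge0_subset_integral => // y _; exact: bheat_y_ge0.
apply: ge0_le_integral => //.
- by move=> y _; rewrite lee_fin mulr_ge0 ?bheat_ge0//; case: ifP.
- apply: measurable_funTS; apply/measurable_EFinP.
  by apply: measurable_funM; [apply: measurable_bheat|solve_meas].
- exact: measurable_funTS.
move=> y _; rewrite lee_fin ler_wpM2l ?bheat_ge0//; case: ifP => // yx.
rewrite indicE mem_set// /far_support/= in_itv/=.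
by move: yx; rewrite ler_norml => /andP[y1 y2]; apply/andP; split; lra.
Qed.

Lemma dw_far_support r : 1 <= r ->
  (dw a (far_support r) <= ((2 * L + 1) * r `^ (2 * a + 1))%:E)%E.
Proof.
move=> r1; have LL := L1; have r0 : 0 < r by lra.
have mS : measurable (far_support r) by exact: measurable_itv.
apply: (@le_trans _ _ (\int[leb]_(x in far_support r) (cst (r `^ (2 * a + 1))%:E x))%E); last first.
  rewrite integral_cst// [X in (_ * X)%E]lebesgue_measure_itv/= lte_fin ifT; last by lra.
  by rewrite -EFinB -EFinM lee_fin (_ : r + 2 * L + 1 - r = 2 * L + 1) 1?mulrC//; ring.
apply: ge0_le_integral => //;
  do ?[exact: measurable_dw_density|by move=> x _; rewrite lee_fin powR_ge0].
move=> x; rewrite /far_support/= in_itv/= => /andP[rx _].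
have x0 : 0 < x by lra.
rewrite lee_fin gtr0_norm// (_ : 2 * a + 1 = - (- (2 * a + 1))); last by ring.
rewrite !(powRN _ (- (2 * a + 1))) lef_pV2 ?posrE ?powR_gt0//.
by apply: ler_powR_nneg => //; [move: a3; lra|lra].
Qed.

Lemma dw_far_points r : L + 1 <= r ->
  (((2 * r) `^ (2 * a + 1))%:E <= dw a (far_points r))%E.
Proof.
move=> r1; have LL := L1; have r0 : 0 < r by lra.
have mA : measurable (far_points r) by exact: measurable_itv.
apply: (@le_trans _ _ (\int[leb]_(x in far_points r) (cst ((2 * r) `^ (2 * a + 1))%:E x))%E).
  rewrite integral_cst// [X in (_ * X)%E]lebesgue_measure_itv/= lte_fin ifT; last by lra.
  by rewrite -EFinB -EFinM lee_fin (_ : r + L + 1 - (r + L) = 1) ?mulr1//; ring.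
apply: ge0_le_integral => //;
  do ?[exact: measurable_dw_density|by move=> x _; rewrite lee_fin powR_ge0].
move=> x; rewrite /far_points/= in_itv/= => /andP[rx xr].
have x0 : 0 < x by lra.
rewrite lee_fin gtr0_norm// (_ : 2 * a + 1 = - (- (2 * a + 1))); last by ring.
rewrite !(powRN _ (- (2 * a + 1))) lef_pV2 ?posrE ?powR_gt0 ?mulr_gt0//.
by apply: ler_powR_nneg => //; [move: a3; lra|lra|lra].
Qed.

(** Both sides are powers of r; as 2 a + 1 < 0 and iq < ip, the right-hand
    side decays faster. *)
Lemma far_growth_false (c C iq ip : R) : 0 < c -> iq < ip ->
  (forall r, L + 1 <= r -> c * ((2 * r) `^ (2 * a + 1)) `^ iq <=
     C * ((2 * L + 1) * r `^ (2 * a + 1)) `^ ip) -> False.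
Proof.
move=> c0 iqp h; have LL := L1.
set dl := (2 * a + 1) * (iq - ip).
have d0 : 0 < dl by rewrite /dl nmulr_rgt0 ?subr_lt0//; move: a3; lra.
set k2 := c * (2 `^ (2 * a + 1)) `^ iq.
have k20 : 0 < k2 by rewrite mulr_gt0 ?powR_gt0.
have : dl <= 0.
  apply: (@powR_bounded_le0 _ dl (C * (2 * L + 1) `^ ip / k2) (L + 1)) => r r1 r0.
  have := h r r1.
  rewrite (powRM (2 * a + 1) _ (ltW r0))// (powRM iq (powR_ge0 _ _) (powR_ge0 _ _)).
  have L2 : 0 <= 2 * L + 1 by lra.
  rewrite (powRM ip L2 (powR_ge0 _ _)) -!(powRrM r) => hh.
  have -> : r `^ dl = r `^ ((2 * a + 1) * iq) / r `^ ((2 * a + 1) * ip).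
    by rewrite -powRB ?(gt_eqF r0) ?implybT//; congr (_ `^ _); rewrite /dl; ring.
  rewrite ler_pdivlMr// mulrAC ler_pdivrMr ?powR_gt0//.
  apply: le_trans (le_trans _ hh) _; rewrite le_eqVlt; apply/orP; left; apply/eqP;
    rewrite /k2; ring.
by rewrite leNgt d0.
Qed.

Lemma Lnorm_far_support_le (p C r : R) (X : \bar R) : 1 <= r -> 0 < p ->
  (X <= C%:E * 'N[dw a]_p%:E[EFin \o (\1_(far_support r) : RM -> R)])%E ->
  (X <= (`|C| * ((2 * L + 1) * r `^ (2 * a + 1)) `^ p^-1)%:E)%E.
Proof.
move=> r1 p0 h; apply: le_trans h _.
have mS : measurable (far_support r) by exact: measurable_itv.
apply: (@le_trans _ _ ((`|C|%R)%:E * 'N[dw a]_p%:E[EFin \o (\1_(far_support r) : RM -> R)])%E).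
  by apply: lee_wpmul2r; [exact: Lnorm_ge0|rewrite lee_fin ler_norm].
rewrite [leRHS]EFinM lee_wpmul2l ?lee_fin//.
exact: (Lnorm_indic_le p0 mS (dw_far_support r1)).
Qed.

Lemma strong_small_alpha_false (p : R) (q : \bar R) : 1 <= p -> (1 <= q)%E ->
  fine q^-1%E < p^-1 -> ~ II_bounded a s p%:E q.
Proof.
move=> p1 q1 iqp [_ [C hC]]; have p0 : 0 < p by exact: lt_le_trans p1.
apply: (far_growth_false (C := `|C|) far_cst_gt0 iqp) => r r1.
have LL := L1; have r1' : 1 <= r by lra.
have mS : measurable (far_support r) by exact: measurable_itv.
have mA : measurable (far_points r) by exact: measurable_itv.
have [mII hb] := hC _ (indic_Lfun p0 mS (dw_far_support r1')).
rewrite -lee_fin; apply: Lnorm_far_support_le => //; apply: le_trans hb.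
apply: (Lnorm_ge q1 mA mII (dw_far_points r1)).
- by rewrite powR_gt0// mulr_gt0//; lra.
- exact: ltW far_cst_gt0.
- by move=> x xA; apply: le_trans (lee_abs _); exact: II_far_ge.
Qed.

Lemma weak_small_alpha_false (q : R) : 1 < q -> ~ II_weak_bounded a s 1%E q.
Proof.
move=> q1 [_ [C hC]]; have q0 : 0 < q by lra.
have iqp : q^-1 < 1^-1 by rewrite invr1 invf_lt1.
have c20 : 0 < far_cst / 2 by rewrite divr_gt0// far_cst_gt0.
apply: (far_growth_false (C := `|C|) c20 iqp) => r r1.
have LL := L1; have r1' : 1 <= r by lra.
have mS : measurable (far_support r) by exact: measurable_itv.
have mA : measurable (far_points r) by exact: measurable_itv.
have [mII hb] := hC _ (indic_Lfun ltr01 mS (dw_far_support r1')).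
rewrite -lee_fin; apply: Lnorm_far_support_le => //; apply: le_trans hb.
set G := II a s _ in mII *.
apply: le_trans (ereal_sup_ubound _); last by exists (far_cst / 2).
rewrite EFinM lee_wpmul2l ?lee_fin ?(ltW c20)// -poweR_EFin.
apply: gt0_ler_poweR; rewrite ?invr_ge0 ?(ltW q0)// ?in_itv/= ?leey ?andbT//.
  by rewrite lee_fin powR_ge0.
apply: le_trans (dw_far_points r1) _; apply: le_measure; rewrite ?inE//.
  rewrite -[X in measurable X]setTI; apply: emeasurable_fun_o_infty => //.
  exact: measurableT_comp.
move=> x xA /=; apply: lt_le_trans (_ : far_cst%:E <= _)%E.
  by rewrite lte_fin; have := far_cst_gt0; lra.
by apply: le_trans (lee_abs _); exact: II_far_ge.
Qed.

End small_alpha.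
End necessity.

(** * Characterization of the mapping properties *)

Theorem theorem2p16 (R : realType) (alpha sigma : R)
    (halpha : -1 < alpha) (hsigma0 : 0 < sigma) (hsigma1 : sigma < alpha + 1)
    (p q : \bar R) (hp : (1 <= p)%E) (hq : (1 <= q)%E) :
  [/\ [set` Lfun (dw alpha) p] `<=` Dom_II alpha sigma <->
        (p < ((alpha + 1) / sigma)%:E)%E,
      II_bounded alpha sigma p q <->
        [/\ (q^-1 = p^-1 - (sigma / (alpha + 1))%:E)%E,
            (1 < p)%E /\ (p < ((alpha + 1) / sigma)%:E)%E
          & - (1 / 2) <= alpha]
    & II_weak_bounded alpha sigma 1%E ((alpha + 1) / (alpha + 1 - sigma)) <->
        - (1 / 2) <= alpha].
Proof.
have N0 : 0 < alpha + 1 by lra.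
have Ns0 : 0 < alpha + 1 - sigma by lra.
split.
- split; first exact: Dom_II_necessary.
  case: p hp => [r| |]//; rewrite lee_fin lte_fin => r1 rN.
  by apply: Dom_II_sufficient => //; rewrite mulrC -ltr_pdivlMr.
- split.
    move=> hb; have [hD _] := hb.
    have := Dom_II_necessary halpha hsigma0 hsigma1 hp hD.
    case: p hp hb {hD} => [r| |]//; rewrite lee_fin lte_fin => r1 hb rN.
    have r0 : 0 < r by lra.
    have rinv : (r%:E^-1 = (r^-1%R)%:E)%E by rewrite inver gt_eqF.
    have sc := scaling_necessary halpha hsigma0 hsigma1 r1 hq hb.
    have qE : (q^-1 = (r^-1 - sigma / (alpha + 1))%:E)%E by rewrite inve_fine// sc.
    (* For p = 1 the relation between the exponents forces the q of the weak type bound. *)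
    have rne1 : r != 1.
      apply/negP => /eqP rE; move: hb qE; rewrite rE invr1 => hb qE.
      have e : 1 - sigma / (alpha + 1) = (alpha + 1 - sigma) / (alpha + 1).
        by field; rewrite gt_eqF.
      have qr : q = ((alpha + 1) / (alpha + 1 - sigma))%:E.
        rewrite -[q]inveK qE e inver gt_eqF ?divr_gt0//.
        by congr EFin; field; rewrite !gt_eqF.
      by move: hb; rewrite qr; apply: strong_1_false.
    split.
    + by rewrite qE rinv EFinB.
    + by rewrite !lte_fin lt_neqAle eq_sym rne1 r1.
    + rewrite leNgt; apply/negP => a3.
      apply: (strong_small_alpha_false halpha hsigma0 a3 r1 hq _ hb).
      by rewrite sc ltrBlDr ltrDl divr_gt0.
  case: p hp => [r| |]//; last by move=> _ [_ [_]].
  move=> _ [+ [+ +] a2]; rewrite !lte_fin => qE r1 rN.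
  have r0 : 0 < r by lra.
  have sp : sigma * r < alpha + 1 by rewrite mulrC -ltr_pdivlMr.
  have rinv : (r%:E^-1 = (r^-1%R)%:E)%E by rewrite inver gt_eqF.
  have d0 : 0 < alpha + 1 - sigma * r by rewrite subr_gt0.
  have qr : q = (r * hls_ratio alpha sigma r)%:E.
    rewrite -[q]inveK qE rinv -EFinB.
    have -> : r^-1 - sigma / (alpha + 1) = (alpha + 1 - sigma * r) / (r * (alpha + 1)).
      by field; rewrite !gt_eqF.
    rewrite inver gt_eqF ?divr_gt0 ?mulr_gt0//; congr EFin.
    rewrite /hls_ratio /hls_gap; field.
    by rewrite mulNr !gt_eqF.
  rewrite qr; exact: strong_sufficient.
- split.
    move=> hb; rewrite leNgt; apply/negP => a3.
    apply: (weak_small_alpha_false halpha hsigma0 a3 _ hb).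
    by rewrite ltr_pdivlMr// mul1r ltrBlDr ltrDl.
  by move=> a2; exact: weak_sufficient.
Qed.
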